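(* Let $\mathcal{Z}$ be a braided monoidal category with braiding $c$ satisfying the coequalizer assumption (see context). Then the following data define a bicategory $\underline{\mathrm{CALG}}(\mathcal{Z})$: - objects are the commutative algebras $A,B,\dots$ in $\mathcal{Z}$; - the category of morphisms from $A$ to $B$ is $\underline{\mathbf{Cosp}}(A,B)$, whose objects are cospans $A\to S\leftarrow B$ between commutative algebras and whose morphisms are isomorphism classes of 2-diagrams, with composition and identities induced by vertical composition of 2-diagrams and identity 2-diagrams; - the identity 1-morphism of $A$ is the cospan $A\xrightarrow{\mathrm{id}}A\xleftarrow{\mathrm{id}}A$, with identity 2-cell $A\xrightarrow{\mathrm{id}}A\xleftarrow{\mathrm{id}}A$; - the composition functor $\underline{\mathbf{Cosp}}(B,C)\times\underline{\mathbf{Cosp}}(A,B)\to\underline{\mathbf{Cosp}}(A,C)$ sends a pair of cospans $A\to S\leftarrow B$, $B\to T\leftarrow C$ to the composite cospan $A\to S\otimes_BT\leftarrow C$, and pairs of classes of 2-diagrams to the class of their horizontal composite; - for cospans $A\to T\leftarrow B$, $B\to S\leftarrow C$, $C\to R\leftarrow D$ the associativity isomorphism is the class of the 2-diagram $T\otimes_B(S\otimes_CR)\xrightarrow{\cong}(T\otimes_BS)\otimes_CR\xleftarrow{\mathrm{id}}(T\otimes_BS)\otimes_CR$ given by the canonical associativity isomorphism; - for a cospan $A\to T\leftarrow B$ the unit isomorphisms are the classes of the 2-diagrams $T\otimes_BB\xrightarrow{\cong}T\xleftarrow{\mathrm{id}}T$ and $A\otimes_AT\xrightarrow{\cong}T\xleftarrow{\mathrm{id}}T$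 given by the canonical isomorphisms.
   Context: Associators and unit isomorphisms of $\mathcal{Z}$ are suppressed. Algebras are unital associative with multiplication $\mu$ and unit $\iota$; homomorphisms are unital. **Coequalizer assumption**: (i) any two morphisms $L,R:U\to V$ in $\mathcal{Z}$ having a common right inverse ($\tau:V\to U$ with $L\tau=\mathrm{id}_V=R\tau$) have a coequalizer; (ii) for each $X\in\mathcal{Z}$ the functors $X\otimes-$ and $-\otimes X$ preserve these coequalizers. For an algebra $A$, a right $A$-module $M$ and a left $A$-module $N$, $\rho:M\otimes N\to M\otimes_A N$ is the coequalizer of the two action maps $M\otimes A\otimes N\to M\otimes N$. **Cospans.** A cospan $A\xrightarrow{a}S\xleftarrow{b}B$ between commutative algebras consists of commutative algebras $A,B$, an algebra $S$ (not necessarily commutative) and algebra homomorphisms $a,b$ with $\mu(\mathrm{id}\otimes a)=\mu(a\otimes\mathrm{id})c_{S,A}:S\otimes A\to S$ and $\mu(b\otimes\mathrm{id})=\mu(\mathrm{id}\otimes b)c_{B,S}:B\otimes S\to S$. The composite of $A\xrightarrow{a}S\xleftarrow{b}B$ and $B\xrightarrow{d}T\xleftarrow{e}C$ is $A\to S\otimes_BT\leftarrow C$, where $B$ acts on $S$ (right) and $T$ (left) via $b,d$ and multiplication, $S\otimes_BT$ has the unique algebra structure making $\rho:S\otimes T\to S\otimes_BT$ an algebra homomorphism for the multiplication $(\mu_S\otimes\mu_T)(\mathrm{id}\otimes c_{T,S}\otimes\mathrm{id})$ on $S\otimes T$, and the legs are $\rho(\mathrm{id}\otimes\iota_T)a$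 and $\rho(\iota_S\otimes\mathrm{id})e$. **2-diagrams.** A 2-diagram from $A\xrightarrow{a_1}S\xleftarrow{b_1}B$ to $A\xrightarrow{a_2}T\xleftarrow{b_2}B$ is a triple $S\xrightarrow{f}M\xleftarrow{g}T$ with $M$ a $T$-$S$-bimodule, $f$ a right $S$-module map, $g$ a left $T$-module map, such that $fa_1=ga_2$, $fb_1=gb_2$, and (writing $\mathrm{act}$ for the actions) $\mathrm{act}(a_2\otimes\mathrm{id}_M)=\mathrm{act}(\mathrm{id}_M\otimes a_1)c_{M,A}^{-1}:A\otimes M\to M$ and $\mathrm{act}(b_2\otimes\mathrm{id}_M)=\mathrm{act}(\mathrm{id}_M\otimes b_1)c_{B,M}:B\otimes M\to M$. A 3-cell from $(M,f,g)$ to $(M',f',g')$ is a $T$-$S$-bimodule map $\delta:M\to M'$ with $\delta f=f'$, $\delta g=g'$; two 2-diagrams are isomorphic if there is an invertible 3-cell between them. The vertical composite of $R\xrightarrow{e}M\xleftarrow{f}S$ and $S\xrightarrow{g}N\xleftarrow{h}T$ is $R\xrightarrow{u}N\otimes_SM\xleftarrow{v}T$ with $u=\rho(g\iota_S\otimes e)$, $v=\rho(h\otimes f\iota_S)$. The identity 2-diagram of $S$ is $S\xrightarrow{\mathrm{id}}S\xleftarrow{\mathrm{id}}S$. The horizontal composite of $S\xrightarrow{f}M\xleftarrow{g}S'$ (between cospans from $A$ to $B$) and $T\xrightarrow{h}N\xleftarrow{k}T'$ (between cospans from $B$ to $C$) is $S\otimes_BT\xrightarrow{f\otimes_Bh}M\otimes_BN\xleftarrow{g\otimes_Bk}S'\otimes_BT'$,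 where $B$ acts on $M$ from the right via $B\to S$ and on $N$ from the left via $B\to T'$, and the bimodule structure is induced by the right action of $S\otimes T$ on $M\otimes N$ using $c_{N,S}$ and the left action of $S'\otimes T'$ using $c_{T',M}$. *)

(* Defs.v *)
From mathcomp Require Import ssreflect ssrfun ssrbool.

Set Implicit Arguments.
Unset Strict Implicit.
Unset Printing Implicit Defensive.

Declare Scope mon_scope.
Delimit Scope mon_scope with mon.
Local Open Scope mon_scope.

Record category := Category {
  ob :> Type;
  hom : ob -> ob -> Type;
  idm : forall X, hom X X;
  comp : forall X Y Z, hom Y Z -> hom X Y -> hom X Z;
  compA : forall W X Y Z (h : hom Y Z) (g : hom X Y) (f : hom W X),
    comp h (comp g f) = comp (comp h g) f;
  comp1m : forall X Y (f : hom X Y), comp (idm Y) f = f;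
  compm1 : forall X Y (f : hom X Y), comp f (idm X) = f
}.
Arguments hom {_} _ _.
Arguments idm {_} _.
Arguments comp {_ _ _ _} _ _.

Notation "g ∘ f" := (comp g f) (at level 50, left associativity) : mon_scope.

Definition is_iso (C : category) (X Y : C) (f : hom X Y) : Prop :=
  exists g : hom Y X, g ∘ f = idm X /\ f ∘ g = idm Y.

(* [alpha], [lam], [rgt] are the associator and the left and right unit
   isomorphisms; a final V marks the inverse. *)
Record monoidal := Monoidal {
  mcat :> category;
  unit_ob : mcat;
  tens : mcat -> mcat -> mcat;
  tensm : forall X X' Y Y' : mcat,
    hom X X' -> hom Y Y' -> hom (tens X Y) (tens X' Y');
  tensm_id : forall X Y : mcat, tensm (idm X) (idm Y) = idm (tens X Y);
  tensm_comp : forall (X X' X'' Y Y' Y'' : mcat)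
    (f' : hom X' X'') (f : hom X X') (g' : hom Y' Y'') (g : hom Y Y'),
    tensm (f' ∘ f) (g' ∘ g) = tensm f' g' ∘ tensm f g;

  alpha : forall X Y Z : mcat,
    hom (tens (tens X Y) Z) (tens X (tens Y Z));
  alphaV : forall X Y Z : mcat,
    hom (tens X (tens Y Z)) (tens (tens X Y) Z);
  alphaK : forall X Y Z : mcat, alphaV X Y Z ∘ alpha X Y Z = idm _;
  alphaVK : forall X Y Z : mcat, alpha X Y Z ∘ alphaV X Y Z = idm _;
  alpha_nat : forall (X X' Y Y' Z Z' : mcat)
    (f : hom X X') (g : hom Y Y') (h : hom Z Z'),
    alpha X' Y' Z' ∘ tensm (tensm f g) h
    = tensm f (tensm g h) ∘ alpha X Y Z;

  lam : forall X : mcat, hom (tens unit_ob X) X;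
  lamV : forall X : mcat, hom X (tens unit_ob X);
  lamK : forall X : mcat, lamV X ∘ lam X = idm _;
  lamVK : forall X : mcat, lam X ∘ lamV X = idm _;
  lam_nat : forall (X Y : mcat) (f : hom X Y),
    lam Y ∘ tensm (idm unit_ob) f = f ∘ lam X;

  rgt : forall X : mcat, hom (tens X unit_ob) X;
  rgtV : forall X : mcat, hom X (tens X unit_ob);
  rgtK : forall X : mcat, rgtV X ∘ rgt X = idm _;
  rgtVK : forall X : mcat, rgt X ∘ rgtV X = idm _;
  rgt_nat : forall (X Y : mcat) (f : hom X Y),
    rgt Y ∘ tensm f (idm unit_ob) = f ∘ rgt X;

  mon_pentagon : forall W X Y Z : mcat,
    alpha W X (tens Y Z) ∘ alpha (tens W X) Y Z
    = tensm (idm W) (alpha X Y Z) ∘ alpha W (tens X Y) Z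
      ∘ tensm (alpha W X Y) (idm Z);
  mon_triangle : forall X Y : mcat,
    tensm (idm X) (lam Y) ∘ alpha X unit_ob Y = tensm (rgt X) (idm Y)
}.
Arguments unit_ob {_}.
Arguments tens {_} _ _.
Arguments tensm {_ _ _ _ _} _ _.
Arguments alpha {_} _ _ _.
Arguments alphaV {_} _ _ _.
Arguments lam {_} _.
Arguments lamV {_} _.
Arguments rgt {_} _.
Arguments rgtV {_} _.

(* [X ⊗ Y] on objects, [f ⊠ g] on morphisms. *)
Notation "X ⊗ Y" := (tens X Y) (at level 40, left associativity) : mon_scope.
Notation "f ⊠ g" := (tensm f g) (at level 40, left associativity) : mon_scope.

Record braided := Braided {
  bmon :> monoidal;
  br : forall X Y : bmon, hom (X ⊗ Y) (Y ⊗ X);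
  brV : forall X Y : bmon, hom (Y ⊗ X) (X ⊗ Y);
  brK : forall X Y : bmon, brV X Y ∘ br X Y = idm _;
  brVK : forall X Y : bmon, br X Y ∘ brV X Y = idm _;
  br_nat : forall (X X' Y Y' : bmon) (f : hom X X') (g : hom Y Y'),
    br X' Y' ∘ (f ⊠ g) = (g ⊠ f) ∘ br X Y;
  br_hexagon1 : forall X Y Z : bmon,
    alpha Y Z X ∘ br X (Y ⊗ Z) ∘ alpha X Y Z
    = (idm Y ⊠ br X Z) ∘ alpha Y X Z ∘ (br X Y ⊠ idm Z);
  br_hexagon2 : forall X Y Z : bmon,
    alphaV Z X Y ∘ br (X ⊗ Y) Z ∘ alphaV X Y Z
    = (br X Z ⊠ idm Y) ∘ alphaV X Z Y ∘ (idm X ⊠ br Y Z)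
}.
Arguments br {_} _ _.
Arguments brV {_} _ _.

(* id_X ⊗ c_{Y,Z} ⊗ id_W *)
Definition swap_mid (Z : braided) (X Y V W : Z) :
    hom ((X ⊗ Y) ⊗ (V ⊗ W)) ((X ⊗ V) ⊗ (Y ⊗ W)) :=
  alphaV X V (Y ⊗ W)
  ∘ (idm X ⊠ (alpha V Y W ∘ (br Y V ⊠ idm W) ∘ alphaV Y V W))
  ∘ alpha X Y (V ⊗ W).

Definition is_coequalizer (C : category) (U V : C) (L R : hom U V)
    (Q : C) (q : hom V Q) : Prop :=
  q ∘ L = q ∘ R /\
  forall (W : C) (h : hom V W), h ∘ L = h ∘ R ->
    exists! k : hom Q W, k ∘ q = h.

Record coequalizer (C : category) (U V : C) (L R : hom U V) := Coequalizer {
  coeq_ob : C;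
  coeq_map : hom V coeq_ob;
  coeqP : is_coequalizer L R coeq_map
}.

Definition reflexive_pair (C : category) (U V : C) (L R : hom U V) : Prop :=
  exists t : hom V U, L ∘ t = idm V /\ R ∘ t = idm V.

(* Coequalizers of reflexive pairs are given as a choice [coeq], so that
   M ⊗_A N denotes a definite object. *)
Record coequalizer_assumption (Z : monoidal) := CoequalizerAssumption {
  coeq : forall (U V : Z) (L R : hom U V),
    reflexive_pair L R -> coequalizer L R;
  coeq_tensl : forall (X U V : Z) (L R : hom U V) (Q : Z) (q : hom V Q),
    reflexive_pair L R -> is_coequalizer L R q ->
    is_coequalizer (idm X ⊠ L) (idm X ⊠ R) (idm X ⊠ q);
  coeq_tensr : forall (X U V : Z) (L R : hom U V) (Q : Z) (q : hom V Q),
    reflexive_pair L R -> is_coequalizer L R q ->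
    is_coequalizer (L ⊠ idm X) (R ⊠ idm X) (q ⊠ idm X)
}.

Record algebra_on (Z : monoidal) (S : Z) := AlgebraOn {
  mu_on : hom (S ⊗ S) S;
  iota_on : hom unit_ob S;
  mu_onA : mu_on ∘ (mu_on ⊠ idm S) = mu_on ∘ (idm S ⊠ mu_on) ∘ alpha S S S;
  mu_on1l : mu_on ∘ (iota_on ⊠ idm S) = lam S;
  mu_on1r : mu_on ∘ (idm S ⊠ iota_on) = rgt S
}.

Record algebra (Z : monoidal) := Algebra {
  acar :> Z;
  aon : algebra_on acar
}.

Definition mu (Z : monoidal) (S : algebra Z) : hom (S ⊗ S) S := mu_on (aon S).
Definition iota (Z : monoidal) (S : algebra Z) : hom unit_ob S :=
  iota_on (aon S).
Arguments mu {_} _.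
Arguments iota {_} _.

Record alghom (Z : monoidal) (A B : algebra Z) := AlgHom {
  ahom :> hom A B;
  ahom_mu : ahom ∘ mu A = mu B ∘ (ahom ⊠ ahom);
  ahom_iota : ahom ∘ iota A = iota B
}.

Record comAlg (Z : braided) := ComAlg {
  calg :> algebra Z;
  calg_comm : mu calg ∘ br calg calg = mu calg
}.

Record rmodule_on (Z : monoidal) (A : algebra Z) (M : Z) := RModuleOn {
  ract : hom (M ⊗ A) M;
  ract_mu : ract ∘ (ract ⊠ idm A) = ract ∘ (idm M ⊠ mu A) ∘ alpha M A A;
  ract_iota : ract ∘ (idm M ⊠ iota A) = rgt M
}.

Record lmodule_on (Z : monoidal) (A : algebra Z) (M : Z) := LModuleOn {
  lact : hom (A ⊗ M) M;
  lact_mu : lact ∘ (mu A ⊠ idm M) = lact ∘ (idm A ⊠ lact) ∘ alpha A A M;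
  lact_iota : lact ∘ (iota A ⊠ idm M) = lam M
}.

Record bimodule_on (Z : monoidal) (T S : algebra Z) (M : Z) := BimoduleOn {
  bim_l : lmodule_on T M;
  bim_r : rmodule_on S M;
  bim_lr : ract bim_r ∘ (lact bim_l ⊠ idm S)
    = lact bim_l ∘ (idm T ⊠ ract bim_r) ∘ alpha T M S
}.

Section Modules.
Variable Z : monoidal.

Lemma tensm_compl (X X' X'' Y : Z) (f : hom X' X'') (g : hom X X') :
  (f ∘ g) ⊠ idm Y = (f ⊠ idm Y) ∘ (g ⊠ idm Y).
Proof. by rewrite -tensm_comp comp1m. Qed.

Lemma tensm_compr (X X' X'' Y : Z) (f : hom X' X'') (g : hom X X') :
  idm Y ⊠ (f ∘ g) = (idm Y ⊠ f) ∘ (idm Y ⊠ g).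
Proof. by rewrite -tensm_comp comp1m. Qed.

Definition rregular (S : algebra Z) : rmodule_on S S :=
  @RModuleOn Z S S (mu S) (mu_onA (aon S)) (mu_on1r (aon S)).

Lemma lregular_mu (S : algebra Z) :
  mu S ∘ (mu S ⊠ idm S) = mu S ∘ (idm S ⊠ mu S) ∘ alpha S S S.
Proof. exact: mu_onA. Qed.

Definition lregular (S : algebra Z) : lmodule_on S S :=
  @LModuleOn Z S S (mu S) (lregular_mu S) (mu_on1l (aon S)).

Section Restriction.
Variables (A B : algebra Z) (f : alghom A B) (M : Z).

Lemma rrestrict_mu (m : rmodule_on B M) (a := ract m ∘ (idm M ⊠ f)) :
  a ∘ (a ⊠ idm A) = a ∘ (idm M ⊠ mu A) ∘ alpha M A A.
Proof.
rewrite /a -2!compA -tensm_comp comp1m compm1.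
have -> : (ract m ∘ (idm M ⊠ f)) ⊠ f
    = (ract m ⊠ idm B) ∘ ((idm M ⊠ f) ⊠ f) by rewrite -tensm_comp comp1m.
rewrite !compA ract_mu -!compA; congr (_ ∘ _).
by rewrite alpha_nat !compA -!tensm_comp !comp1m ahom_mu.
Qed.

Lemma rrestrict_iota (m : rmodule_on B M) :
  ract m ∘ (idm M ⊠ f) ∘ (idm M ⊠ iota A) = rgt M.
Proof. by rewrite -compA -tensm_comp comp1m ahom_iota ract_iota. Qed.

Definition rrestrict (m : rmodule_on B M) : rmodule_on A M :=
  RModuleOn (rrestrict_mu m) (rrestrict_iota m).

Lemma lrestrict_mu (m : lmodule_on B M) (a := lact m ∘ (f ⊠ idm M)) :
  a ∘ (mu A ⊠ idm M) = a ∘ (idm A ⊠ a) ∘ alpha A A M.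
Proof.
rewrite /a -!compA -tensm_comp comp1m ahom_mu.
rewrite (compA (f ⊠ idm M)) -tensm_comp comp1m compm1.
have -> : f ⊠ (lact m ∘ (f ⊠ idm M))
    = (idm B ⊠ lact m) ∘ (f ⊠ (f ⊠ idm M)) by rewrite -tensm_comp comp1m.
by rewrite tensm_compl !compA lact_mu -!compA alpha_nat.
Qed.

Lemma lrestrict_iota (m : lmodule_on B M) :
  lact m ∘ (f ⊠ idm M) ∘ (iota A ⊠ idm M) = lam M.
Proof. by rewrite -compA -tensm_comp comp1m ahom_iota lact_iota. Qed.

Definition lrestrict (m : lmodule_on B M) : lmodule_on A M :=
  LModuleOn (lrestrict_mu m) (lrestrict_iota m).

End Restriction.

Section RelativeTensor.
Variables (H : coequalizer_assumption Z) (A : algebra Z) (M N : Z).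
Variables (m : rmodule_on A M) (n : lmodule_on A N).

Lemma actions_reflexive :
  reflexive_pair (ract m ⊠ idm N) ((idm M ⊠ lact n) ∘ alpha M A N).
Proof.
exists (((idm M ⊠ iota A) ∘ rgtV M) ⊠ idm N); split.
  by rewrite -tensm_comp compA ract_iota rgtVK comp1m tensm_id.
rewrite tensm_compl compA -(compA _ (alpha _ _ _)) alpha_nat compA.
rewrite -tensm_compr lact_iota mon_triangle -tensm_comp rgtVK comp1m.
exact: tensm_id.
Qed.

Definition rtensor : Z := coeq_ob (coeq H actions_reflexive).
Definition rho : hom (M ⊗ N) rtensor := coeq_map (coeq H actions_reflexive).

End RelativeTensor.
End Modules.

Record cospan (Z : braided) (A B : comAlg Z) := Cospan {
  apex :> algebra Z;
  legl : alghom A apex;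
  legr : alghom B apex;
  legl_central :
    mu apex ∘ (idm apex ⊠ legl) = mu apex ∘ (legl ⊠ idm apex) ∘ br apex A;
  legr_central :
    mu apex ∘ (legr ⊠ idm apex) = mu apex ∘ (idm apex ⊠ legr) ∘ br B apex
}.

Section Cospans.
Variable Z : braided.

Definition id_alghom (A : algebra Z) : alghom A A.
Proof.
by refine (@AlgHom Z A A (idm A) _ _); rewrite ?tensm_id ?comp1m ?compm1.
Defined.

Lemma id_cospan_central (A : comAlg Z) :
  mu A ∘ (idm A ⊠ id_alghom A) = mu A ∘ (id_alghom A ⊠ idm A) ∘ br A A.
Proof. by rewrite /= tensm_id !compm1 calg_comm. Qed.

Lemma id_cospan_centralr (A : comAlg Z) :
  mu A ∘ (id_alghom A ⊠ idm A) = mu A ∘ (idm A ⊠ id_alghom A) ∘ br A A.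
Proof. by rewrite /= tensm_id !compm1 calg_comm. Qed.

Definition id_cospan (A : comAlg Z) : cospan A A :=
  Cospan (id_cospan_central A) (id_cospan_centralr A).

Variable H : coequalizer_assumption Z.

(* S ⊗_B T *)
Definition cosp_tensor (A B C : comAlg Z) (S : cospan A B) (T : cospan B C) :
    Z :=
  rtensor H (rrestrict (legr S) (rregular S)) (lrestrict (legl T) (lregular T)).

Definition cosp_rho (A B C : comAlg Z) (S : cospan A B) (T : cospan B C) :
    hom (S ⊗ T) (cosp_tensor S T) :=
  rho H (rrestrict (legr S) (rregular S)) (lrestrict (legl T) (lregular T)).

(* The composite cospan structure on the object S ⊗_B T; all its fields are
   determined by the requirement that [cosp_rho] be multiplicative and unital,
   since [cosp_rho S T ⊠ cosp_rho S T] is epi. *)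
Record composite (A B C : comAlg Z) (S : cospan A B) (T : cospan B C) :=
    Composite {
  cmp_alg : algebra_on (cosp_tensor S T);
  cmp_mu : mu_on cmp_alg ∘ (cosp_rho S T ⊠ cosp_rho S T)
    = cosp_rho S T ∘ ((mu S ⊠ mu T) ∘ swap_mid S T S T);
  cmp_iota : iota_on cmp_alg
    = cosp_rho S T ∘ ((iota S ⊠ iota T) ∘ lamV unit_ob);
  cmp_legl : alghom A (Algebra cmp_alg);
  cmp_legr : alghom C (Algebra cmp_alg);
  cmp_leglE : cmp_legl
    = cosp_rho S T ∘ (idm S ⊠ iota T) ∘ rgtV S ∘ legl S :> hom _ _;
  cmp_legrE : cmp_legr
    = cosp_rho S T ∘ (iota S ⊠ idm T) ∘ lamV T ∘ legr T :> hom _ _;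
  cmp_legl_central :
    mu (Algebra cmp_alg) ∘ (idm _ ⊠ cmp_legl)
    = mu (Algebra cmp_alg) ∘ (cmp_legl ⊠ idm _) ∘ br _ A;
  cmp_legr_central :
    mu (Algebra cmp_alg) ∘ (cmp_legr ⊠ idm _)
    = mu (Algebra cmp_alg) ∘ (idm _ ⊠ cmp_legr) ∘ br C _
}.

Definition composite_cospan (A B C : comAlg Z) (S : cospan A B)
    (T : cospan B C) (K : composite S T) : cospan A C :=
  Cospan (cmp_legl_central K) (cmp_legr_central K).

End Cospans.

Section TwoDiagrams.
Variable Z : braided.

Section Fixed.
Variables (A B : comAlg Z).
Implicit Types S T : cospan A B.

(* S --[td_l]--> M <--[td_r]-- T *)
Record twodiag_on S T (M : Z) := TwoDiagOn {
  td_bim : bimodule_on T S M;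
  td_l : hom S M;
  td_r : hom T M;
  td_l_linear : td_l ∘ mu S = ract (bim_r td_bim) ∘ (td_l ⊠ idm S);
  td_r_linear : td_r ∘ mu T = lact (bim_l td_bim) ∘ (idm T ⊠ td_r);
  td_legl : td_l ∘ legl S = td_r ∘ legl T;
  td_legr : td_l ∘ legr S = td_r ∘ legr T;
  td_actl : lact (bim_l td_bim) ∘ (legl T ⊠ idm M)
    = ract (bim_r td_bim) ∘ (idm M ⊠ legl S) ∘ brV M A;
  td_actr : lact (bim_l td_bim) ∘ (legr T ⊠ idm M)
    = ract (bim_r td_bim) ∘ (idm M ⊠ legr S) ∘ br B M
}.

Record twodiag S T := TwoDiag {
  td_ob : Z;
  td_on : twodiag_on S T td_ob
}.

Definition td_lact S T (M : Z) (D : twodiag_on S T M) : hom (T ⊗ M) M :=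
  lact (bim_l (td_bim D)).
Definition td_ract S T (M : Z) (D : twodiag_on S T M) : hom (M ⊗ S) M :=
  ract (bim_r (td_bim D)).

Definition is_3cell S T (D D' : twodiag S T) (d : hom (td_ob D) (td_ob D')) :
    Prop :=
  [/\ d ∘ td_lact (td_on D) = td_lact (td_on D') ∘ (idm T ⊠ d),
      d ∘ td_ract (td_on D) = td_ract (td_on D') ∘ (d ⊠ idm S),
      d ∘ td_l (td_on D) = td_l (td_on D')
    & d ∘ td_r (td_on D) = td_r (td_on D')].

Definition td_iso S T (D D' : twodiag S T) : Prop :=
  exists (d : hom (td_ob D) (td_ob D')) (d' : hom (td_ob D') (td_ob D)),
    [/\ is_3cell d, is_3cell d', d' ∘ d = idm _ & d ∘ d' = idm _].

(* Isomorphism classes of 2-diagrams, as subsets of [twodiag S T]. *)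
Definition cell S T : Type :=
  {c : twodiag S T -> Prop | exists D, c = td_iso D}.

Definition class_of S T (D : twodiag S T) : cell S T :=
  exist _ (td_iso D) (ex_intro _ D erefl).

Record cospan_hom S T := CospanHom {
  chom :> alghom S T;
  chom_legl : chom ∘ legl S = legl T;
  chom_legr : chom ∘ legr S = legr T
}.

(* The 2-diagram S --[p]--> T <--[id]-- T of a morphism of cospans p, where S
   acts on T from the right through p. *)
Section Companion.
Variables (S T : cospan A B) (p : cospan_hom S T).

Definition companion_bim : bimodule_on T S T.
Proof.
refine (@BimoduleOn Z T S T (lregular T) (rrestrict p (rregular T)) _).
rewrite /= -compA -tensm_comp comp1m compm1 tensm_compr compA.
have -> : mu T ⊠ p = (mu T ⊠ idm T) ∘ (idm (T ⊗ T) ⊠ p).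
  by rewrite -tensm_comp comp1m compm1.
by rewrite compA lregular_mu -!compA -tensm_id alpha_nat.
Defined.

Definition companion_on : twodiag_on S T T.
Proof.
refine (@TwoDiagOn S T T companion_bim p (idm T) _ _ _ _ _ _); rewrite /=.
- by rewrite -compA -tensm_comp comp1m compm1 ahom_mu.
- by rewrite comp1m tensm_id compm1.
- by rewrite comp1m chom_legl.
- by rewrite comp1m chom_legr.
- rewrite -(compA (mu T)) -tensm_comp comp1m chom_legl legl_central.
  by rewrite -(compA _ (br _ _)) brVK compm1.
- by rewrite -(compA (mu T)) -tensm_comp comp1m chom_legr legr_central.
Defined.

Definition companion : twodiag S T := TwoDiag companion_on.
End Companion.

Definition id_twodiag_bim S : bimodule_on S S S :=
  @BimoduleOn Z S S S (lregular S) (rregular S) (lregular_mu S).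

Definition id_twodiag_on S : twodiag_on S S S.
Proof.
refine (@TwoDiagOn S S S (id_twodiag_bim S) (idm S) (idm S) _ _ _ _ _ _);
  rewrite //= ?tensm_id ?comp1m ?compm1 //.
- by rewrite legl_central -compA brVK compm1.
- exact: legr_central.
Defined.

Definition id_twodiag S : twodiag S S := TwoDiag (id_twodiag_on S).

End Fixed.

Variable H : coequalizer_assumption Z.

(* N ⊗_S M, for M : R => S and N : S => T *)
Definition vtensor (A B : comAlg Z) (R S T : cospan A B)
    (M : twodiag R S) (N : twodiag S T) : Z :=
  rtensor H (bim_r (td_bim (td_on N))) (bim_l (td_bim (td_on M))).

Definition is_vcomp (A B : comAlg Z) (R S T : cospan A B)
    (M : twodiag R S) (N : twodiag S T)
    (F : twodiag_on R T (vtensor M N)) : Prop :=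
  let q := rho H (bim_r (td_bim (td_on N))) (bim_l (td_bim (td_on M))) in
  [/\ td_lact F ∘ (idm T ⊠ q)
      = q ∘ (td_lact (td_on N) ⊠ idm (td_ob M)) ∘ alphaV T (td_ob N) (td_ob M),
      td_ract F ∘ (q ⊠ idm R)
      = q ∘ (idm (td_ob N) ⊠ td_ract (td_on M)) ∘ alpha (td_ob N) (td_ob M) R,
      td_l F = q ∘ ((td_l (td_on N) ∘ iota S) ⊠ td_l (td_on M)) ∘ lamV R
    & td_r F = q ∘ (td_r (td_on N) ⊠ (td_r (td_on M) ∘ iota S)) ∘ rgtV T].

Section Horizontal.
Variables (A B C : comAlg Z) (S S' : cospan A B) (T T' : cospan B C).
Variables (M : twodiag S S') (N : twodiag T T').

(* M ⊗_B N, where B acts on M through B -> S and on N through B -> T' *)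
Definition htensor : Z :=
  rtensor H (rrestrict (legr S) (bim_r (td_bim (td_on M))))
            (lrestrict (legl T') (bim_l (td_bim (td_on N)))).

Definition hrho : hom (td_ob M ⊗ td_ob N) htensor :=
  rho H (rrestrict (legr S) (bim_r (td_bim (td_on M))))
        (lrestrict (legl T') (bim_l (td_bim (td_on N)))).

Definition is_hcomp (K : composite H S T) (K' : composite H S' T')
    (F : twodiag_on (composite_cospan K) (composite_cospan K') htensor) :
    Prop :=
  [/\ td_ract F ∘ (hrho ⊠ cosp_rho H S T)
      = hrho ∘ ((td_ract (td_on M) ⊠ td_ract (td_on N))
                ∘ swap_mid (td_ob M) (td_ob N) S T),
      td_lact F ∘ (cosp_rho H S' T' ⊠ hrho)
      = hrho ∘ ((td_lact (td_on M) ⊠ td_lact (td_on N))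
                ∘ swap_mid S' T' (td_ob M) (td_ob N)),
      td_l F ∘ cosp_rho H S T = hrho ∘ (td_l (td_on M) ⊠ td_l (td_on N))
    & td_r F ∘ cosp_rho H S' T' = hrho ∘ (td_r (td_on M) ⊠ td_r (td_on N))].

End Horizontal.
End TwoDiagrams.

(* Composition is written in applicative order: [comp1 g f] is g after f, and
   similarly for [vcomp] and [hcomp]. *)
Record bicategory_data := BicategoryData {
  cell0 : Type;
  cell1 : cell0 -> cell0 -> Type;
  cell2 : forall A B, cell1 A B -> cell1 A B -> Type;
  id2 : forall A B (f : cell1 A B), cell2 f f;
  vcomp : forall A B (f g h : cell1 A B),
    cell2 g h -> cell2 f g -> cell2 f h;
  id1 : forall A, cell1 A A;
  comp1 : forall A B C, cell1 B C -> cell1 A B -> cell1 A C;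
  hcomp : forall A B C (g g' : cell1 B C) (f f' : cell1 A B),
    cell2 g g' -> cell2 f f' -> cell2 (comp1 g f) (comp1 g' f');
  assoc2 : forall A B C D (h : cell1 C D) (g : cell1 B C) (f : cell1 A B),
    cell2 (comp1 (comp1 h g) f) (comp1 h (comp1 g f));
  lunit2 : forall A B (f : cell1 A B), cell2 (comp1 (id1 B) f) f;
  runit2 : forall A B (f : cell1 A B), cell2 (comp1 f (id1 A)) f
}.
Arguments id2 {_ _ _} f.
Arguments vcomp {_ _ _ _ _ _} _ _.
Arguments id1 {_} A.
Arguments comp1 {_ _ _ _} g f.
Arguments hcomp {_ _ _ _ _ _ _ _} _ _.
Arguments assoc2 {_ _ _ _ _} h g f.
Arguments lunit2 {_ _ _} f.
Arguments runit2 {_ _ _} f.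

Definition invertible2 (X : bicategory_data) (A B : cell0 X)
    (f g : cell1 A B) (a : cell2 f g) : Prop :=
  exists b : cell2 g f, vcomp b a = id2 f /\ vcomp a b = id2 g.

Record is_bicategory (X : bicategory_data) : Prop := IsBicategory {
  vcompA : forall (A B : cell0 X) (e f g h : cell1 A B)
    (c : cell2 g h) (b : cell2 f g) (a : cell2 e f),
    vcomp c (vcomp b a) = vcomp (vcomp c b) a;
  vcomp_id2l : forall (A B : cell0 X) (f g : cell1 A B) (a : cell2 f g),
    vcomp (id2 g) a = a;
  vcomp_id2r : forall (A B : cell0 X) (f g : cell1 A B) (a : cell2 f g),
    vcomp a (id2 f) = a;

  hcomp_id2 : forall (A B C : cell0 X) (g : cell1 B C) (f : cell1 A B),
    hcomp (id2 g) (id2 f) = id2 (comp1 g f);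
  hcomp_vcomp : forall (A B C : cell0 X)
    (g g' g'' : cell1 B C) (f f' f'' : cell1 A B)
    (b' : cell2 g' g'') (b : cell2 g g') (a' : cell2 f' f'') (a : cell2 f f'),
    hcomp (vcomp b' b) (vcomp a' a) = vcomp (hcomp b' a') (hcomp b a);

  assoc2_inv : forall (A B C D : cell0 X)
    (h : cell1 C D) (g : cell1 B C) (f : cell1 A B),
    invertible2 (assoc2 h g f);
  assoc2_nat : forall (A B C D : cell0 X)
    (h h' : cell1 C D) (g g' : cell1 B C) (f f' : cell1 A B)
    (c : cell2 h h') (b : cell2 g g') (a : cell2 f f'),
    vcomp (assoc2 h' g' f') (hcomp (hcomp c b) a)
    = vcomp (hcomp c (hcomp b a)) (assoc2 h g f);

  lunit2_inv : forall (A B : cell0 X) (f : cell1 A B), invertible2 (lunit2 f);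
  lunit2_nat : forall (A B : cell0 X) (f f' : cell1 A B) (a : cell2 f f'),
    vcomp (lunit2 f') (hcomp (id2 (id1 B)) a) = vcomp a (lunit2 f);
  runit2_inv : forall (A B : cell0 X) (f : cell1 A B), invertible2 (runit2 f);
  runit2_nat : forall (A B : cell0 X) (f f' : cell1 A B) (a : cell2 f f'),
    vcomp (runit2 f') (hcomp a (id2 (id1 A))) = vcomp a (runit2 f);

  bicat_pentagon : forall (A B C D E : cell0 X) (k : cell1 D E)
    (h : cell1 C D) (g : cell1 B C) (f : cell1 A B),
    vcomp (assoc2 k h (comp1 g f)) (assoc2 (comp1 k h) g f)
    = vcomp (hcomp (id2 k) (assoc2 h g f))
        (vcomp (assoc2 k (comp1 h g) f) (hcomp (assoc2 k h g) (id2 f)));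
  bicat_triangle : forall (A B C : cell0 X) (g : cell1 B C) (f : cell1 A B),
    vcomp (hcomp (id2 g) (lunit2 f)) (assoc2 g (id1 B) f)
    = hcomp (runit2 g) (id2 f)
}.

(* The operations whose existence is part of the claim that CALG(Z) is well
   defined. Each specification determines the corresponding operation. *)
Record CALG_data (Z : braided) (H : coequalizer_assumption Z) := CALGData {
  cg_comp : forall (A B C : comAlg Z) (S : cospan A B) (T : cospan B C),
    composite H S T;
  cg_cosp := fun (A B C : comAlg Z) (S : cospan A B) (T : cospan B C) =>
    composite_cospan (cg_comp S T);

  cg_vcomp : forall (A B : comAlg Z) (R S T : cospan A B),
    cell S T -> cell R S -> cell R T;
  cg_vcompP : forall (A B : comAlg Z) (R S T : cospan A B)
    (M : twodiag R S) (N : twodiag S T),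
    exists2 F : twodiag_on R T (vtensor H M N), is_vcomp F &
      cg_vcomp (class_of N) (class_of M) = class_of (TwoDiag F);

  cg_hcomp : forall (A B C : comAlg Z) (T T' : cospan B C) (S S' : cospan A B),
    cell T T' -> cell S S' -> cell (cg_cosp S T) (cg_cosp S' T');
  cg_hcompP : forall (A B C : comAlg Z) (T T' : cospan B C)
    (S S' : cospan A B) (N : twodiag T T') (M : twodiag S S'),
    exists2 F : twodiag_on (cg_cosp S T) (cg_cosp S' T') (htensor H M N),
      is_hcomp F &
      cg_hcomp (class_of N) (class_of M) = class_of (TwoDiag F);

  cg_assoc : forall (A B C D : comAlg Z)
    (R : cospan C D) (S : cospan B C) (T : cospan A B),
    cell (cg_cosp T (cg_cosp S R)) (cg_cosp (cg_cosp T S) R);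
  cg_assocP : forall (A B C D : comAlg Z)
    (R : cospan C D) (S : cospan B C) (T : cospan A B),
    exists p : cospan_hom (cg_cosp T (cg_cosp S R)) (cg_cosp (cg_cosp T S) R),
      [/\ is_iso p,
          p ∘ cosp_rho H T (cg_cosp S R) ∘ (idm T ⊠ cosp_rho H S R)
          = cosp_rho H (cg_cosp T S) R ∘ (cosp_rho H T S ⊠ idm R)
            ∘ alphaV T S R
        & cg_assoc R S T = class_of (companion p)];

  cg_lunit : forall (A B : comAlg Z) (T : cospan A B),
    cell (cg_cosp T (id_cospan B)) T;
  cg_lunitP : forall (A B : comAlg Z) (T : cospan A B),
    exists p : cospan_hom (cg_cosp T (id_cospan B)) T,
      [/\ is_iso p,
          p ∘ cosp_rho H T (id_cospan B) = mu T ∘ (idm T ⊠ legr T)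
        & cg_lunit T = class_of (companion p)];

  cg_runit : forall (A B : comAlg Z) (T : cospan A B),
    cell (cg_cosp (id_cospan A) T) T;
  cg_runitP : forall (A B : comAlg Z) (T : cospan A B),
    exists p : cospan_hom (cg_cosp (id_cospan A) T) T,
      [/\ is_iso p,
          p ∘ cosp_rho H (id_cospan A) T = mu T ∘ (legl T ⊠ idm T)
        & cg_runit T = class_of (companion p)]
}.

Definition CALG (Z : braided) (H : coequalizer_assumption Z)
    (d : CALG_data H) : bicategory_data :=
  @BicategoryData (comAlg Z) (@cospan Z) (@cell Z)
    (fun A B S => class_of (id_twodiag S))
    (@cg_vcomp Z H d)
    (@id_cospan Z)
    (fun A B C T S => cg_cosp d S T)
    (@cg_hcomp Z H d)
    (@cg_assoc Z H d)
    (@cg_lunit Z H d)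
    (@cg_runit Z H d).

(* Main.v *)
From Stdlib Require Import FunctionalExtensionality PropExtensionality.
From Stdlib Require Import ProofIrrelevance ClassicalEpsilon.
From mathcomp Require Import ssreflect ssrfun ssrbool.
Require Import Defs.

(** A 2-diagram from S to T is the same thing as a T-S-bimodule M with a point
    1 -> M (the common image of the units of S and T) on which the two actions
    of A, and of B, agree up to the braiding. Composites are characterised up to
    isomorphism as universal balanced operations: a vertical composite of M and
    N is a pointed bimodule with a universal S-balanced, T-R-linear operation on
    N ⊗ M, and similarly for horizontal composites over B. Every axiom then
    amounts to comparing two operations with the same universal property; the
    interchange law rests on elements s ⊗ 1 and 1 ⊗ t of S' ⊗_B T' acting
    separately on the two factors of M' ⊗_B N'.

    The canonical isomorphisms enter as 2-diagrams S -> T <- T of morphisms of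
    cospans; these compose like morphisms, and composing an arbitrary 2-diagram
    with one of them restricts an action.

    To suppress associators, an operation f : X ⊗ Y -> V is replaced by its hats
    h2 f W : X ⊗ (Y ⊗ W) -> V ⊗ W for all W, and likewise h0, h1 and hb for
    points, morphisms and the braiding. Together with the whiskerings U ◁ - these
    satisfy strict interchange and naturality equations between right-nested
    tensor products. *)

Set Implicit Arguments.
Unset Strict Implicit.
Unset Printing Implicit Defensive.

Local Open Scope mon_scope.

(** * Coherence *)

(** Statements about cospans are special cases of statements about 2-diagrams: the multiplication of
    an algebra [S] is both actions of its identity 2-diagram. The multiplication of a composite
    cospan, its associator and its unit isomorphisms are therefore obtained from the lemmas on
    general bimodules, taken at identity 2-diagrams. Equations between maps out of iterated
    quotients are lifted to plain tensor products, since every quotient map stays epi after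
    tensoring on both sides. Maps out of such quotients descend along one quotient map at a time,
    and this is where the work lies. The hard case is the inverse of the interchange map: its source
    is balanced over the two middle algebras and over [B], whereas its target is known to be
    balanced only over the composite of the middle algebras. Composing with the 2-diagram of a
    morphism [p'] on the target side has a simple description only when [p'] is invertible, which
    holds for every structural isomorphism. Because composites are fixed up to isomorphism by their
    universal property, the axioms hold for every choice of operations meeting the specification,
    whichever representatives it picked. *)

Section Coherence.
Variable Z : monoidal.
Implicit Types U V W X Y : Z.

Lemma alphaVE1 X Y V W (f : hom W _) : alphaV X Y V ∘ (alpha X Y V ∘ f) = f.
Proof. by rewrite compA alphaK comp1m. Qed.

Lemma alphaVE2 X Y V W (f : hom W _) : alpha X Y V ∘ (alphaV X Y V ∘ f) = f.
Proof. by rewrite compA alphaVK comp1m. Qed.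

Lemma unit_tensl_inj X Y (f g : hom X Y) :
  idm unit_ob ⊠ f = idm unit_ob ⊠ g -> f = g.
Proof.
move=> e; rewrite -(compm1 f) -(compm1 g) -(lamVK X) !compA -!lam_nat.
by rewrite e.
Qed.

Lemma unit_tensr_inj X Y (f g : hom X Y) :
  f ⊠ idm unit_ob = g ⊠ idm unit_ob -> f = g.
Proof.
move=> e; rewrite -(compm1 f) -(compm1 g) -(rgtVK X) !compA -!rgt_nat.
by rewrite e.
Qed.

Lemma alphaV_nat X X' Y Y' V V' (f : hom X X') (g : hom Y Y') (h : hom V V') :
  alphaV X' Y' V' ∘ (f ⊠ (g ⊠ h)) = ((f ⊠ g) ⊠ h) ∘ alphaV X Y V.
Proof.
rewrite -[LHS]compm1 -(alphaVK X Y V) compA -(compA _ _ (alpha _ _ _)).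
by rewrite -alpha_nat compA alphaK comp1m.
Qed.

(** Kelly's argument: tensoring with the unit is faithful, and after whiskering by [unit_ob] and
    precomposing with invertible associators the claim is a pentagon with two triangles filled
    in. *)
Lemma lam_tens X Y : lam (X ⊗ Y) ∘ alpha unit_ob X Y = lam X ⊠ idm Y.
Proof.
apply: unit_tensl_inj.
rewrite tensm_compr.
set a := alpha unit_ob unit_ob X ⊠ idm Y.
suff: (idm unit_ob ⊠ lam (X ⊗ Y)) ∘ (idm unit_ob ⊠ alpha unit_ob X Y)
       ∘ alpha unit_ob (unit_ob ⊗ X) Y ∘ a
     = idm unit_ob ⊠ (lam X ⊠ idm Y) ∘ alpha unit_ob (unit_ob ⊗ X) Y ∘ a.
  have ka : a ∘ (alphaV unit_ob unit_ob X ⊠ idm Y) = idm _.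
    by rewrite -tensm_comp alphaVK comp1m tensm_id.
  move=> /(congr1 (fun f => f ∘ (alphaV unit_ob unit_ob X ⊠ idm Y))).
  rewrite -!(compA _ a) ka !compm1.
  move=> /(congr1 (fun f => f ∘ alphaV _ _ _)).
  by rewrite -!(compA _ (alpha _ _ _)) alphaVK !compm1.
rewrite -(alpha_nat (idm unit_ob) (lam X)).
rewrite -(compA (alpha _ X Y) _ a) -[in RHS]tensm_comp mon_triangle comp1m.
rewrite -!(compA (_ ⊠ lam _)).
by rewrite -mon_pentagon compA mon_triangle -(tensm_id X Y) alpha_nat.
Qed.

(** Naturality of [lam] at the invertible map [lam unit_ob] identifies [lam (unit_ob ⊗ unit_ob)]
    with the whiskered [lam unit_ob]; the triangle then applies. *)
Lemma lam_rgt_unit : lam (unit_ob : Z) = rgt unit_ob.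
Proof.
apply: unit_tensr_inj; rewrite -mon_triangle -lam_tens.
congr (_ ∘ _).
have := lam_nat (lam (unit_ob : Z)).
move=> /(congr1 (fun f => lamV _ ∘ f)).
by rewrite !compA lamK !comp1m.
Qed.

End Coherence.

(** * Whiskered operations *)

Fact hat_key : unit. Proof. exact: tt. Qed.

Section Hats.
Variable Z : braided.
Implicit Types U V W X Y : Z.

(* Locked, so that rewriting with [compA] never looks inside the hats. *)
Definition wl U X Y (f : hom X Y) : hom (U ⊗ X) (U ⊗ Y) :=
  locked_with hat_key (idm U ⊠ f).
Definition h1 X Y (f : hom X Y) W : hom (X ⊗ W) (Y ⊗ W) :=
  locked_with hat_key (f ⊠ idm W).
Definition h0 X (f : hom unit_ob X) W : hom W (X ⊗ W) :=
  locked_with hat_key ((f ⊠ idm W) ∘ lamV W).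
Definition h2 X Y V (f : hom (X ⊗ Y) V) W : hom (X ⊗ (Y ⊗ W)) (V ⊗ W) :=
  locked_with hat_key ((f ⊠ idm W) ∘ alphaV X Y W).
Definition hb X Y W : hom (X ⊗ (Y ⊗ W)) (Y ⊗ (X ⊗ W)) :=
  locked_with hat_key (alpha Y X W ∘ (br X Y ⊠ idm W) ∘ alphaV X Y W).
Definition hbV X Y W : hom (Y ⊗ (X ⊗ W)) (X ⊗ (Y ⊗ W)) :=
  locked_with hat_key (alpha X Y W ∘ (brV X Y ⊠ idm W) ∘ alphaV Y X W).

Lemma wlE U X Y (f : hom X Y) : wl U f = idm U ⊠ f.
Proof. by rewrite /wl unlock. Qed.
Lemma h1E X Y (f : hom X Y) W : h1 f W = f ⊠ idm W.
Proof. by rewrite /h1 unlock. Qed.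
Lemma h0E X (f : hom unit_ob X) W : h0 f W = h1 f W ∘ lamV W.
Proof. by rewrite /h0 /h1 !unlock. Qed.
Lemma h2E X Y V (f : hom (X ⊗ Y) V) W : h2 f W = h1 f W ∘ alphaV X Y W.
Proof. by rewrite /h2 /h1 !unlock. Qed.
Lemma hbE X Y W : hb X Y W = alpha Y X W ∘ h1 (br X Y) W ∘ alphaV X Y W.
Proof. by rewrite /hb /h1 !unlock. Qed.
Lemma hbVE X Y W : hbV X Y W = alpha X Y W ∘ h1 (brV X Y) W ∘ alphaV Y X W.
Proof. by rewrite /hbV /h1 !unlock. Qed.

Local Notation "U ◁ f" := (wl U f) (at level 39, right associativity).

Lemma wlD U X Y V (f : hom Y V) (g : hom X Y) : U ◁ (f ∘ g) = U ◁ f ∘ U ◁ g.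
Proof. by rewrite !wlE tensm_compr. Qed.
Lemma wl_id U X : U ◁ idm X = idm _.
Proof. by rewrite wlE tensm_id. Qed.

Lemma h1D X Y V (f : hom Y V) (g : hom X Y) W : h1 (f ∘ g) W = h1 f W ∘ h1 g W.
Proof. by rewrite !h1E tensm_compl. Qed.
Lemma h1_id X W : h1 (idm X) W = idm _.
Proof. by rewrite h1E tensm_id. Qed.
Lemma tensm_wlh1 X Y V W (f : hom X Y) (g : hom V W) :
  f ⊠ g = h1 f W ∘ X ◁ g.
Proof. by rewrite h1E wlE -tensm_comp comp1m compm1. Qed.

Lemma h2D X Y V V' (f : hom V V') (g : hom (X ⊗ Y) V) W :
  h2 (f ∘ g) W = h1 f W ∘ h2 g W.
Proof. by rewrite !h2E h1D -compA. Qed.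
Lemma h0D X Y (f : hom X Y) (g : hom unit_ob X) W :
  h0 (f ∘ g) W = h1 f W ∘ h0 g W.
Proof. by rewrite !h0E h1D -compA. Qed.
Lemma h2_wl X Y Y' V (f : hom (X ⊗ Y) V) (g : hom Y' Y) W :
  h2 (f ∘ X ◁ g) W = h2 f W ∘ X ◁ h1 g W.
Proof. by rewrite !h2E h1D -!compA !h1E !wlE alphaV_nat. Qed.
Lemma h2_h1 X X' Y V (f : hom (X ⊗ Y) V) (g : hom X' X) W :
  h2 (f ∘ h1 g Y) W = h2 f W ∘ h1 g (Y ⊗ W).
Proof. by rewrite !h2E h1D -!compA !h1E -alphaV_nat tensm_id. Qed.
Lemma h2_br X Y V (f : hom (Y ⊗ X) V) W :
  h2 (f ∘ br X Y) W = h2 f W ∘ hb X Y W.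
Proof. by rewrite !h2E hbE h1D -!compA alphaVE1. Qed.
Lemma h2_brV X Y V (f : hom (Y ⊗ X) V) W :
  h2 (f ∘ brV Y X) W = h2 f W ∘ hbV Y X W.
Proof. by rewrite !h2E hbVE h1D -!compA alphaVE1. Qed.

Lemma wl_h1 X Y V W (f : hom X Y) (g : hom V W) :
  Y ◁ g ∘ h1 f V = h1 f W ∘ X ◁ g.
Proof. by rewrite !wlE !h1E -!tensm_comp !comp1m !compm1. Qed.
Lemma wl_h0 X V W (f : hom unit_ob X) (g : hom V W) :
  X ◁ g ∘ h0 f V = h0 f W ∘ g.
Proof.
have e : lamV W ∘ g = unit_ob ◁ g ∘ lamV V.
  by rewrite -[RHS]comp1m -lamK -compA (compA (lam W)) wlE lam_nat -!compA lamVK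
     compm1.
by rewrite !h0E compA wl_h1 -!compA e.
Qed.
Lemma wl_h2 X Y U V W (f : hom (X ⊗ Y) U) (g : hom V W) :
  U ◁ g ∘ h2 f V = h2 f W ∘ X ◁ (Y ◁ g).
Proof.
rewrite !h2E compA wl_h1 -!compA; congr (_ ∘ _).
by rewrite !wlE alphaV_nat tensm_id.
Qed.
Lemma wl_hb X Y V W (g : hom V W) :
  Y ◁ (X ◁ g) ∘ hb X Y V = hb X Y W ∘ X ◁ (Y ◁ g).
Proof.
have e A B : A ◁ (B ◁ g) ∘ alpha A B V = alpha A B W ∘ (A ⊗ B) ◁ g.
  by rewrite !wlE -alpha_nat tensm_id.
rewrite !hbE !compA e -!compA; congr (_ ∘ _); rewrite compA wl_h1 -!compA.
by congr (_ ∘ _); rewrite !wlE alphaV_nat tensm_id.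
Qed.

Lemma hbK X Y W : hbV X Y W ∘ hb X Y W = idm _.
Proof.
rewrite hbE hbVE -!compA alphaVE1 (compA (h1 (brV _ _) _)) -h1D brK h1_id comp1m.
by rewrite alphaVK.
Qed.
Lemma hbVK X Y W : hb X Y W ∘ hbV X Y W = idm _.
Proof.
rewrite hbE hbVE -!compA alphaVE1 (compA (h1 (br _ _) _)) -h1D brVK h1_id comp1m.
by rewrite alphaVK.
Qed.

Lemma hb_h1l X X' Y W (f : hom X X') :
  hb X' Y W ∘ h1 f (Y ⊗ W) = Y ◁ h1 f W ∘ hb X Y W.
Proof.
rewrite !hbE !h1E !wlE -!compA -tensm_id alphaV_nat (compA (br _ _ ⊠ _)).
by rewrite -tensm_comp br_nat tensm_comp !compA -alpha_nat.
Qed.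
Lemma hb_h1r X Y Y' W (f : hom Y Y') :
  hb X Y' W ∘ X ◁ h1 f W = h1 f (X ⊗ W) ∘ hb X Y W.
Proof.
rewrite !hbE !h1E !wlE -!compA alphaV_nat (compA (br _ _ ⊠ _)).
by rewrite -tensm_comp br_nat tensm_comp -tensm_id !compA -alpha_nat.
Qed.

Lemma mon_pentagonh X Y V W :
  alpha X Y (V ⊗ W) ∘ alpha (X ⊗ Y) V W
  = X ◁ alpha Y V W ∘ (alpha X (Y ⊗ V) W ∘ h1 (alpha X Y V) W).
Proof. by rewrite mon_pentagon wlE h1E compA. Qed.

Lemma alpha_h1h1 X X' Y V (f : hom X X') :
  alpha X' Y V ∘ h1 (h1 f Y) V = h1 f (Y ⊗ V) ∘ alpha X Y V.
Proof. by rewrite !h1E alpha_nat tensm_id. Qed.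

Lemma alpha_h1wl X Y Y' V (f : hom Y Y') :
  alpha X Y' V ∘ h1 (X ◁ f) V = X ◁ h1 f V ∘ alpha X Y V.
Proof. by rewrite !h1E !wlE alpha_nat. Qed.

Lemma pentagonV1 X Y V W :
  alpha X (Y ⊗ V) W ∘ h1 (alpha X Y V) W
  = X ◁ alphaV Y V W ∘ (alpha X Y (V ⊗ W) ∘ alpha (X ⊗ Y) V W).
Proof. by rewrite mon_pentagonh (compA (X ◁ _)) -wlD alphaK wl_id comp1m. Qed.

Lemma pentagonV2 X Y V W :
  alpha (X ⊗ Y) V W ∘ h1 (alphaV X Y V) W
  = alphaV X Y (V ⊗ W) ∘ (X ◁ alpha Y V W ∘ alpha X (Y ⊗ V) W).
Proof.
rewrite -[LHS]comp1m -alphaK -compA; congr (_ ∘ _).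
rewrite (compA (alpha X Y _)) mon_pentagonh -!compA -h1D alphaVK.
by rewrite h1_id compm1.
Qed.

Lemma pentagonV3 X Y V W :
  alpha X (Y ⊗ V) W ∘ (h1 (alpha X Y V) W
    ∘ (alphaV (X ⊗ Y) V W ∘ alphaV X Y (V ⊗ W))) = X ◁ alphaV Y V W.
Proof. by rewrite compA pentagonV1 -!compA alphaVE2 alphaVK compm1. Qed.

Lemma br_tensl X Y U : br (X ⊗ Y) U =
  alpha U X Y ∘ (h1 (br X U) Y ∘ (alphaV X U Y ∘ (X ◁ br Y U ∘ alpha X Y U))).
Proof.
have := br_hexagon2 X Y U.
move/(congr1 (fun f => alpha _ _ _ ∘ f ∘ alpha _ _ _)).
by rewrite -!compA alphaVE2 alphaK compm1 h1E wlE.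
Qed.

Lemma br_tensr U X Y : br U (X ⊗ Y) =
  alphaV X Y U ∘ (X ◁ br U Y ∘ (alpha X U Y ∘ (h1 (br U X) Y ∘ alphaV U X Y))).
Proof.
have := br_hexagon1 U X Y.
move/(congr1 (fun f => alphaV _ _ _ ∘ f ∘ alphaV _ _ _)).
by rewrite -!compA alphaVE1 alphaVK compm1 h1E wlE.
Qed.

(** This is the hexagon for right-nested products. Expanding the braiding by [br_tensl] leaves only
    associators, which the three pentagon corollaries above rearrange. *)
Lemma hb_tensl X Y U W :
  hb (X ⊗ Y) U W ∘ alphaV X Y (U ⊗ W)
  = U ◁ alphaV X Y W ∘ (hb X U (Y ⊗ W) ∘ X ◁ hb Y U W).
Proof.
rewrite !hbE br_tensl !h1D -!compA compA pentagonV1 -!compA.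
congr (_ ∘ (_ ∘ _)).
rewrite (compA (alpha _ _ _)) alpha_h1h1 -!compA; congr (_ ∘ _).
rewrite (compA (alpha _ _ _)) pentagonV2 -!compA.
congr (_ ∘ _); rewrite !wlD; congr (_ ∘ _).
by rewrite (compA (alpha _ _ _)) alpha_h1wl -!compA pentagonV3.
Qed.

Lemma hb_tensr X Y U W :
  hb U (X ⊗ Y) W ∘ U ◁ alphaV X Y W
  = alphaV X Y (U ⊗ W) ∘ (X ◁ hb U Y W ∘ hb U X (Y ⊗ W)).
Proof.
rewrite !hbE br_tensr !h1D -!compA (compA (alpha (X ⊗ Y) _ _)) pentagonV2.
rewrite -!compA; congr (_ ∘ _); rewrite !wlD -?compA; congr (_ ∘ _).
rewrite (compA (alpha _ _ _)) alpha_h1wl -!compA; congr (_ ∘ _).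
rewrite (compA (alpha _ _ _)) pentagonV1 -!compA; congr (_ ∘ _).
congr (_ ∘ _); rewrite (compA (alpha _ _ _)) alpha_h1h1 -!compA.
congr (_ ∘ _); rewrite (compA (alpha _ _ _)) pentagonV2 -!compA.
by rewrite (compA (alpha U _ _)) alphaVK comp1m -wlD alphaVK wl_id compm1.
Qed.

Lemma hb_h2l X Y V U W (f : hom (X ⊗ Y) V) :
  hb V U W ∘ h2 f (U ⊗ W) = U ◁ h2 f W ∘ (hb X U (Y ⊗ W) ∘ X ◁ hb Y U W).
Proof. by rewrite !h2E wlD compA hb_h1l -!compA hb_tensl. Qed.
Lemma hb_h2r X Y V U W (f : hom (X ⊗ Y) V) :
  hb U V W ∘ U ◁ h2 f W = h2 f (U ⊗ W) ∘ (X ◁ hb U Y W ∘ hb U X (Y ⊗ W)).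
Proof. by rewrite !h2E wlD compA hb_h1r -!compA hb_tensr. Qed.

Lemma h2_lam X W : h2 (lam X) W = lam (X ⊗ W).
Proof. by rewrite h2E h1E -lam_tens -compA alphaVK compm1. Qed.

Lemma h2_lam1 V : h2 (lam (unit_ob : Z)) V = unit_ob ◁ lam V.
Proof.
by rewrite lam_rgt_unit h2E h1E wlE -mon_triangle -compA alphaVK compm1.
Qed.

(** Triviality of the braiding with the unit follows from the hexagon: moving [U] past the operation
    [lam unit_ob] produces two braidings with the unit on one side and one on the other, and one
    invertible braiding cancels. *)
Lemma hb_unitl U W : U ◁ lam W ∘ hb unit_ob U W = lam (U ⊗ W).
Proof.
apply: unit_tensl_inj; rewrite -!wlE wlD.
have inj Y (f g : hom Y (unit_ob ⊗ (U ⊗ W))) :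
    hb unit_ob U W ∘ f = hb unit_ob U W ∘ g -> f = g.
  by move=> e; rewrite -(comp1m f) -(comp1m g) -(hbK unit_ob U W) -!compA e.
apply: inj.
have := hb_h2l U W (lam unit_ob); rewrite !h2_lam1 => ->.
by rewrite !compA wl_hb.
Qed.

Lemma hb_unitr U W : lam (U ⊗ W) ∘ hb U unit_ob W = U ◁ lam W.
Proof.
apply: unit_tensl_inj; rewrite -!wlE wlD.
have inj Y (f g : hom (unit_ob ⊗ (U ⊗ (unit_ob ⊗ W))) Y) :
    f ∘ hb U unit_ob _ = g ∘ hb U unit_ob _ -> f = g.
  by move=> e; rewrite -(compm1 f) -(compm1 g) -(hbVK U unit_ob _) !compA e.
apply: inj.
have := hb_h2r U W (lam unit_ob); rewrite !h2_lam1 -compA => <-.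
by rewrite wl_hb.
Qed.

Lemma hb_h0l V U W (f : hom unit_ob V) :
  hb V U W ∘ h0 f (U ⊗ W) = U ◁ h0 f W.
Proof.
rewrite !h0E compA hb_h1l -compA wlD; congr (_ ∘ _).
rewrite -[LHS]comp1m -(wl_id U) -lamK wlD -!compA.
by rewrite (compA (U ◁ lam _)) hb_unitl lamVK compm1.
Qed.
Lemma hb_h0r V U W (f : hom unit_ob V) :
  hb U V W ∘ U ◁ h0 f W = h0 f (U ⊗ W).
Proof.
rewrite !h0E wlD compA hb_h1r -compA; congr (_ ∘ _).
rewrite -[LHS]comp1m -lamK -!compA (compA (lam _)) hb_unitr.
by rewrite -wlD lamVK wl_id compm1.
Qed.

(* An operation is recovered from its hat at [unit_ob], so equations between hats
   need only be checked there. *)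
Lemma h1_surj X Y (f : hom (X ⊗ unit_ob) (Y ⊗ unit_ob)) :
  f = h1 (rgt Y ∘ f ∘ rgtV X) unit_ob.
Proof.
have inj (a b : hom (X ⊗ unit_ob) (Y ⊗ unit_ob)) :
    rgt Y ∘ a = rgt Y ∘ b -> a = b.
  by move/(congr1 (fun f => rgtV _ ∘ f)); rewrite !compA rgtK !comp1m.
by apply: inj; rewrite h1E rgt_nat -!compA rgtK compm1.
Qed.
Lemma h1_inj X Y (f g : hom X Y) : h1 f unit_ob = h1 g unit_ob -> f = g.
Proof. by rewrite !h1E; apply: unit_tensr_inj. Qed.
Lemma h2_inj X Y V (f g : hom (X ⊗ Y) V) : h2 f unit_ob = h2 g unit_ob -> f = g.
Proof.
rewrite !h2E => /(congr1 (fun f => f ∘ alpha _ _ _)).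
by rewrite -!compA alphaK !compm1; apply: h1_inj.
Qed.
Lemma h2_surj X Y V (f : hom (X ⊗ (Y ⊗ unit_ob)) (V ⊗ unit_ob)) :
  exists g, f = h2 g unit_ob.
Proof.
exists (rgt V ∘ (f ∘ alpha _ _ _) ∘ rgtV _).
by rewrite h2E -h1_surj -compA alphaVK compm1.
Qed.
Lemma h0_inj X (f g : hom unit_ob X) : h0 f unit_ob = h0 g unit_ob -> f = g.
Proof.
rewrite !h0E => /(congr1 (fun f => f ∘ lam _)).
by rewrite -!compA lamK !compm1; apply: h1_inj.
Qed.

Lemma h2_h0l X Y (f : hom (X ⊗ Y) Y) (p : hom unit_ob X) :
  f ∘ (p ⊠ idm Y) = lam Y <-> forall W, h2 f W ∘ h0 p (Y ⊗ W) = idm _.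
Proof.
have e W : h2 f W ∘ h0 p (Y ⊗ W) = h2 (f ∘ (p ⊠ idm Y)) W ∘ lamV (Y ⊗ W).
  by rewrite h0E compA -h1E h2_h1.
split=> [e1 W|/(_ unit_ob)]; first by rewrite e e1 h2_lam lamVK.
rewrite e -(lamVK (Y ⊗ unit_ob)) -h2_lam.
move/(congr1 (fun f => f ∘ lam _)).
by rewrite -!compA lamK !compm1 => /h2_inj.
Qed.

Lemma h2_h0r X Y (f : hom (X ⊗ Y) X) (p : hom unit_ob Y) :
  f ∘ (idm X ⊠ p) = rgt X <-> forall W, h2 f W ∘ X ◁ h0 p W = idm _.
Proof.
have e W : h2 f W ∘ X ◁ h0 p W
    = h1 (f ∘ (idm X ⊠ p)) W ∘ (alphaV X unit_ob W ∘ X ◁ lamV W).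
  rewrite h2E h0E wlD -wlE h1D -!compA; congr (_ ∘ _).
  by rewrite !compA !h1E !wlE alphaV_nat.
have t W : h1 (rgt X) W ∘ (alphaV X unit_ob W ∘ X ◁ lamV W) = idm _.
  by rewrite h1E -mon_triangle -wlE -!compA alphaVE2 -wlD lamVK wl_id.
split=> [e1 W|/(_ unit_ob)]; first by rewrite e e1.
rewrite e -(t unit_ob) => /(congr1 (fun f => f ∘ (X ◁ lam _ ∘ alpha _ _ _))).
rewrite -!compA (compA (X ◁ lamV _)) -wlD lamK wl_id comp1m alphaK !compm1.
exact: h1_inj.
Qed.

End Hats.

Notation "U ◁ f" := (wl U f) (at level 39, right associativity) : mon_scope.

(** * Rewriting in contexts *)

Section Lifting.
Variable Z : braided.
Implicit Types U V W X Y : Z.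

Lemma ap2 X Y V (f : hom Y V) (g : hom X Y) h :
  f ∘ g = h -> forall U (x : hom U X), f ∘ (g ∘ x) = h ∘ x.
Proof. by move=> <- U x; rewrite compA. Qed.

Lemma ap3 X Y V W (f : hom V W) (g : hom Y V) (k : hom X Y) h :
  f ∘ (g ∘ k) = h -> forall U (x : hom U X), f ∘ (g ∘ (k ∘ x)) = h ∘ x.
Proof. by move=> <- U x; rewrite !compA. Qed.

Lemma wl2 U X Y V (f : hom Y V) (g : hom X Y) h :
  f ∘ g = h -> U ◁ f ∘ U ◁ g = U ◁ h.
Proof. by move=> <-; rewrite wlD. Qed.

Lemma wl3 U X Y V W (f : hom V W) (g : hom Y V) (k : hom X Y) h :
  f ∘ (g ∘ k) = h -> U ◁ f ∘ (U ◁ g ∘ U ◁ k) = U ◁ h.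
Proof. by move=> <-; rewrite !wlD. Qed.

(** The arbitrary tail [x] ensures that every group of adjacent factors is followed by another
    factor, the only shape in which [nf], [rw2] and [rw3] look for a redex. *)
Lemma homext X Y (f g : hom X Y) :
  (forall U (x : hom U X), f ∘ x = g ∘ x) -> f = g.
Proof. by move=> e; rewrite -(compm1 f) -(compm1 g) e. Qed.
End Lifting.

Ltac hat_op g :=
  lazymatch g with
  | wl _ ?h => hat_op h
  | h0 _ _ => constr:(tt) | h1 _ _ => constr:(tt) | h2 _ _ => constr:(tt)
  end.
Ltac hat_braid g :=
  lazymatch g with wl _ ?h => hat_braid h | hb _ _ _ => constr:(tt) end.

(* An equation rewriting [f ∘ g] towards the normal form in which braidings act
   first, and deeper operations act before shallower ones. *)
Ltac hat_step f g :=
  lazymatch f with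
  | wl ?U ?f' =>
    lazymatch g with
    | wl _ ?g' => let e := hat_step f' g' in constr:(wl2 U e)
    | h2 ?p _ => constr:(wl_h2 p f')
    | h1 ?p _ => constr:(wl_h1 p f')
    | h0 ?p _ => constr:(wl_h0 p f')
    | hb ?X ?Y _ =>
      lazymatch f' with
      | wl _ ?k => let _ := hat_braid k in constr:(wl_hb X Y k) end
    end
  | hb ?X ?Y ?W =>
    lazymatch g with
    | h2 ?p _ => constr:(hb_h2l Y W p)
    | h1 ?p _ => constr:(hb_h1l Y W p)
    | h0 ?p _ => constr:(hb_h0l Y W p)
    | wl _ ?g' =>
      lazymatch g' with
      | h2 ?p _ => constr:(hb_h2r X W p)
      | h1 ?p _ => constr:(hb_h1r X W p)
      | h0 ?p _ => constr:(hb_h0r X W p)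
      | wl _ ?k => let _ := hat_op k in constr:(esym (wl_hb X Y k))
      end
    end
  end.

(** The equation [E] is lifted through the whiskerings common to [f] and [g]: when the type of [E]
    does not fit, [match] falls through to the second branch and peels off one whiskering. *)
Ltac hat_rule2 E f g :=
  match f with
  | _ => constr:(E : f ∘ g = _)
  | wl ?U ?f' =>
    lazymatch g with wl _ ?g' =>
      let e := hat_rule2 E f' g' in constr:(wl2 U e) end
  end.
Ltac hat_rule3 E f g k :=
  match f with
  | _ => constr:(E : f ∘ (g ∘ k) = _)
  | wl ?U ?f' =>
    lazymatch g with wl _ ?g' => lazymatch k with wl _ ?k' =>
      let e := hat_rule3 E f' g' k' in constr:(wl3 U e) end end
  end.

Ltac hat_simp := rewrite ?wlD ?wl_id -?compA ?comp1m.
Ltac hat_nf1 :=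
  match goal with |- context [?f ∘ (?g ∘ _)] =>
    let e := hat_step f g in rewrite (ap2 e) end; hat_simp.
Tactic Notation "rw2" uconstr(E) :=
  match goal with |- context [?f ∘ (?g ∘ _)] =>
    let e := hat_rule2 E f g in rewrite (ap2 e) end; hat_simp.
Tactic Notation "rw3" uconstr(E) :=
  match goal with |- context [?f ∘ (?g ∘ (?k ∘ _))] =>
    let e := hat_rule3 E f g k in rewrite (ap3 e) end; hat_simp.

Tactic Notation "nf" := hat_simp; repeat hat_nf1.
Tactic Notation "nfw" tactic3(t) := hat_simp; repeat (first [hat_nf1 | t]).

(** * Associativity and product relations between operations *)

Section Relations.
Variable Z : braided.
Implicit Types U V W X Y : Z.

(* p1 (p2 (x, y), z) = p3 (x, p4 (y, z)) *)
Definition assoc X Y V X' Y' V' (p1 : hom (X' ⊗ V) V') (p2 : hom (X ⊗ Y) X')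
    (p3 : hom (X ⊗ Y') V') (p4 : hom (Y ⊗ V) Y') : Prop :=
  forall W, h2 p1 W ∘ h2 p2 (V ⊗ W) = h2 p3 W ∘ X ◁ h2 p4 W.

(* p (r1 (x, x'), r2 (y, y')) = r3 (p1 (x, y), p2 (x', y')) *)
Definition prodrel X X' Y Y' V V' Q1 Q2 Q3
    (p : hom (Q1 ⊗ Q2) Q3) (r1 : hom (X ⊗ X') Q1) (r2 : hom (Y ⊗ Y') Q2)
    (r3 : hom (V ⊗ V') Q3) (p1 : hom (X ⊗ Y) V) (p2 : hom (X' ⊗ Y') V') : Prop :=
  forall W, h2 p W ∘ (h2 r1 (Q2 ⊗ W) ∘ X ◁ (X' ◁ h2 r2 W))
    = h2 r3 W ∘ (h2 p1 (V' ⊗ W) ∘ (X ◁ (Y ◁ h2 p2 W) ∘ X ◁ hb X' Y (Y' ⊗ W))).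

(** Reflexivity is kept together with the universal property because tensoring is only assumed to
    preserve coequalizers of reflexive pairs. *)
Definition rcoeq U V Q (L R : hom U V) (q : hom V Q) :=
  reflexive_pair L R /\ is_coequalizer L R q.

(** [Q] is a model of [X ⊗_A Y]. The property is required with every tail [W], so that [q] can be
    cancelled, and maps can descend along it, in front of further tensor factors. *)
Definition univ X A Y Q (r : hom (X ⊗ A) X) (l : hom (A ⊗ Y) Y)
    (q : hom (X ⊗ Y) Q) : Prop :=
  forall W, rcoeq (h2 r (Y ⊗ W)) (X ◁ h2 l W) (h2 q W).

Lemma pentagonW2 X Y V W :
  h1 (alpha X Y V) W ∘ alphaV (X ⊗ Y) V W
  = alphaV X (Y ⊗ V) W ∘ (X ◁ alphaV Y V W ∘ alpha X Y (V ⊗ W)).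
Proof. by rewrite -pentagonV3 -!compA alphaVE1 alphaK compm1. Qed.

Lemma pentagonW1 X Y V W :
  h1 (alphaV X Y V) W ∘ (alphaV X (Y ⊗ V) W ∘ X ◁ alphaV Y V W)
  = alphaV (X ⊗ Y) V W ∘ alphaV X Y (V ⊗ W).
Proof.
rewrite -pentagonV3 !compA -(compA (h1 _ _)) alphaK compm1 -h1D alphaK h1_id.
by rewrite comp1m.
Qed.

Lemma alphaV_h1h1 X X' Y V (f : hom X X') :
  alphaV X' Y V ∘ h1 f (Y ⊗ V) = h1 (h1 f Y) V ∘ alphaV X Y V.
Proof. by rewrite !h1E -alphaV_nat tensm_id. Qed.

Lemma alphaV_wl X Y Y' V (f : hom Y Y') :
  alphaV X Y' V ∘ X ◁ h1 f V = h1 (X ◁ f) V ∘ alphaV X Y V.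
Proof. by rewrite !h1E !wlE alphaV_nat. Qed.

Lemma alphaV_wlwl X Y V V' (f : hom V V') :
  alphaV X Y V' ∘ X ◁ (Y ◁ f) = (X ⊗ Y) ◁ f ∘ alphaV X Y V.
Proof. by rewrite !wlE alphaV_nat tensm_id. Qed.

Lemma hb_tail X Y V W :
  h1 (hb X Y V) W ∘ (alphaV X (Y ⊗ V) W ∘ X ◁ alphaV Y V W)
  = alphaV Y (X ⊗ V) W ∘ (Y ◁ alphaV X V W ∘ hb X Y (V ⊗ W)).
Proof.
rewrite !hbE !h1D -!compA pentagonW1 (compA (h1 (h1 _ _) _)) -alphaV_h1h1.
by rewrite -!compA (compA (h1 (alpha _ _ _) _)) pentagonW2 -!compA.
Qed.

Lemma swap_midE X Y V W :
  swap_mid X Y V W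
  = alphaV X V (Y ⊗ W) ∘ (X ◁ hb Y V W ∘ alpha X Y (V ⊗ W)).
Proof. by rewrite hbE wlE h1E /swap_mid -!compA. Qed.

Section Assoc.
Variables (X Y V X' Y' V' : Z) (p1 : hom (X' ⊗ V) V') (p2 : hom (X ⊗ Y) X').
Variables (p3 : hom (X ⊗ Y') V') (p4 : hom (Y ⊗ V) Y').

Let h3 W (f : hom ((X ⊗ Y) ⊗ V) V') := h2 f W ∘ alphaV X Y (V ⊗ W).

Let assoc_l W : h2 p1 W ∘ h2 p2 (V ⊗ W) = h3 W (p1 ∘ (p2 ⊠ idm V)).
Proof. by rewrite /h3 -h1E h2_h1 h2E -!compA h2E. Qed.

Let assoc_r W :
  h2 p3 W ∘ X ◁ h2 p4 W = h3 W (p3 ∘ (idm X ⊠ p4) ∘ alpha X Y V).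
Proof.
rewrite /h3 -wlE h2D h1D -!compA h2E h2E wlD -!compA; congr (_ ∘ _).
rewrite h2E -!compA [X in _ = _ ∘ X]compA pentagonW2 -!compA alphaVK compm1.
by rewrite !compA alphaV_wl.
Qed.

Lemma assocP : p1 ∘ (p2 ⊠ idm V) = p3 ∘ (idm X ⊠ p4) ∘ alpha X Y V ->
  assoc p1 p2 p3 p4.
Proof. by move=> e W; rewrite assoc_l assoc_r e. Qed.

(** Each side of [assoc] at [W] is the hat of a ternary operation that does not depend on [W], and
    this hat is injective at [unit_ob]. Descent therefore has to be carried out at the tail
    [unit_ob] only. *)
Lemma assoc_unit :
  h2 p1 unit_ob ∘ h2 p2 (V ⊗ unit_ob) = h2 p3 unit_ob ∘ X ◁ h2 p4 unit_ob ->
  p1 ∘ (p2 ⊠ idm V) = p3 ∘ (idm X ⊠ p4) ∘ alpha X Y V.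
Proof.
rewrite assoc_l assoc_r => /(congr1 (fun f => f ∘ alpha _ _ _)).
by rewrite -!compA alphaK !compm1 => /h2_inj.
Qed.

Lemma assocE : assoc p1 p2 p3 p4 ->
  p1 ∘ (p2 ⊠ idm V) = p3 ∘ (idm X ⊠ p4) ∘ alpha X Y V.
Proof. by move=> e; apply: assoc_unit. Qed.
End Assoc.

Section Prodrel.
Variables (X X' Y Y' V V' Q1 Q2 Q3 : Z).
Variables (p : hom (Q1 ⊗ Q2) Q3) (r1 : hom (X ⊗ X') Q1) (r2 : hom (Y ⊗ Y') Q2).
Variables (r3 : hom (V ⊗ V') Q3) (p1 : hom (X ⊗ Y) V) (p2 : hom (X' ⊗ Y') V').

Let h4 W (f : hom ((X ⊗ X') ⊗ (Y ⊗ Y')) Q3) :=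
  h2 f W ∘ (alphaV X X' ((Y ⊗ Y') ⊗ W) ∘ X ◁ (X' ◁ alphaV Y Y' W)).

Let prodrel_l W : h2 p W ∘ (h2 r1 (Q2 ⊗ W) ∘ X ◁ (X' ◁ h2 r2 W))
  = h4 W (p ∘ (r1 ⊠ r2)).
Proof.
rewrite /h4 tensm_wlh1 (compA p) h2_wl h2_h1 -!compA; congr (_ ∘ _).
rewrite (h2E r1) -!compA; congr (_ ∘ _).
by rewrite (h2E r2) !wlD compA alphaV_wlwl -!compA.
Qed.

Let prodrel_r W :
  h2 r3 W ∘ (h2 p1 (V' ⊗ W) ∘ (X ◁ (Y ◁ h2 p2 W) ∘ X ◁ hb X' Y (Y' ⊗ W)))
  = h4 W (r3 ∘ ((p1 ⊠ p2) ∘ swap_mid X X' Y Y')).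
Proof.
rewrite /h4 swap_midE h2D [X in _ = _ ∘ X ∘ _]h2E tensm_wlh1 !h1D.
rewrite (h2E r3) -!compA; congr (_ ∘ _).
rewrite (ap2 (pentagonW2 _ _ _ _)) -!compA alphaVE2.
rewrite (ap2 (esym (alphaV_wl _ _ _))) -!compA -!wlD hb_tail !wlD.
rewrite (ap3 (pentagonW1 _ _ _ _)) -!compA (ap2 (esym (alphaV_wl _ _ _))) -!compA.
rewrite (ap2 (esym (alphaV_h1h1 _ _ _))) -!compA; congr (_ ∘ _).
rewrite (h2E p1) (h2E p2) -!compA !wlD -?compA; congr (_ ∘ _).
by rewrite (ap2 (alphaV_wlwl _ _ _)) -!compA.
Qed.

Lemma prodrelP :
  p ∘ (r1 ⊠ r2) = r3 ∘ ((p1 ⊠ p2) ∘ swap_mid X X' Y Y') ->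
  prodrel p r1 r2 r3 p1 p2.
Proof. by move=> e W; rewrite prodrel_l prodrel_r e. Qed.

Lemma prodrel_unit :
  h2 p unit_ob ∘ (h2 r1 (Q2 ⊗ unit_ob) ∘ X ◁ (X' ◁ h2 r2 unit_ob))
  = h2 r3 unit_ob ∘ (h2 p1 (V' ⊗ unit_ob)
    ∘ (X ◁ (Y ◁ h2 p2 unit_ob) ∘ X ◁ hb X' Y (Y' ⊗ unit_ob))) ->
  p ∘ (r1 ⊠ r2) = r3 ∘ ((p1 ⊠ p2) ∘ swap_mid X X' Y Y').
Proof.
rewrite prodrel_l prodrel_r.
move=> /(congr1 (fun f => f ∘ (X ◁ (X' ◁ alpha _ _ _) ∘ alpha _ _ _))).
rewrite /h4 -!compA !(compA (X ◁ (_ ◁ _))) -!wlD alphaK !wl_id !comp1m.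
by rewrite alphaK !compm1 => /h2_inj.
Qed.

Lemma prodrelE : prodrel p r1 r2 r3 p1 p2 ->
  p ∘ (r1 ⊠ r2) = r3 ∘ ((p1 ⊠ p2) ∘ swap_mid X X' Y Y').
Proof. by move=> e; apply: prodrel_unit. Qed.
End Prodrel.
End Relations.

(** * Reflexive coequalizers *)

Section Coequalizers.
Variables (Z : braided) (H : coequalizer_assumption Z).
Implicit Types T U V W X Y : Z.

Lemma rcoeq_eq U V Q (L R : hom U V) (q : hom V Q) :
  rcoeq L R q -> q ∘ L = q ∘ R.
Proof. by case=> _ []. Qed.

Lemma rcoeq_ex U V Q (L R : hom U V) (q : hom V Q) W (h : hom V W) :
  rcoeq L R q -> h ∘ L = h ∘ R -> exists k, k ∘ q = h.
Proof. by case=> _ [_ u] /u [k [e _]]; exists k. Qed.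

Lemma rcoeq_epi U V Q (L R : hom U V) (q : hom V Q) W (f g : hom Q W) :
  rcoeq L R q -> f ∘ q = g ∘ q -> f = g.
Proof.
case=> _ [e u] efg; have [|k [_ uk]] := u W (f ∘ q).
  by rewrite -!compA e.
by rewrite -(uk f erefl) (uk g (esym efg)).
Qed.

Lemma rcoeq_wl U V Q (L R : hom U V) (q : hom V Q) X :
  rcoeq L R q -> rcoeq (X ◁ L) (X ◁ R) (X ◁ q).
Proof.
case=> rp cq; split; last by rewrite !wlE; apply: coeq_tensl.
by have [t [e1 e2]] := rp; exists (X ◁ t); rewrite -!wlD e1 e2 wl_id.
Qed.

Lemma rcoeq_h1 U V Q (L R : hom U V) (q : hom V Q) X :
  rcoeq L R q -> rcoeq (h1 L X) (h1 R X) (h1 q X).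
Proof.
case=> rp cq; split; last by rewrite !h1E; apply: coeq_tensr.
by have [t [e1 e2]] := rp; exists (h1 t X); rewrite -!h1D e1 e2 h1_id.
Qed.

Lemma rcoeq_iso U V U' V' Q (L R : hom U V) (L' R' : hom U' V') (q : hom V Q)
    (a : hom V' V) (a' : hom V V') (i : hom U' U) (i' : hom U U') :
  a' ∘ a = idm _ -> a ∘ a' = idm _ -> i' ∘ i = idm _ -> i ∘ i' = idm _ ->
  a ∘ L' = L ∘ i -> a ∘ R' = R ∘ i -> rcoeq L R q -> rcoeq L' R' (q ∘ a).
Proof.
move=> a1 a2 i1 i2 eL eR cq.
have eL' : L' = a' ∘ (L ∘ i) by rewrite -eL compA a1 comp1m.
have eR' : R' = a' ∘ (R ∘ i) by rewrite -eR compA a1 comp1m.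
split.
  have [[t [e1 e2]] _] := cq; exists (i' ∘ t ∘ a).
  rewrite eL' eR' -!compA !(compA i) i2 comp1m (compA L) (compA R) e1 e2 comp1m.
  by [].
split=> [|W h e].
  by rewrite -!compA eL eR !compA (rcoeq_eq cq).
have [|k ek] := @rcoeq_ex _ _ _ _ _ _ W (h ∘ a') cq.
  have : h ∘ L' ∘ i' = h ∘ R' ∘ i' by rewrite e.
  by rewrite eL' eR' -!compA i2 !compm1.
exists k; split=> [|k' ek']; first by rewrite compA ek -compA a1 compm1.
by apply: (rcoeq_epi cq); rewrite ek -ek' -!compA a2 compm1.
Qed.

Section Univ.
Variables (X A Y Q : Z) (r : hom (X ⊗ A) X) (l : hom (A ⊗ Y) Y).
Variable (q : hom (X ⊗ Y) Q).

(** Preservation by [- ⊗ W] gives the property at each tail; the associators between [q ⊠ idm W] and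
    the hat of [q] are absorbed by [rcoeq_iso]. *)
Lemma univP : reflexive_pair (r ⊠ idm Y) ((idm X ⊠ l) ∘ alpha X A Y) ->
  is_coequalizer (r ⊠ idm Y) ((idm X ⊠ l) ∘ alpha X A Y) q -> univ r l q.
Proof.
move=> rp cq W; rewrite -h1E -wlE in rp cq.
rewrite (h2E q).
apply: (rcoeq_iso (a' := alpha X Y W)
  (i := alphaV (X ⊗ A) Y W ∘ alphaV X A (Y ⊗ W))
  (i' := alpha X A (Y ⊗ W) ∘ alpha (X ⊗ A) Y W) _ _ _ _ _ _
  (rcoeq_h1 W (conj rp cq))).
- exact: alphaVK.
- exact: alphaK.
- by rewrite -!compA alphaVE2 alphaVK.
- by rewrite -!compA alphaVE1 alphaK.
- by rewrite h2E compA alphaV_h1h1 -!compA.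
rewrite h2E wlD compA alphaV_wl h1D -!compA; congr (_ ∘ _).
by rewrite -pentagonV3 alphaVE1.
Qed.

Hypothesis u : univ r l q.

Lemma univ_bal : assoc q r q l.
Proof. by move=> W; apply: rcoeq_eq (u W). Qed.

Lemma univ_epi W V (f g : hom _ V) : f ∘ h2 q W = g ∘ h2 q W -> f = g.
Proof. exact: rcoeq_epi (u W). Qed.

Lemma univ_wl_epi T W V (f g : hom _ V) :
  f ∘ T ◁ h2 q W = g ∘ T ◁ h2 q W -> f = g.
Proof. exact: rcoeq_epi (rcoeq_wl T (u W)). Qed.

Lemma univ_wl2_epi T T' W V (f g : hom _ V) :
  f ∘ T ◁ (T' ◁ h2 q W) = g ∘ T ◁ (T' ◁ h2 q W) -> f = g.
Proof. exact: rcoeq_epi (rcoeq_wl T (rcoeq_wl T' (u W))). Qed.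

(** The extension found at [unit_ob] is itself a hat by [h1_surj], so balance at this single tail
    suffices. *)
Lemma univ_ext_unit V (f : hom (X ⊗ Y) V) :
  h2 f unit_ob ∘ h2 r _ = h2 f unit_ob ∘ X ◁ h2 l _ -> exists k, k ∘ q = f.
Proof.
move=> e; have [k ek] := rcoeq_ex (u unit_ob) e.
by exists (rgt V ∘ k ∘ rgtV Q); apply: h2_inj; rewrite h2D -h1_surj.
Qed.

Lemma univ_ext V (f : hom (X ⊗ Y) V) :
  assoc f r f l -> exists k, k ∘ q = f.
Proof. by move=> e; apply: univ_ext_unit. Qed.

Lemma univ_inj V (f g : hom Q V) : f ∘ q = g ∘ q -> f = g.
Proof.
move=> e; apply: h1_inj; apply: (@univ_epi unit_ob).
by rewrite -!h2D e.
Qed.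

(** An operation on the left factor descends because [T ⊗ -] preserves the coequalizer. In the
    mirror image [univ_rext] the object [S] is part of the tail. *)
Lemma univ_lext T X' Q' (p2 : hom (T ⊗ X) X') (q' : hom (X' ⊗ Y) Q') :
  (forall W, h2 q' W ∘ (h2 p2 (Y ⊗ W) ∘ T ◁ h2 r (Y ⊗ W))
    = h2 q' W ∘ (h2 p2 (Y ⊗ W) ∘ T ◁ (X ◁ h2 l W))) ->
  exists p3, assoc q' p2 p3 q.
Proof.
move=> /(_ unit_ob); rewrite !compA => e.
have [k ek] := rcoeq_ex (rcoeq_wl T (u unit_ob)) e.
have [p3 ep] := h2_surj k; exists p3; apply/assocP/assoc_unit.
by rewrite -ep ek.
Qed.

Lemma univ_rext S Y' Q' (p4 : hom (Y ⊗ S) Y') (q' : hom (X ⊗ Y') Q') :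
  (forall W, h2 q' W ∘ (X ◁ h2 p4 W ∘ h2 r (Y ⊗ (S ⊗ W)))
    = h2 q' W ∘ (X ◁ h2 p4 W ∘ X ◁ h2 l (S ⊗ W))) ->
  exists p1, assoc p1 q q' p4.
Proof.
move=> /(_ unit_ob); rewrite !compA => e.
have [k ek] := rcoeq_ex (u _) e.
have [p1 ep] := h2_surj k; exists p1; apply/assocP/assoc_unit.
by rewrite -ep ek.
Qed.

Lemma assoc_linj T X' Q' (p2 : hom (T ⊗ X) X') (q' : hom (X' ⊗ Y) Q') f g :
  assoc q' p2 f q -> assoc q' p2 g q -> f = g.
Proof.
move=> ef eg; apply: h2_inj; apply: (@univ_wl_epi _ unit_ob).
by rewrite -ef -eg.
Qed.

Lemma assoc_rinj S Y' Q' (p4 : hom (Y ⊗ S) Y') (q' : hom (X ⊗ Y') Q') f g :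
  assoc f q q' p4 -> assoc g q q' p4 -> f = g.
Proof.
move=> ef eg; apply: h2_inj; apply: univ_epi.
by rewrite ef eg.
Qed.

End Univ.

Section Prod.
Variables (X A X' Q1 Y B Y' Q2 : Z).
Variables (r : hom (X ⊗ A) X) (l : hom (A ⊗ X') X') (q : hom (X ⊗ X') Q1).
Variables (r' : hom (Y ⊗ B) Y) (l' : hom (B ⊗ Y') Y') (q' : hom (Y ⊗ Y') Q2).
Hypotheses (u : univ r l q) (u' : univ r' l' q').

(** The map descends first along [q], with [Y] and [Y'] in the tail, and then along [Q1 ◁ q']; the
    balance needed for the second descent is tested after cancelling [q]. *)
Lemma biuniv_ex Q3 (h : hom (X ⊗ (X' ⊗ (Y ⊗ (Y' ⊗ unit_ob)))) (Q3 ⊗ unit_ob)) :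
  h ∘ h2 r _ = h ∘ X ◁ h2 l _ ->
  h ∘ X ◁ (X' ◁ h2 r' _) = h ∘ X ◁ (X' ◁ (Y ◁ h2 l' _)) ->
  exists p, h2 p unit_ob ∘ (h2 q _ ∘ X ◁ (X' ◁ h2 q' unit_ob)) = h.
Proof.
move=> e e'; have [k ek] := rcoeq_ex (u _) e.
have [|k' ek'] := @rcoeq_ex _ _ _ _ _ _ _ k (rcoeq_wl Q1 (u' unit_ob)).
  by apply: (univ_epi u); rewrite -!compA !wl_h2 !compA ek.
have [p ep] := h2_surj k'; exists p.
by rewrite -wl_h2 compA -ep ek' ek.
Qed.

Lemma biuniv_inj W V (f g : hom _ V) :
  f ∘ (h2 q _ ∘ X ◁ (X' ◁ h2 q' W)) = g ∘ (h2 q _ ∘ X ◁ (X' ◁ h2 q' W)) ->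
  f = g.
Proof.
rewrite -wl_h2 !compA => e.
exact: (univ_wl_epi u' (univ_epi u e)).
Qed.

Variables (V V' Q3 : Z) (q3 : hom (V ⊗ V') Q3).
Variables (p1 : hom (X ⊗ Y) V) (p2 : hom (X' ⊗ Y') V').

Let h W := h2 q3 W ∘ (h2 p1 (V' ⊗ W) ∘ (X ◁ (Y ◁ h2 p2 W)
  ∘ X ◁ hb X' Y (Y' ⊗ W))).

Lemma prodrel_ex :
  (forall W, h W ∘ h2 r _ = h W ∘ X ◁ h2 l _) ->
  (forall W, h W ∘ X ◁ (X' ◁ h2 r' _) = h W ∘ X ◁ (X' ◁ (Y ◁ h2 l' _))) ->
  exists p, prodrel p q q' q3 p1 p2.
Proof.
move=> e e'; have [p ep] := biuniv_ex (e _) (e' _).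
by exists p; apply/prodrelP/prodrel_unit.
Qed.
End Prod.
End Coequalizers.

(** * Products of operations *)

Section Products.
Variables (Z : braided) (H : coequalizer_assumption Z).
Implicit Types T U V W X Y : Z.

Section Existence.
Variables (A X X' Q1 Y Y' Q2 V V' Q3 : Z).
Variables (r : hom (X ⊗ A) X) (l : hom (A ⊗ X') X') (q : hom (X ⊗ X') Q1).
Variables (r' : hom (Y ⊗ A) Y) (l' : hom (A ⊗ Y') Y') (q' : hom (Y ⊗ Y') Q2).
Variables (r3 : hom (V ⊗ A) V) (l3 : hom (A ⊗ V') V').
Variables (q3 : hom (V ⊗ V') Q3) (p1 : hom (X ⊗ Y) V) (p2 : hom (X' ⊗ Y') V').

(** An element of [A] acting on [X] is carried past [Y] out of [p1], crosses [q3], and re-enters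
    [p2] as an action on [X']. An element acting on [Y] leaves [p1] on the right, crosses [q3], and
    is carried past [X'] into [p2] as an action on [Y']. *)
Lemma prodrel_exists : univ r l q -> univ r' l' q' -> assoc q3 r3 q3 l3 ->
  (forall W, h2 p1 W ∘ h2 r (Y ⊗ W)
    = h2 r3 W ∘ (h2 p1 (A ⊗ W) ∘ X ◁ hb A Y W)) ->
  assoc p2 l l3 p2 -> assoc r3 p1 p1 r' ->
  (forall W, h2 p2 W ∘ X' ◁ h2 l' W
    = h2 l3 W ∘ (A ◁ h2 p2 W ∘ hb X' A (Y' ⊗ W))) ->
  exists p, prodrel p q q' q3 p1 p2.
Proof.
move=> u u' e3 e1 e1' e2 e2'; apply: (prodrel_ex H u u') => W /=.
  apply: homext => U x.
  by nfw (first [rw2 (e1 _) | rw2 (e1' _) | rw2 (e3 _)]).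
apply: homext => U x.
by nfw (first [rw2 (esym (e2 _)) | rw2 (e2' _) | rw2 (e3 _)]).
Qed.
End Existence.

(** Once the three quotient maps are cancelled, the claim splits into the two factors. Associativity
    of composite algebras, the action laws of horizontal composites, and the balance and linearity
    of the interchange map are all instances. *)
Lemma prodrel_assoc X X' Y Y' V V' A B C E E' F F' G G' Q1 Q2 Q3 Q12 Q23 Q
    (r1 : hom (X ⊗ A) X) (l1 : hom (A ⊗ X') X') (q1 : hom (X ⊗ X') Q1)
    (r2 : hom (Y ⊗ B) Y) (l2 : hom (B ⊗ Y') Y') (q2 : hom (Y ⊗ Y') Q2)
    (r3 : hom (V ⊗ C) V) (l3 : hom (C ⊗ V') V') (q3 : hom (V ⊗ V') Q3)
    (q12 : hom (E ⊗ E') Q12) (q23 : hom (F ⊗ F') Q23) (q : hom (G ⊗ G') Q)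
    P1 P2 P3 P4 p1 p2 p3 p4 p1' p2' p3' p4' :
  univ r1 l1 q1 -> univ r2 l2 q2 -> univ r3 l3 q3 ->
  prodrel P1 q12 q3 q p1 p1' -> prodrel P2 q1 q2 q12 p2 p2' ->
  prodrel P3 q1 q23 q p3 p3' -> prodrel P4 q2 q3 q23 p4 p4' ->
  assoc p1 p2 p3 p4 -> assoc p1' p2' p3' p4' -> assoc P1 P2 P3 P4.
Proof.
move=> u1 u2 u3 e1 e2 e3 e4 a a' W.
apply: (univ_wl2_epi H u3); apply: (univ_wl_epi H u2); apply: (univ_epi u1).
apply: homext => U x; hat_simp.
rw2 (esym (wl_h2 P2 (h2 q3 W))); rw2 (wl_h2 q1 _); rw3 (e2 _).
rw2 (wl_h2 q12 _); rw3 (e1 _).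
rw2 (esym (wl_h2 q1 (h2 q2 _))); rw2 (wl_h2 q2 _); rw3 (e4 _).
nfw (first [rw3 (e3 _) | rw2 (a _) | rw2 (a' _)]).
by [].
Qed.

Section Units.
Variables (X X' Y Y' V V' Q1 Q2 Q3 A : Z).
Variables (q1 : hom (X ⊗ X') Q1) (q2 : hom (Y ⊗ Y') Q2) (q3 : hom (V ⊗ V') Q3).
Variables (P : hom (Q1 ⊗ Q2) Q3) (p : hom (X ⊗ Y) V) (p' : hom (X' ⊗ Y') V').
Hypothesis e : prodrel P q1 q2 q3 p p'.

Lemma prodrel_l0 (i' : hom unit_ob X') (a : hom A X) (c : hom A Q1)
    (f : hom Y' V') :
  (forall W, h2 p' W ∘ h0 i' (Y' ⊗ W) = h1 f W) ->
  (forall W, h1 c W = h2 q1 W ∘ (X ◁ h0 i' W ∘ h1 a W)) ->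
  forall W, h2 P W ∘ (h1 c (Q2 ⊗ W) ∘ A ◁ h2 q2 W)
    = h2 q3 W ∘ (h2 p (V' ⊗ W) ∘ (h1 a _ ∘ A ◁ (Y ◁ h1 f W))).
Proof.
move=> u ec W; rewrite ec; apply: homext => U x; hat_simp.
rw2 (esym (wl_h1 a (h2 q2 W))); rw2 (esym (wl_h0 i' (h2 q2 W))).
by rw3 (e _); nfw (rw2 (u _)).
Qed.

Lemma prodrel_0l (i : hom unit_ob X) (a : hom A X') (c : hom A Q1)
    (f : hom Y V) :
  (forall W, h2 p W ∘ h0 i (Y ⊗ W) = h1 f W) ->
  (forall W, h1 c W = h2 q1 W ∘ (h0 i (X' ⊗ W) ∘ h1 a W)) ->
  forall W, h2 P W ∘ (h1 c (Q2 ⊗ W) ∘ A ◁ h2 q2 W)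
    = h2 q3 W ∘ (h1 f (V' ⊗ W) ∘ (Y ◁ h2 p' W
      ∘ (Y ◁ h1 a (Y' ⊗ W) ∘ hb A Y (Y' ⊗ W)))).
Proof.
move=> u ec W; rewrite ec; apply: homext => U x; hat_simp.
rw2 (esym (wl_h1 a (h2 q2 W))); rw2 (esym (wl_h0 i (X' ◁ h2 q2 W))).
by rw3 (e _); nfw (rw2 (u _)).
Qed.

Lemma prodrel_r0 (i' : hom unit_ob Y') (a : hom A Y) (c : hom A Q2)
    (f : hom X' V') :
  (forall W, h2 p' W ∘ X' ◁ h0 i' W = h1 f W) ->
  (forall W, h1 c W = h2 q2 W ∘ (Y ◁ h0 i' W ∘ h1 a W)) ->
  forall W, h2 P W ∘ (Q1 ◁ h1 c W ∘ h2 q1 (A ⊗ W))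
    = h2 q3 W ∘ (h2 p (V' ⊗ W) ∘ (X ◁ h1 a (V' ⊗ W) ∘ (X ◁ (A ◁ h1 f W)
      ∘ X ◁ hb X' A W))).
Proof.
move=> u ec W; rewrite ec; apply: homext => U x; hat_simp.
rw2 (wl_h2 q1 (h1 a W)); rw2 (wl_h2 q1 (Y ◁ h0 i' W)).
by rw2 (wl_h2 q1 (h2 q2 W)); rw3 (e _); nfw (rw2 (u _)).
Qed.

Lemma prodrel_0r (i : hom unit_ob Y) (a : hom A Y') (c : hom A Q2)
    (f : hom X V) :
  (forall W, h2 p W ∘ X ◁ h0 i W = h1 f W) ->
  (forall W, h1 c W = h2 q2 W ∘ (h0 i (Y' ⊗ W) ∘ h1 a W)) ->
  forall W, h2 P W ∘ (Q1 ◁ h1 c W ∘ h2 q1 (A ⊗ W))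
    = h2 q3 W ∘ (h1 f (V' ⊗ W) ∘ (X ◁ h2 p' W ∘ X ◁ (X' ◁ h1 a W))).
Proof.
move=> u ec W; rewrite ec; apply: homext => U x; hat_simp.
rw2 (wl_h2 q1 (h1 a W)); rw2 (wl_h2 q1 (h0 i (Y' ⊗ W))).
by rw2 (wl_h2 q1 (h2 q2 W)); rw3 (e _); nfw (rw2 (u _)).
Qed.

Lemma prodrel_l00 (i : hom unit_ob X) (i' : hom unit_ob X') (f : hom Y V)
    (f' : hom Y' V') :
  (forall W, h2 p W ∘ h0 i (Y ⊗ W) = h1 f W) ->
  (forall W, h2 p' W ∘ h0 i' (Y' ⊗ W) = h1 f' W) ->
  forall W, h2 P W ∘ (h2 q1 (Q2 ⊗ W) ∘ (h0 i (X' ⊗ (Q2 ⊗ W))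
      ∘ (h0 i' (Q2 ⊗ W) ∘ h2 q2 W)))
    = h2 q3 W ∘ (h1 f (V' ⊗ W) ∘ Y ◁ h1 f' W).
Proof.
move=> u u' W; apply: homext => U x; hat_simp.
rw2 (esym (wl_h0 i' (h2 q2 W))); rw2 (esym (wl_h0 i (X' ◁ h2 q2 W))).
by rw3 (e _); nfw (first [rw2 (u _) | rw2 (u' _)]).
Qed.

Lemma prodrel_r00 (i : hom unit_ob Y) (i' : hom unit_ob Y') (f : hom X V)
    (f' : hom X' V') :
  (forall W, h2 p W ∘ X ◁ h0 i W = h1 f W) ->
  (forall W, h2 p' W ∘ X' ◁ h0 i' W = h1 f' W) ->
  forall W, h2 P W ∘ (Q1 ◁ (h2 q2 W ∘ (h0 i (Y' ⊗ W) ∘ h0 i' W)) ∘ h2 q1 W)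
    = h2 q3 W ∘ (h1 f (V' ⊗ W) ∘ X ◁ h1 f' W).
Proof.
move=> u u' W; apply: homext => U x; hat_simp.
rw2 (wl_h2 q1 (h0 i' W)); rw2 (wl_h2 q1 (h0 i (Y' ⊗ W))).
rw2 (wl_h2 q1 (h2 q2 W)).
by rw3 (e _); nfw (first [rw2 (u _) | rw2 (u' _)]).
Qed.
End Units.

Lemma h0_pair X Y Q (q : hom (X ⊗ Y) Q) (i : hom unit_ob X) (i' : hom unit_ob Y) W :
  h0 (q ∘ ((i ⊠ i') ∘ lamV unit_ob)) W = h2 q W ∘ (h0 i (Y ⊗ W) ∘ h0 i' W).
Proof.
have eV : alphaV unit_ob Y W ∘ lamV (Y ⊗ W) = h1 (lamV Y) W.
  rewrite -[LHS]compm1 -(h1_id Y) -lamVK h1D [h1 (lam Y) W]h1E -lam_tens.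
  by rewrite -!compA !(compA (lamV _)) lamK comp1m alphaVE1.
have eN : lamV Y ∘ i' = unit_ob ◁ i' ∘ lamV unit_ob.
  rewrite -[RHS]comp1m -(lamK Y) -!compA (compA (lam Y)) wlE lam_nat.
  by rewrite -!compA lamVK compm1.
rewrite h0E h2E (h0E i) (h0E i') -!compA (ap2 (alphaV_h1h1 _ _ _)) -!compA.
rewrite (ap2 eV) tensm_wlh1 !h1D -!compA; congr (_ ∘ (_ ∘ _)).
by rewrite !compA -!h1D eN.
Qed.
End Products.

(** * 2-diagrams as pointed bimodules *)

Section TwoDiagramHats.
Variable Z : braided.
Implicit Types T U V W X Y : Z.

Lemma h1_lamV X X' Y Q (q : hom (X ⊗ Y) Q) (p : hom unit_ob X) (f : hom X' Y) W :
  h1 (q ∘ (p ⊠ f) ∘ lamV X') W = h2 q W ∘ (h0 p (Y ⊗ W) ∘ h1 f W).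
Proof.
have e : h1 (lamV X') W = alphaV unit_ob X' W ∘ lamV (X' ⊗ W).
  rewrite -[LHS]comp1m -alphaK -!compA; congr (_ ∘ _).
  rewrite -[LHS]comp1m -lamK -!compA (compA (lam _)) lam_tens -h1E -h1D lamVK.
  by rewrite h1_id compm1.
rewrite (h0E p) tensm_wlh1 !h1D e (h2E q) -!compA.
rewrite (ap2 (alphaV_h1h1 _ _ _)) -!compA; congr (_ ∘ (_ ∘ _)).
have -> : lamV (Y ⊗ W) ∘ h1 f W = unit_ob ◁ h1 f W ∘ lamV (X' ⊗ W).
  rewrite -[RHS]comp1m -(lamK (Y ⊗ W)) -!compA (compA (lam _)) wlE lam_nat.
  by rewrite -!compA lamVK compm1.

by rewrite !compA alphaV_wl.
Qed.

Lemma h1_rgtV X Y Y' Q (q : hom (Y ⊗ X) Q) (p : hom unit_ob X) (f : hom Y' Y) W :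
  h1 (q ∘ (f ⊠ p) ∘ rgtV Y') W = h2 q W ∘ (h1 f (X ⊗ W) ∘ Y' ◁ h0 p W).
Proof.
have e : h1 (rgtV Y') W = alphaV Y' unit_ob W ∘ Y' ◁ lamV W.
  rewrite -[LHS]comp1m -alphaK -!compA; congr (_ ∘ _).
  rewrite -[LHS]comp1m -wl_id -lamK wlD -!compA (compA (_ ◁ lam _)).
  by rewrite (wlE _ (lam _)) mon_triangle -h1E -h1D rgtVK h1_id compm1.
rewrite (h0E p) tensm_wlh1 !h1D e (h2E q) wlD -!compA.
rewrite (ap2 (alphaV_h1h1 _ _ _)) -!compA; congr (_ ∘ (_ ∘ _)).
by rewrite !compA alphaV_wl.
Qed.

Lemma muA (S : algebra Z) : assoc (mu S) (mu S) (mu S) (mu S).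
Proof. exact/assocP/(mu_onA (aon S)). Qed.

Lemma mu1l (S : algebra Z) W : h2 (mu S) W ∘ h0 (iota S) (S ⊗ W) = idm _.
Proof. by have /h2_h0l -> := mu_on1l (aon S). Qed.

Lemma mu1r (S : algebra Z) W : h2 (mu S) W ∘ S ◁ h0 (iota S) W = idm _.
Proof. by have /h2_h0r -> := mu_on1r (aon S). Qed.

Lemma h1_mu (A S : algebra Z) (f : alghom A S) W :
  h1 f W ∘ h2 (mu A) W = h2 (mu S) W ∘ (h1 f (S ⊗ W) ∘ A ◁ h1 f W).
Proof. by rewrite -h2D ahom_mu tensm_wlh1 compA h2_wl h2_h1 -compA. Qed.

Lemma h1_iota (A S : algebra Z) (f : alghom A S) W :
  h1 f W ∘ h0 (iota A) W = h0 (iota S) W.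
Proof. by rewrite -h0D ahom_iota. Qed.

Section CospanHats.
Variables (A B : comAlg Z) (S : cospan A B).

Lemma leglC W : h2 (mu S) W ∘ S ◁ h1 (legl S) W
  = h2 (mu S) W ∘ (h1 (legl S) (S ⊗ W) ∘ hb S A W).
Proof. by rewrite -h2_wl wlE legl_central h2_br -h1E h2_h1 -compA. Qed.

Lemma legrC W : h2 (mu S) W ∘ h1 (legr S) (S ⊗ W)
  = h2 (mu S) W ∘ (S ◁ h1 (legr S) W ∘ hb B S W).
Proof. by rewrite -h2_h1 h1E legr_central h2_br -wlE h2_wl -compA. Qed.
End CospanHats.

Definition td_pt (A B : comAlg Z) (S T : cospan A B) M (D : twodiag_on S T M) :
  hom unit_ob M := td_l D ∘ iota S.

Section Facts.
Variables (A B : comAlg Z) (S T : cospan A B) (M : Z) (D : twodiag_on S T M).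

Lemma tdA_l : assoc (td_lact D) (mu T) (td_lact D) (td_lact D).
Proof. exact/assocP/lact_mu. Qed.
Lemma tdA_r : assoc (td_ract D) (td_ract D) (td_ract D) (mu S).
Proof. exact/assocP/ract_mu. Qed.
Lemma tdA_lr : assoc (td_ract D) (td_lact D) (td_lact D) (td_ract D).
Proof. exact/assocP/bim_lr. Qed.
Lemma td_1l W : h2 (td_lact D) W ∘ h0 (iota T) (M ⊗ W) = idm _.
Proof. by have /h2_h0l -> := lact_iota (bim_l (td_bim D)). Qed.
Lemma td_1r W : h2 (td_ract D) W ∘ M ◁ h0 (iota S) W = idm _.
Proof. by have /h2_h0r -> := ract_iota (bim_r (td_bim D)). Qed.
Lemma td_al W : h2 (td_ract D) W ∘ M ◁ h1 (legl S) W
  = h2 (td_lact D) W ∘ (h1 (legl T) (M ⊗ W) ∘ hb M A W).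
Proof.
have e : td_lact D ∘ (legl T ⊠ idm M) = td_ract D ∘ (idm M ⊠ legl S) ∘ brV M A.
  exact: td_actl.
rewrite compA -h2_h1 (h1E (legl T)) e -wlE h2_brV h2_wl -!compA hbK.
by rewrite compm1.
Qed.
Lemma td_ar W : h2 (td_lact D) W ∘ h1 (legr T) (M ⊗ W)
  = h2 (td_ract D) W ∘ (M ◁ h1 (legr S) W ∘ hb B M W).
Proof.
have e : td_lact D ∘ (legr T ⊠ idm M) = td_ract D ∘ (idm M ⊠ legr S) ∘ br B M.
  exact: td_actr.
by rewrite -h2_h1 (h1E (legr T)) e h2_br -wlE h2_wl -!compA.
Qed.

Lemma td_ptr : td_r D ∘ iota T = td_pt D.
Proof. by rewrite /td_pt -(ahom_iota (legl S)) compA td_legl -compA ahom_iota. Qed.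

Lemma h1_td_l W : h1 (td_l D) W = h2 (td_ract D) W ∘ h0 (td_pt D) (S ⊗ W).
Proof.
have e : td_l D ∘ mu S = td_ract D ∘ (td_l D ⊠ idm S) by exact: td_l_linear.
by rewrite h0D compA -h2_h1 (h1E _ S) -e h2D -compA mu1l compm1.
Qed.

Lemma h1_td_r W : h1 (td_r D) W = h2 (td_lact D) W ∘ T ◁ h0 (td_pt D) W.
Proof.
have e : td_r D ∘ mu T = td_lact D ∘ (idm T ⊠ td_r D) by exact: td_r_linear.
by rewrite -td_ptr h0D wlD compA -h2_wl wlE -e h2D -compA mu1r compm1.
Qed.
End Facts.

Lemma mk_twodiag (A B : comAlg Z) (S T : cospan A B) (M : Z)
    (la : hom (T ⊗ M) M) (ra : hom (M ⊗ S) M) (pt : hom unit_ob M) :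
  assoc la (mu T) la la -> assoc ra ra ra (mu S) -> assoc ra la la ra ->
  (forall W, h2 la W ∘ h0 (iota T) (M ⊗ W) = idm _) ->
  (forall W, h2 ra W ∘ M ◁ h0 (iota S) W = idm _) ->
  (forall W, h2 ra W ∘ M ◁ h1 (legl S) W
    = h2 la W ∘ (h1 (legl T) (M ⊗ W) ∘ hb M A W)) ->
  (forall W, h2 la W ∘ h1 (legr T) (M ⊗ W)
    = h2 ra W ∘ (M ◁ h1 (legr S) W ∘ hb B M W)) ->
  exists D : twodiag_on S T M,
    [/\ td_lact D = la, td_ract D = ra & td_pt D = pt].
Proof.
move=> all arr alr l1 r1 al ar.
pose ml := LModuleOn (assocE all) (iffRL (h2_h0l _ _) l1).
pose mr := RModuleOn (assocE arr) (iffRL (h2_h0r _ _) r1).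
pose b := @BimoduleOn _ _ _ _ ml mr (assocE alr).
pose f := ra ∘ (pt ⊠ idm S) ∘ lamV S.
pose g := la ∘ (idm T ⊠ pt) ∘ rgtV T.
have ef W : h1 f W = h2 ra W ∘ h0 pt (S ⊗ W) by rewrite h1_lamV h1_id compm1.
have eg W : h1 g W = h2 la W ∘ T ◁ h0 pt W by rewrite h1_rgtV h1_id comp1m.
clearbody f g.
have d1 : f ∘ mu S = ra ∘ (f ⊠ idm S).
  apply: h2_inj; rewrite -h1E h2D h2_h1 !ef; apply: homext => U x.
  by nfw (rw2 (arr _)).
have d2 : g ∘ mu T = la ∘ (idm T ⊠ g).
  apply: h2_inj; rewrite -wlE h2D h2_wl !eg; apply: homext => U x.
  by nfw (rw2 (all _)).
(* Evaluated on the point, [al] says that the two legs act alike from the two sides, because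
   braiding past a point is trivial. *)
have d3 : f ∘ legl S = g ∘ legl T.
  apply: h1_inj; rewrite !h1D ef eg; apply: homext => U x; hat_simp.
  by rw2 (esym (wl_h0 pt (h1 (legl S) _))); rw2 (al _); nf.
have d4 : f ∘ legr S = g ∘ legr T.
  apply: h1_inj; rewrite !h1D ef eg; apply: homext => U x; hat_simp.
  by nfw (rw2 (ar _)).
have d5 : la ∘ (legl T ⊠ idm M) = ra ∘ (idm M ⊠ legl S) ∘ brV M A.
  apply: h2_inj; rewrite -h1E -wlE h2_brV h2_h1 h2_wl al -!compA hbVK compm1 //.
have d6 : la ∘ (legr T ⊠ idm M) = ra ∘ (idm M ⊠ legr S) ∘ br B M.
  by apply: h2_inj; rewrite -h1E -wlE h2_br h2_h1 h2_wl ar compA.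
exists (@TwoDiagOn _ _ _ _ _ _ b f g d1 d2 d3 d4 d5 d6); split=> //.
apply: h0_inj; rewrite /td_pt /= h0D ef; apply: homext => U x; hat_simp.
by rw2 (esym (wl_h0 pt (h0 (iota S) _))); rw2 (r1 _).
Qed.
End TwoDiagramHats.

(** * Composite cospans *)

Section Composites.
Variables (Z : braided) (H : coequalizer_assumption Z).

Lemma rho_univ (A : algebra Z) (M N : Z) (m : rmodule_on A M)
    (n : lmodule_on A N) : univ (ract m) (lact n) (rho H m n).
Proof. exact: (univP H (actions_reflexive m n) (coeqP _)). Qed.

Section Actions.
Variables (A B : comAlg Z) (S T : cospan A B) (M : Z) (D : twodiag_on S T M).

(** The middle algebra of a horizontal composite acts on the first factor through its source cospan,
    by [td_rb], and on the second through its target cospan, by [td_lb]. *)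
Definition td_rb : hom (M ⊗ B) M := td_ract D ∘ (idm M ⊠ legr S).
Definition td_lb : hom (A ⊗ M) M := td_lact D ∘ (legl T ⊠ idm M).

Lemma h2_rb W : h2 td_rb W = h2 (td_ract D) W ∘ M ◁ h1 (legr S) W.
Proof. by rewrite /td_rb -wlE h2_wl. Qed.
Lemma h2_lb W : h2 td_lb W = h2 (td_lact D) W ∘ h1 (legl T) (M ⊗ W).
Proof. by rewrite /td_lb -h1E h2_h1. Qed.

(** The eight lemmas from here to [td_llb_assoc] are the compatibilities that [prodrel_exists] asks
    for. Those with a braiding rest on central legs or on the axioms behind [td_al] and [td_ar]; the
    others are bimodule laws. *)
Lemma td_rb_comm W : h2 (td_ract D) W ∘ h2 td_rb (S ⊗ W)
  = h2 td_rb W ∘ (h2 (td_ract D) (B ⊗ W) ∘ M ◁ hb B S W).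
Proof.
rewrite !h2_rb; apply: homext => U x.
by nfw (first [rw2 (tdA_r D _) | rw2 (legrC S _)]).
Qed.

Lemma td_lb_comm W : h2 (td_lact D) W ∘ T ◁ h2 td_lb W
  = h2 td_lb W ∘ (A ◁ h2 (td_lact D) W ∘ hb T A (M ⊗ W)).
Proof.
rewrite !h2_lb; apply: homext => U x.
nfw (first [rw2 (esym (tdA_l D _))]).
by nfw (first [rw2 (leglC T _) | rw2 (tdA_l D _)]).
Qed.

Lemma td_rb_lact W : h2 (td_lact D) W ∘ h2 (mu T ∘ (idm T ⊠ legr T)) (M ⊗ W)
  = h2 td_rb W ∘ (h2 (td_lact D) (B ⊗ W) ∘ T ◁ hb B M W).
Proof.
rewrite !h2_rb -wlE h2_wl; apply: homext => U x.
by nfw (first [rw2 (tdA_l D _) | rw2 (td_ar D _) | rw2 (tdA_lr D _)]).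
Qed.

Lemma td_lb_ract W : h2 (td_ract D) W ∘ M ◁ h2 (mu S ∘ (legl S ⊠ idm S)) W
  = h2 td_lb W ∘ (A ◁ h2 (td_ract D) W ∘ hb M A (S ⊗ W)).
Proof.
rewrite !h2_lb -h1E h2_h1; apply: homext => U x; hat_simp.
rw2 (esym (tdA_r D _)); rw2 (td_al D _).
by nfw (first [rw2 (tdA_lr D _)]).
Qed.

Lemma td_lrb_assoc : assoc td_rb (td_lact D) (td_lact D) td_rb.
Proof.
move=> W; rewrite !h2_rb; apply: homext => U x.
by nfw (first [rw2 (tdA_lr D _)]).
Qed.
Lemma td_lbr_assoc : assoc (td_ract D) td_lb td_lb (td_ract D).
Proof.
move=> W; rewrite !h2_lb; apply: homext => U x.
by nfw (first [rw2 (tdA_lr D _)]).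
Qed.
Lemma td_rrb_assoc :
  assoc td_rb (td_ract D) (td_ract D) (mu S ∘ (idm S ⊠ legr S)).
Proof.
move=> W; rewrite !h2_rb -wlE h2_wl; apply: homext => U x.
by nfw (first [rw2 (tdA_r D _)]).
Qed.
Lemma td_llb_assoc :
  assoc (td_lact D) (mu T ∘ (legl T ⊠ idm T)) td_lb (td_lact D).
Proof.
move=> W; rewrite !h2_lb -h1E h2_h1; apply: homext => U x.
by nfw (first [rw2 (tdA_l D _)]).
Qed.
End Actions.

Section Htensor.
Variables (A B C : comAlg Z) (S S' : cospan A B) (T T' : cospan B C).
Variables (M : twodiag S S') (N : twodiag T T').

Lemma hrho_univ : univ (td_rb (td_on M)) (td_lb (td_on N)) (hrho H M N).
Proof. exact: rho_univ. Qed.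

Lemma cosp_rho_univ : univ (mu S ∘ (idm S ⊠ legr S)) (mu T ∘ (legl T ⊠ idm T))
  (cosp_rho H S T).
Proof. exact: rho_univ. Qed.

Lemma hract_ex : exists p, prodrel p (hrho H M N) (cosp_rho H S T) (hrho H M N)
  (td_ract (td_on M)) (td_ract (td_on N)).
Proof.
apply: (prodrel_exists H hrho_univ cosp_rho_univ (univ_bal hrho_univ)).
- exact: td_rb_comm.
- exact: td_lbr_assoc.
- exact: td_rrb_assoc.
- exact: td_lb_ract.
Qed.
End Htensor.

Lemma hlact_ex (A B C : comAlg Z) (S S' : cospan A B) (T T' : cospan B C)
    (M : twodiag S S') (N : twodiag T T') :
  exists p, prodrel p (cosp_rho H S' T') (hrho H M N) (hrho H M N)
  (td_lact (td_on M)) (td_lact (td_on N)).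
Proof.
apply: (prodrel_exists H (cosp_rho_univ S' T') (hrho_univ M N)
  (univ_bal (hrho_univ M N))).
- exact: td_rb_lact.
- exact: td_llb_assoc.
- exact: td_lrb_assoc.
- exact: td_lb_comm.
Qed.

End Composites.

Section Composites.
Variables (Z : braided) (H : coequalizer_assumption Z).
Variables (A B C : comAlg Z) (S : cospan A B) (T : cospan B C).
Let k := cosp_rho H S T.
Let u : univ _ _ k := cosp_rho_univ H S T.

Lemma composite_ex : inhabited (composite H S T).
Proof.
(* The multiplication is the right action on the horizontal tensor product of the identity
   2-diagrams of [S] and [T]. *)
have [p e] : exists p, prodrel p k k k (mu S) (mu T).
  exact: (hract_ex H (id_twodiag S) (id_twodiag T)).
have pA : assoc p p p p.
  exact: (prodrel_assoc H u u u e e e e (@muA _ S) (@muA _ T)).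
pose i : hom unit_ob (cosp_tensor H S T)
  := k ∘ ((iota S ⊠ iota T) ∘ lamV unit_ob).
have ei W : h0 i W = h2 k W ∘ (h0 (iota S) _ ∘ h0 (iota T) W) by apply: h0_pair.
have sl W : h2 (mu S) W ∘ h0 (iota S) (S ⊗ W) = h1 (idm S) W.
  by rewrite mu1l h1_id.
have tl W : h2 (mu T) W ∘ h0 (iota T) (T ⊗ W) = h1 (idm T) W.
  by rewrite mu1l h1_id.
have sr W : h2 (mu S) W ∘ S ◁ h0 (iota S) W = h1 (idm S) W.
  by rewrite mu1r h1_id.
have tr W : h2 (mu T) W ∘ T ◁ h0 (iota T) W = h1 (idm T) W.
  by rewrite mu1r h1_id.
have p1l W : h2 p W ∘ h0 i (cosp_tensor H S T ⊗ W) = idm _.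
  apply: (univ_epi u); rewrite ei -!compA (prodrel_l00 e sl tl).
  by rewrite !h1_id wl_id !comp1m !compm1.
have p1r W : h2 p W ∘ (cosp_tensor H S T) ◁ h0 i W = idm _.
  apply: (univ_epi u); rewrite ei -!compA (prodrel_r00 e sr tr).
  by rewrite !h1_id wl_id !comp1m !compm1.
pose K := AlgebraOn (assocE pA) (iffRL (h2_h0l _ _) p1l) (iffRL (h2_h0r _ _) p1r).
pose a := k ∘ (idm S ⊠ iota T) ∘ rgtV S ∘ legl S.
pose c := k ∘ (iota S ⊠ idm T) ∘ lamV T ∘ legr T.
have ea W : h1 a W = h2 k W ∘ (S ◁ h0 (iota T) W ∘ h1 (legl S) W).
  by rewrite /a h1D h1_rgtV h1_id comp1m -compA.
have ec W : h1 c W = h2 k W ∘ (h0 (iota S) (T ⊗ W) ∘ h1 (legr T) W).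
  by rewrite /c h1D h1_lamV h1_id compm1 -compA.
have Ea : a = k ∘ (idm S ⊠ iota T) ∘ rgtV S ∘ legl S by [].
have Ec : c = k ∘ (iota S ⊠ idm T) ∘ lamV T ∘ legr T by [].
clearbody a c.
have am : a ∘ mu A = p ∘ (a ⊠ a).
  apply: h2_inj; rewrite tensm_wlh1 compA h2_wl h2_h1 h2D.
  rewrite [in X in _ = _ ∘ X]ea wlD -!compA.
  rewrite (compA (h1 a _)) (compA (h2 p _)) (prodrel_l0 e tl ea) ea h1_id !wl_id.
  rewrite compm1; apply: homext => U x.
  by nfw (rw2 (h1_mu (legl S) _)).
have cm : c ∘ mu C = p ∘ (c ⊠ c).
  apply: h2_inj; rewrite tensm_wlh1 compA h2_wl h2_h1 h2D.
  rewrite [in X in _ = _ ∘ X]ec wlD -!compA.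
  rewrite (compA (h1 c _)) (compA (h2 p _)) (prodrel_0l e sl ec) ec h1_id comp1m.
  apply: homext => U x.
  by nfw (rw2 (h1_mu (legr T) _)).
have ai : a ∘ iota A = i.
  apply: h0_inj; rewrite h0D ei ea; apply: homext => U x; hat_simp.
  by rw2 (h1_iota (legl S) _); nf.
have ci : c ∘ iota C = i.
  apply: h0_inj; rewrite h0D ei ec; apply: homext => U x; hat_simp.
  by rw2 (h1_iota (legr T) _).
pose ah := @AlgHom Z A (Algebra K) a am ai.
pose ch := @AlgHom Z C (Algebra K) c cm ci.
(* [prodrel_r0] braids [A] past [T], centrality of [legl S] braids it past [S], and [hb_h2l]
   assembles both into the braiding past the composite. *)
have aC : p ∘ (idm _ ⊠ a) = p ∘ (a ⊠ idm _) ∘ br _ A.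
  apply: h2_inj; rewrite -wlE -h1E h2_br h2_wl h2_h1; apply: (univ_epi u).
  rewrite -compA (prodrel_r0 e tr ea) h1_id !wl_id comp1m -!compA hb_h2l.
  rewrite (compA (h1 a _)) (compA (h2 p _)) (prodrel_l0 e tl ea).
  rewrite h1_id !wl_id; apply: homext => U x; hat_simp.
  by rewrite (ap2 (leglC S _)); nf.
have cC : p ∘ (c ⊠ idm _) = p ∘ (idm _ ⊠ c) ∘ br C _.
  apply: h2_inj; rewrite -wlE -h1E h2_br h2_wl h2_h1.
  apply: (univ_wl_epi H u).
  rewrite -!compA (prodrel_0l e sl ec) h1_id comp1m hb_h2r.
  rewrite (compA (_ ◁ h1 c _)) (compA (h2 p _)) (prodrel_0r e sr ec).
  rewrite h1_id; apply: homext => U x; hat_simp.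
  by rw2 (legrC T _); nf.
constructor.
apply: (@Composite Z H A B C S T K _ _ ah ch _ _ aC cC) => //.
exact: prodrelE.
Qed.
End Composites.

(** * Isomorphism classes and vertical composites *)

Notation tla D := (td_lact (td_on D)).
Notation tra D := (td_ract (td_on D)).
Notation tpt D := (td_pt (td_on D)).

Section Cells.
Variables (Z : braided) (A B : comAlg Z).
Implicit Types S T : cospan A B.

(* Preserving the image of the unit amounts to preserving both maps S -> M <- T. *)
Definition bimap S T (D D' : twodiag S T) (d : hom (td_ob D) (td_ob D')) :=
  [/\ forall W, h1 d W ∘ h2 (tla D) W = h2 (tla D') W ∘ T ◁ h1 d W,
      forall W, h1 d W ∘ h2 (tra D) W = h2 (tra D') W ∘ h1 d (S ⊗ W)
    & d ∘ tpt D = tpt D'].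

Lemma bimap_3cell S T (D D' : twodiag S T) (d : hom (td_ob D) (td_ob D')) :
  bimap d -> is_3cell d.
Proof.
case=> el er ep.
have ep' W : h1 d W ∘ h0 (tpt D) W = h0 (tpt D') W by rewrite -h0D ep.
split.
- by apply: h2_inj; rewrite -wlE h2_wl h2D el.
- by apply: h2_inj; rewrite -h1E h2_h1 h2D er.
- by apply: h1_inj; rewrite h1D !h1_td_l compA er -compA ep'.
- by apply: h1_inj; rewrite h1D !h1_td_r compA el -compA -wlD ep'.
Qed.

Lemma is_3cell_bimap S T (D D' : twodiag S T) (d : hom (td_ob D) (td_ob D')) :
  is_3cell d -> bimap d.
Proof.
case=> el er ef eg; split=> [W|W|].
- by rewrite -h2D el -wlE h2_wl.
- by rewrite -h2D er -h1E h2_h1.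
- by rewrite /td_pt compA ef.
Qed.

Lemma bimap_inv S T (D D' : twodiag S T) d d' :
  @bimap S T D D' d -> d' ∘ d = idm _ -> d ∘ d' = idm _ -> @bimap S T D' D d'.
Proof.
case=> el er ep d1 d2.
have k W : h1 d' W ∘ h1 d W = idm _ by rewrite -h1D d1 h1_id.
have k' W : h1 d W ∘ h1 d' W = idm _ by rewrite -h1D d2 h1_id.
split=> [W|W|].
- rewrite -[RHS]comp1m -k -!compA (compA (h1 d W)) el -compA -wlD k' wl_id.
  by rewrite compm1.
- rewrite -[RHS]comp1m -k -!compA (compA (h1 d W)) er -compA k'.
  by rewrite compm1.
- by rewrite -ep compA d1 comp1m.
Qed.

Lemma bimap_rb S T (D D' : twodiag S T) d : @bimap S T D D' d -> forall W,
  h1 d W ∘ h2 (td_rb (td_on D)) W = h2 (td_rb (td_on D')) W ∘ h1 d (B ⊗ W).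
Proof.
case=> el er ep W; rewrite !h2_rb; apply: homext => U x.
by nfw (rw2 (er _)).
Qed.

Lemma bimap_lb S T (D D' : twodiag S T) d : @bimap S T D D' d -> forall W,
  h1 d W ∘ h2 (td_lb (td_on D)) W = h2 (td_lb (td_on D')) W ∘ A ◁ h1 d W.
Proof.
case=> el er ep W; rewrite !h2_lb; apply: homext => U x.
by nfw (rw2 (el _)).
Qed.

Lemma td_isoP S T (D D' : twodiag S T) d d' :
  @bimap S T D D' d -> d' ∘ d = idm _ -> d ∘ d' = idm _ -> td_iso D D'.
Proof.
by move=> b d1 d2; exists d, d'; split=> //; apply: bimap_3cell => //;
  apply: bimap_inv b _ _.
Qed.

Lemma td_isoE S T (D D' : twodiag S T) : td_iso D D' ->
  exists d d', [/\ @bimap S T D D' d, d' ∘ d = idm _ & d ∘ d' = idm _].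
Proof.
by case=> d [d' [c _ e1 e2]]; exists d, d'; split=> //; apply: is_3cell_bimap.
Qed.

Lemma bimap_id S T (D : twodiag S T) : bimap (idm (td_ob D)).
Proof. by split=> [W|W|]; rewrite ?h1_id ?wl_id ?comp1m ?compm1. Qed.

Lemma bimap_comp S T (D D' D'' : twodiag S T) d d' :
  @bimap S T D D' d -> @bimap S T D' D'' d' -> @bimap S T D D'' (d' ∘ d).
Proof.
case=> el er ep [el' er' ep']; split=> [W|W|].
- by rewrite !h1D wlD -compA el compA el' -compA.
- by rewrite !h1D -compA er compA er' -compA.
- by rewrite -compA ep ep'.
Qed.

Lemma td_iso_refl S T (D : twodiag S T) : td_iso D D.
Proof. by apply: (td_isoP (bimap_id D) (d' := idm _)); rewrite comp1m. Qed.

Lemma td_iso_sym S T (D D' : twodiag S T) : td_iso D D' -> td_iso D' D.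
Proof.
by case/td_isoE=> d [d' [b e1 e2]]; apply: (td_isoP (bimap_inv b e1 e2) (d' := d)).
Qed.

Lemma td_iso_trans S T (D D' D'' : twodiag S T) :
  td_iso D D' -> td_iso D' D'' -> td_iso D D''.
Proof.
case/td_isoE=> d [d' [b e1 e2]] /td_isoE [c [c' [b' e1' e2']]].
apply: (td_isoP (bimap_comp b b') (d' := d' ∘ c')).
  by rewrite compA -(compA d') e1' compm1.
by rewrite compA -(compA c) e2 compm1.
Qed.

Lemma cell_eq S T (c c' : cell S T) : sval c = sval c' -> c = c'.
Proof.
case: c c' => [c hc] [c' hc'] /= e; case: _ / e in hc' *.
by rewrite (proof_irrelevance _ hc hc').
Qed.

(** A class is the predicate [td_iso D], so equality of classes takes functional and propositional
    extensionality, besides symmetry and transitivity of [td_iso]. *)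
Lemma class_of_eq S T (D D' : twodiag S T) :
  td_iso D D' -> class_of D = class_of D'.
Proof.
move=> i; apply: cell_eq; apply: functional_extensionality => E /=.
apply: propositional_extensionality; split.
  by apply: td_iso_trans; apply: td_iso_sym.
exact: td_iso_trans.
Qed.

Lemma class_of_inj S T (D D' : twodiag S T) :
  class_of D = class_of D' -> td_iso D D'.
Proof. by case=> ->; apply: td_iso_refl. Qed.

Lemma cellP S T (c : cell S T) : {D | c = class_of D}.
Proof.
apply: constructive_indefinite_description.
by case: c => c [D e]; exists D; apply: cell_eq.
Qed.

End Cells.

Section Vertical.
Variables (Z : braided) (H : coequalizer_assumption Z) (A B : comAlg Z).

(** [X] and [q] are arbitrary rather than the chosen coequalizer, so that convenient models can
    serve as composites, such as [M] itself for its composite with an identity. *)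
Record is_vc (R S T : cospan A B) (M : twodiag R S) (N : twodiag S T)
    (X : twodiag R T) (q : hom (td_ob N ⊗ td_ob M) (td_ob X)) : Prop := IsVc {
  vc_univ : univ (tra N) (tla M) q;
  vc_la : assoc q (tla N) (tla X) q;
  vc_ra : assoc (tra X) q q (tra M);
  vc_pt : tpt X = q ∘ ((tpt N ⊠ tpt M) ∘ lamV unit_ob)
}.

Lemma vc_h0 R S T M N X q (v : @is_vc R S T M N X q) W :
  h0 (tpt X) W = h2 q W ∘ (h0 (tpt N) _ ∘ h0 (tpt M) W).
Proof. by rewrite (vc_pt v) h0_pair. Qed.

Lemma vc_map R S T M N X q M' N' X' q' (v : @is_vc R S T M N X q)
    (v' : @is_vc R S T M' N' X' q') m n :
  @bimap _ _ _ _ _ M M' m -> @bimap _ _ _ _ _ N N' n ->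
  exists d, @bimap _ _ _ _ _ X X' d /\ d ∘ q = q' ∘ (n ⊠ m).
Proof.
move=> [ml mr mp] [nl nr np].
have [W|d ed] := @univ_ext _ _ _ _ _ _ _ _ (vc_univ v) _ (q' ∘ (n ⊠ m)).
  rewrite tensm_wlh1 compA !h2_wl !h2_h1; apply: homext => U x; hat_simp.
  by nfw (first [rw2 (nr _) | rw2 (ml _) | rw2 (univ_bal (vc_univ v') _)]).
have hd W : h1 d W ∘ h2 q W = h2 q' W ∘ (h1 n _ ∘ td_ob N ◁ h1 m W).
  by rewrite -h2D ed tensm_wlh1 compA h2_wl h2_h1 -compA.
exists d; split=> //; split=> [W|W|].
- apply: (univ_wl_epi H (vc_univ v)).
  apply: homext => U x; hat_simp; rw2 (esym (vc_la v _)).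
  by nfw (first [rw2 (hd _) | rw2 (nl _) | rw2 (esym (vc_la v' _))]).
- apply: (univ_epi (vc_univ v)).
  apply: homext => U x; hat_simp; rw2 (vc_ra v _).
  by nfw (first [rw2 (hd _) | rw2 (mr _) | rw2 (vc_ra v' _)]).
apply: h0_inj; rewrite h0D (vc_h0 v) (vc_h0 v') -np -mp !h0D.
by apply: homext => U x; hat_simp; rw2 (hd _); nf.
Qed.

(** It has two uses: with [M] and [N] varying, vertical composition is well defined on classes; with
    both fixed, composites are unique up to isomorphism. *)
Lemma vc_iso R S T M N X q M' N' X' q' :
  @is_vc R S T M N X q -> @is_vc R S T M' N' X' q' ->
  td_iso M M' -> td_iso N N' -> td_iso X X'.
Proof.
move=> v v' /td_isoE [m [m' [bm m1 m2]]] /td_isoE [n [n' [bn n1 n2]]].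
have [d [bd ed]] := vc_map v v' bm bn.
have [d' [_ ed']] := vc_map v' v (bimap_inv bm m1 m2) (bimap_inv bn n1 n2).
apply: (td_isoP bd (d' := d')).
  apply: (univ_inj (vc_univ v)).
  by rewrite -compA ed compA ed' -compA -tensm_comp m1 n1 tensm_id compm1 comp1m.
apply: (univ_inj (vc_univ v')).
by rewrite -compA ed' compA ed -compA -tensm_comp m2 n2 tensm_id compm1 comp1m.
Qed.

Lemma is_vcompP (R S T : cospan A B) (M : twodiag R S) (N : twodiag S T)
    (F : twodiag_on R T (vtensor H M N)) :
  is_vcomp F -> @is_vc R S T M N (TwoDiag F)
   (rho H (bim_r (td_bim (td_on N))) (bim_l (td_bim (td_on M)))).
Proof.
case=> el er ef eg; split.
- exact: rho_univ.
- by apply: assocP; rewrite /= el -!compA alphaK compm1.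
- exact: assocP.
- rewrite /td_pt ef; apply: h0_inj; rewrite h0D h0_pair h1_lamV -!compA.
  by rewrite -(h0D (td_l (td_on M))).
Qed.

(** [T] acts through [N] and [R] through [M]; both actions descend along [q] because they commute
    with the actions of [S] that [q] balances. *)
Lemma vc_exists (R S T : cospan A B) (M : twodiag R S) (N : twodiag S T)
    (Q : Z) (q : hom (td_ob N ⊗ td_ob M) Q) : univ (tra N) (tla M) q ->
  exists F : twodiag_on R T Q, @is_vc R S T M N (TwoDiag F) q.
Proof.
move=> u.
have b := univ_bal u.
have nr := tdA_r (td_on N); have nl := tdA_l (td_on N).
have nlr := tdA_lr (td_on N); have ml := tdA_l (td_on M).
have mr := tdA_r (td_on M); have mlr := tdA_lr (td_on M).
have nal := td_al (td_on N); have nar := td_ar (td_on N).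
have mal := td_al (td_on M); have mar := td_ar (td_on M).
have [W|la el] := @univ_lext _ H _ _ _ _ _ _ _ u T _ _ (tla N) q.
  by apply: homext => U x; nfw (first [rw2 (esym (nlr _)) | rw2 (b _)]).
have [W|ra er] := @univ_rext _ _ _ _ _ _ _ _ u R _ _ (tra M) q.
  by apply: homext => U x; nfw (first [rw2 (mlr _) | rw2 (b _)]).
pose pt := q ∘ ((tpt N ⊠ tpt M) ∘ lamV unit_ob).
have [| | | | | | |F [Fl Fr Fp]] := @mk_twodiag _ A B R T _ la ra pt.
- move=> W; apply: (univ_wl2_epi H u); apply: homext => U x; hat_simp.
  rw2 (esym (wl_h2 (mu T) (h2 q _))).
  rw2 (esym (el _)).
  by nfw (first [rw2 (esym (el _)) | rw2 (nl _)]).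
- move=> W; apply: (univ_epi u); apply: homext => U x.
  by nfw (first [rw2 (er _) | rw2 (mr _)]).
- move=> W; apply: (univ_wl_epi H u); apply: homext => U x.
  by nfw (first [rw2 (esym (el _)) | rw2 (er _)]).
- move=> W; apply: (univ_epi u); apply: homext => U x; hat_simp.
  rw2 (esym (wl_h0 (iota T) (h2 q _))); rw2 (esym (el _)).
  by nfw (first [rw2 (esym (el _)) | rw2 (td_1l (td_on N) _)]).
- move=> W; apply: (univ_epi u); apply: homext => U x.
  by nfw (first [rw2 (er _) | rw2 (td_1r (td_on M) _)]).
(* The element of [A] crosses [M], becoming a left action of [S]; balance moves it to a right action
   on [N], and it then crosses [N]. *)
- move=> W; apply: (univ_epi u); apply: homext => U x.
  nfw (first [rw2 (er _) | rw2 (mal _)]).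
  rw2 (esym (b _)); rw2 (esym (wl_h1 (legl T) (h2 q _))); rw2 (esym (el _)).
  by nfw (rw2 (nal _)).
- move=> W; apply: (univ_wl_epi H u); apply: homext => U x; hat_simp.
  rw2 (esym (wl_h1 (legr T) (h2 q _))); rw2 (esym (el _)).
  by nfw (first [rw2 (nar _) | rw2 (b _) | rw2 (mar _) | rw2 (er _)]).
by exists F; split; rewrite // /= ?Fl ?Fr ?Fp.
Qed.

Lemma vc_is_vcomp (R S T : cospan A B) (M : twodiag R S) (N : twodiag S T)
    (F : twodiag_on R T (vtensor H M N)) :
  @is_vc R S T M N (TwoDiag F)
   (rho H (bim_r (td_bim (td_on N))) (bim_l (td_bim (td_on M)))) -> is_vcomp F.
Proof.
case; set q := rho _ _ _ => u el er ep.
have epW W : h0 (td_pt F) W = h2 q W ∘ (h0 (tpt N) _ ∘ h0 (tpt M) W).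
  by rewrite -h0_pair -ep.
split.
- by rewrite (assocE el) -!compA alphaVK compm1.
- exact: assocE.
- apply: h1_inj; rewrite h1_lamV h1_td_l epW (h1_td_l (td_on M)).
  by apply: homext => U x; hat_simp; rw2 (er _); nf.
- apply: h1_inj; rewrite h1_rgtV h1_td_r epW (h1_td_r (td_on N)) td_ptr.
  apply: homext => U x; hat_simp.
  by rw2 (esym (el _)); nf.
Qed.

Lemma vc_ex (R S T : cospan A B) (M : twodiag R S) (N : twodiag S T) :
  exists F : twodiag_on R T (vtensor H M N), is_vcomp F.
Proof.
have [F vF] := vc_exists (rho_univ H (bim_r (td_bim (td_on N))) (bim_l (td_bim (td_on M)))).
by exists F; apply: vc_is_vcomp.
Qed.

End Vertical.

(** * Horizontal composites *)

Section CompositeHats.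
Variables (Z : braided) (H : coequalizer_assumption Z) (A B C : comAlg Z).
Variables (S : cospan A B) (T : cospan B C) (K : composite H S T).
Notation ck := (composite_cospan K).
Notation k := (cosp_rho H S T).

Lemma cmp_prod : prodrel (mu ck) k k k (mu S) (mu T).
Proof. exact/prodrelP/cmp_mu. Qed.

Lemma cmp_h0 W : h0 (iota ck) W = h2 k W ∘ (h0 (iota S) _ ∘ h0 (iota T) W).
Proof. by rewrite /iota (cmp_iota K) h0_pair. Qed.

Lemma cmp_h1l W :
  h1 (legl ck) W = h2 k W ∘ (S ◁ h0 (iota T) W ∘ h1 (legl S) W).
Proof. by rewrite (cmp_leglE K) h1D h1_rgtV h1_id comp1m -compA. Qed.

Lemma cmp_h1r W :
  h1 (legr ck) W = h2 k W ∘ (h0 (iota S) (T ⊗ W) ∘ h1 (legr T) W).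
Proof. by rewrite (cmp_legrE K) h1D h1_lamV h1_id compm1 -compA. Qed.
End CompositeHats.

Section Horizontal.
Variables (Z : braided) (H : coequalizer_assumption Z) (A B C : comAlg Z).

Section Relation.
Variables (S S' : cospan A B) (T T' : cospan B C).
Variables (K : composite H S T) (K' : composite H S' T').

Record is_hc (M : twodiag S S') (N : twodiag T T')
    (X : twodiag (composite_cospan K) (composite_cospan K'))
    (q : hom (td_ob M ⊗ td_ob N) (td_ob X)) : Prop := IsHc {
  hc_univ : univ (td_rb (td_on M)) (td_lb (td_on N)) q;
  hc_la : prodrel (tla X) (cosp_rho H S' T') q q (tla M) (tla N);
  hc_ra : prodrel (tra X) q (cosp_rho H S T) q (tra M) (tra N);
  hc_pt : tpt X = q ∘ ((tpt M ⊠ tpt N) ∘ lamV unit_ob)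
}.

Lemma hc_h0 M N X q (v : @is_hc M N X q) W :
  h0 (tpt X) W = h2 q W ∘ (h0 (tpt M) _ ∘ h0 (tpt N) W).
Proof. by rewrite (hc_pt v) h0_pair. Qed.

Lemma hc_map M N X q M' N' X' q' (v : @is_hc M N X q)
    (v' : @is_hc M' N' X' q') m n :
  @bimap _ _ _ _ _ M M' m -> @bimap _ _ _ _ _ N N' n ->
  exists d, @bimap _ _ _ _ _ X X' d /\ d ∘ q = q' ∘ (m ⊠ n).
Proof.
move=> bm bn; have [ml mr mp] := bm; have [nl nr np] := bn.
have mrb := bimap_rb bm; have nlb := bimap_lb bn.
have b' := univ_bal (hc_univ v').
have [W|d ed] := @univ_ext _ _ _ _ _ _ _ _ (hc_univ v) _ (q' ∘ (m ⊠ n)).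
  rewrite tensm_wlh1 compA !h2_wl !h2_h1; apply: homext => U x.
  by nfw (first [rw2 (mrb _) | rw2 (nlb _) | rw2 (b' _)]).
have hd W : h1 d W ∘ h2 q W = h2 q' W ∘ (h1 m _ ∘ td_ob M ◁ h1 n W).
  by rewrite -h2D ed tensm_wlh1 compA h2_wl h2_h1 -compA.
exists d; split=> //; split=> [W|W|].
- apply: (univ_wl_epi H (hc_univ v)); apply: (univ_epi (cosp_rho_univ H S' T')).
  apply: homext => U x; hat_simp.
  rw2 (wl_h2 (cosp_rho H S' T') (h2 q W)); rw3 (hc_la v _); rw2 (hd _).
  rw2 (esym (wl_h2 (cosp_rho H S' T') (h2 q W))); rw2 (hd _); nf.
  by rw3 (hc_la v' _); nfw (first [rw2 (ml _) | rw2 (nl _)]).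
- apply: (univ_wl_epi H (cosp_rho_univ H S T)); apply: (univ_epi (hc_univ v)).
  apply: homext => U x; hat_simp.
  rw2 (wl_h2 q (h2 (cosp_rho H S T) W)); rw3 (hc_ra v _); rw2 (hd _).
  rw2 (esym (wl_h2 q (h2 (cosp_rho H S T) W))).
  rw2 (esym (wl_h1 d (h2 (cosp_rho H S T) W))); rw2 (hd _).
  rw2 (wl_h2 q' (h2 (cosp_rho H S T) W)); rw3 (hc_ra v' _).
  by nfw (first [rw2 (mr _) | rw2 (nr _)]).
apply: h0_inj; rewrite h0D (hc_h0 v) (hc_h0 v') -np -mp !h0D.
by apply: homext => U x; hat_simp; rw2 (hd _); nf.
Qed.

Lemma hc_iso M N X q M' N' X' q' :
  @is_hc M N X q -> @is_hc M' N' X' q' ->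
  td_iso M M' -> td_iso N N' -> td_iso X X'.
Proof.
move=> v v' /td_isoE [m [m' [bm m1 m2]]] /td_isoE [n [n' [bn n1 n2]]].
have [d [bd ed]] := hc_map v v' bm bn.
have [d' [_ ed']] := hc_map v' v (bimap_inv bm m1 m2) (bimap_inv bn n1 n2).
apply: (td_isoP bd (d' := d')).
  apply: (univ_inj (hc_univ v)).
  by rewrite -compA ed compA ed' -compA -tensm_comp m1 n1 tensm_id compm1 comp1m.
apply: (univ_inj (hc_univ v')).
by rewrite -compA ed' compA ed -compA -tensm_comp m2 n2 tensm_id compm1 comp1m.
Qed.

Lemma is_hcompP (M : twodiag S S') (N : twodiag T T')
    (F : twodiag_on (composite_cospan K) (composite_cospan K') (htensor H M N)) :
  is_hcomp F -> @is_hc M N (TwoDiag F) (hrho H M N).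
Proof.
case=> er el ef eg; split.
- exact: hrho_univ.
- exact: prodrelP.
- exact: prodrelP.
- rewrite /td_pt /= /iota (cmp_iota K) compA ef -compA.
  by rewrite (compA (td_l _ ⊠ _)) -tensm_comp.
Qed.

Lemma hc_is_hcomp (M : twodiag S S') (N : twodiag T T')
    (F : twodiag_on (composite_cospan K) (composite_cospan K') (htensor H M N)) :
  @is_hc M N (TwoDiag F) (hrho H M N) -> is_hcomp F.
Proof.
case=> u el er ep; split.
- exact: prodrelE.
- exact: prodrelE.
- apply: h2_inj; rewrite h2D tensm_wlh1 compA h2_wl h2_h1 h1_td_l ep h0_pair.
  rewrite -!compA (prodrel_l00 er (fun W => esym (h1_td_l (td_on M) W))
    (fun W => esym (h1_td_l (td_on N) W))) //.
- apply: h2_inj; rewrite h2D tensm_wlh1 compA h2_wl h2_h1 h1_td_r ep h0_pair.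
  rewrite -!compA (prodrel_r00 el (fun W => esym (h1_td_r (td_on M) W))
    (fun W => esym (h1_td_r (td_on N) W))) //.
Qed.

Lemma hc_exists (M : twodiag S S') (N : twodiag T T') :
  exists F : twodiag_on (composite_cospan K) (composite_cospan K')
    (htensor H M N), @is_hc M N (TwoDiag F) (hrho H M N).
Proof.
have u := hrho_univ H M N; have uk := cosp_rho_univ H S T.
have uk' := cosp_rho_univ H S' T'.
have cp := cmp_prod K; have cp' := cmp_prod K'.
have [la el] := hlact_ex H M N; have [ra er] := hract_ex H M N.
pose pt := hrho H M N ∘ ((tpt M ⊠ tpt N) ∘ lamV unit_ob).
have ml W : h2 (tla M) W ∘ h0 (iota S') _ = h1 (idm _) W by rewrite td_1l h1_id.
have mr W : h2 (tra M) W ∘ _ ◁ h0 (iota S) W = h1 (idm _) W.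
  by rewrite td_1r h1_id.
have nl W : h2 (tla N) W ∘ h0 (iota T') _ = h1 (idm _) W by rewrite td_1l h1_id.
have nr W : h2 (tra N) W ∘ _ ◁ h0 (iota T) W = h1 (idm _) W.
  by rewrite td_1r h1_id.
have [| | | | | | |F [Fl Fr Fp]] := @mk_twodiag _ A C (composite_cospan K)
  (composite_cospan K') _ la ra pt.
- exact: (prodrel_assoc H uk' uk' u el cp' el el (tdA_l _) (tdA_l _)).
- exact: (prodrel_assoc H u uk uk er er er cp (tdA_r _) (tdA_r _)).
- exact: (prodrel_assoc H uk' u uk er el el er (tdA_lr _) (tdA_lr _)).
- move=> W; apply: (univ_epi u); rewrite cmp_h0 -!compA (prodrel_l00 el ml nl).
  by rewrite !h1_id wl_id !comp1m !compm1.
- move=> W; apply: (univ_epi u); rewrite cmp_h0 -!compA (prodrel_r00 er mr nr).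
  by rewrite !h1_id wl_id !comp1m !compm1.
(* As for the left leg of a composite cospan, the braiding is split over the two factors, with
   [td_al] for [M] in place of centrality. *)
- move=> W; apply: (univ_epi u); rewrite -compA (prodrel_r0 er nr (cmp_h1l K)).
  rewrite h1_id !wl_id comp1m -!compA hb_h2l.
  rewrite (compA (h1 (legl _) _)) (compA (h2 la _)).
  rewrite (prodrel_l0 el nl (cmp_h1l K')).
  rewrite h1_id !wl_id; apply: homext => U x; hat_simp.
  by rewrite (ap2 (td_al (td_on M) _)); nf.
- move=> W; apply: (univ_wl_epi H u).
  rewrite -!compA (prodrel_0l el ml (cmp_h1r K')) h1_id comp1m hb_h2r.
  rewrite (compA (_ ◁ h1 (legr _) _)) (compA (h2 ra _)).
  rewrite (prodrel_0r er mr (cmp_h1r K)).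
  rewrite h1_id; apply: homext => U x; hat_simp.
  by rw2 (td_ar (td_on N) _); nf.
by exists F; split; rewrite //= ?Fl ?Fr ?Fp.
Qed.

Lemma hc_ex (M : twodiag S S') (N : twodiag T T') :
  exists F : twodiag_on (composite_cospan K) (composite_cospan K')
    (htensor H M N), is_hcomp F.
Proof. by have [F vF] := hc_exists M N; exists F; apply: hc_is_hcomp. Qed.


End Relation.
End Horizontal.

(** * Associativity and unit isomorphisms *)

Section RelativeTensors.
Variables (Z : braided) (H : coequalizer_assumption Z).

Lemma assoc_post (X Y V X' Y' V' V'' : Z) (p1 : hom (X' ⊗ V) V')
    (p2 : hom (X ⊗ Y) X') (p3 : hom (X ⊗ Y') V') (p4 : hom (Y ⊗ V) Y')
    (f : hom V' V'') :
  assoc p1 p2 p3 p4 -> assoc (f ∘ p1) p2 (f ∘ p3) p4.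
Proof. by move=> e W; rewrite !h2D -!compA e. Qed.

Lemma univ_unique (X A Y Q Q' : Z) (r : hom (X ⊗ A) X) (l : hom (A ⊗ Y) Y)
    (q : hom (X ⊗ Y) Q) (q' : hom (X ⊗ Y) Q') :
  univ r l q -> univ r l q' ->
  exists f g, [/\ f ∘ q = q', g ∘ q' = q, g ∘ f = idm _ & f ∘ g = idm _].
Proof.
move=> u u'; have [f ef] := univ_ext u (univ_bal u').
have [g eg] := univ_ext u' (univ_bal u); exists f, g; split=> //.
  by apply: (univ_inj u); rewrite -compA ef eg comp1m.
by apply: (univ_inj u'); rewrite -compA eg ef comp1m.
Qed.

(** This is the isomorphism [X ⊗_A A ≅ X]: the coequalizer is split by inserting the unit. *)
Lemma univ_rsplit (X A : Z) (r : hom (X ⊗ A) X) (m : hom (A ⊗ A) A)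
    (i : hom unit_ob A) : assoc r r r m ->
  (forall W, h2 r W ∘ X ◁ h0 i W = idm _) ->
  (forall W, h2 m W ∘ h0 i (A ⊗ W) = idm _) ->
  (forall W, h2 m W ∘ A ◁ h0 i W = idm _) -> univ r m r.
Proof.
move=> a r1 m1 m1' W; split.
  by exists (X ◁ h0 i (A ⊗ W)); rewrite r1 -wlD m1 wl_id.
split=> [|V h e]; first exact: a.
exists (h ∘ X ◁ h0 i W); split=> [|k <-]; last by rewrite -compA r1 compm1.
by rewrite -compA wl_h2 compA e -compA -wlD m1' wl_id compm1.
Qed.

Lemma univ_lsplit (A Y : Z) (l : hom (A ⊗ Y) Y) (m : hom (A ⊗ A) A)
    (i : hom unit_ob A) : assoc l m l l ->
  (forall W, h2 l W ∘ h0 i (Y ⊗ W) = idm _) ->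
  (forall W, h2 m W ∘ h0 i (A ⊗ W) = idm _) ->
  (forall W, h2 m W ∘ A ◁ h0 i W = idm _) -> univ m l l.
Proof.
move=> a l1 m1 m1' W; split.
  by exists (A ◁ h0 i (Y ⊗ W)); rewrite m1' -wlD l1 wl_id.
split=> [|V h e]; first exact: a.
exists (h ∘ h0 i (Y ⊗ W)); split=> [|k <-]; last by rewrite -compA l1 compm1.
by rewrite -compA -wl_h0 compA -e -compA m1 compm1.
Qed.

Section Assoc.
Variables (X A Y C V P Q U U' : Z).
Variables (rX : hom (X ⊗ A) X) (lY : hom (A ⊗ Y) Y) (q1 : hom (X ⊗ Y) P).
Variables (rY : hom (Y ⊗ C) Y) (lV : hom (C ⊗ V) V) (q2 : hom (Y ⊗ V) Q).
Variables (rP : hom (P ⊗ C) P) (q3 : hom (P ⊗ V) U).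
Variables (lQ : hom (A ⊗ Q) Q) (q4 : hom (X ⊗ Q) U').

(** Each comparison map comes from two descents, [f] along [X ◁ q2] and [q4], [g] along [q1] and
    [q3]. They are mutually inverse because an operation in an [assoc] relation is determined by the
    other three. *)
Lemma rtensor_assoc : univ rX lY q1 -> univ rY lV q2 -> univ rP lV q3 ->
  univ rX lQ q4 -> assoc rP q1 q1 rY -> assoc q2 lY lQ q2 ->
  exists f g, [/\ g ∘ f = idm U', f ∘ g = idm U & assoc q3 q1 (f ∘ q4) q2].
Proof.
move=> u1 u2 u3 u4 eP eQ.
have b1 := univ_bal u1; have b2 := univ_bal u2.
have b3 := univ_bal u3; have b4 := univ_bal u4.
have [W|f1 e1] := @univ_lext _ H _ _ _ _ _ _ _ u2 _ _ _ q1 q3.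
  by apply: homext => T x; hat_simp; rw2 (esym (eP _)); rw2 (b3 _); nf.
have [W|f ef] := @univ_ext _ _ _ _ _ _ _ _ u4 _ f1.
  apply: (univ_wl2_epi H u2); apply: homext => T x; hat_simp.
  rw2 (esym (wl_h2 rX (h2 q2 W))); rw2 (esym (e1 _)); rw2 (b1 _).
  by rw2 (esym (eQ _)); rw2 (esym (e1 _)); nf.
have [W|g1 e1'] := @univ_rext _ _ _ _ _ _ _ _ u1 _ _ _ q2 q4.
  apply: homext => T x; hat_simp; rw2 (wl_h2 rX (h2 q2 W)).
  by rw2 (b4 _); rw2 (esym (eQ _)); nf.
have [W|g eg] := @univ_ext _ _ _ _ _ _ _ _ u3 _ g1.
  apply: (univ_epi u1); apply: homext => T x; hat_simp.
  rw2 (eP _); rw2 (e1' _).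
  rw2 (b2 _); rw2 (wl_h2 q1 (h2 lV W)).
  by rw2 (e1' _); nf.
exists f, g; split.
- apply: (univ_inj u4); rewrite comp1m -compA ef.
  apply: (assoc_linj H u2) e1'; rewrite -eg.
  exact: assoc_post.
- apply: (univ_inj u3); rewrite comp1m -compA eg.
  apply: (assoc_rinj u1) (e1); rewrite -ef.
  exact: assoc_post.
- by rewrite ef.
Qed.
End Assoc.
End RelativeTensors.

Section HorizontalLegs.
Variables (Z : braided) (H : coequalizer_assumption Z) (A B C : comAlg Z).
Variables (S S' : cospan A B) (T T' : cospan B C).
Variables (K : composite H S T) (K' : composite H S' T').
Variables (M : twodiag S S') (N : twodiag T T').
Variables (X : twodiag (composite_cospan K) (composite_cospan K')).
Variables (q : hom (td_ob M ⊗ td_ob N) (td_ob X)) (v : is_hc q).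

(** The right leg of [K] is a unit paired with [legr T], so it reaches the second factor only. This
    lemma and [hc_lb] are the last two hypotheses of [rtensor_assoc]. *)
Lemma hc_rb : assoc (td_rb (td_on X)) q q (td_rb (td_on N)).
Proof.
have mr W : h2 (tra M) W ∘ _ ◁ h0 (iota S) W = h1 (idm _) W.
  by rewrite td_1r h1_id.
move=> W; rewrite !h2_rb -compA (prodrel_0r (hc_ra v) mr (cmp_h1r K)).
by rewrite h1_id wlD comp1m.
Qed.

Lemma hc_lb : assoc q (td_lb (td_on M)) (td_lb (td_on X)) q.
Proof.
have nl W : h2 (tla N) W ∘ h0 (iota T') _ = h1 (idm _) W by rewrite td_1l h1_id.
move=> W; rewrite !h2_lb -compA (prodrel_l0 (hc_la v) nl (cmp_h1l K')).
by rewrite h1_id !wl_id compm1.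
Qed.
End HorizontalLegs.

(** Besides preservation of identities, this is what lets the lemmas on horizontal composites be
    applied to the cospans themselves. *)
Lemma hc_id (Z : braided) (H : coequalizer_assumption Z) (A B C : comAlg Z)
    (S : cospan A B) (T : cospan B C) (K : composite H S T) :
  is_hc (K := K) (K' := K) (M := id_twodiag S) (N := id_twodiag T)
    (X := id_twodiag (composite_cospan K)) (cosp_rho H S T).
Proof.
split; [exact: cosp_rho_univ | exact: cmp_prod | exact: cmp_prod |].
by rewrite /td_pt /= !comp1m /iota /= (cmp_iota K).
Qed.

Section HorizontalAssoc.
Variables (Z : braided) (H : coequalizer_assumption Z) (A B C D : comAlg Z).
Variables (S1 S1' : cospan A B) (S2 S2' : cospan B C) (S3 S3' : cospan C D).
Variables (K23 : composite H S2 S3) (K12 : composite H S1 S2).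
Variables (L : composite H S1 (composite_cospan K23)).
Variables (R : composite H (composite_cospan K12) S3).
Variables (K23' : composite H S2' S3') (K12' : composite H S1' S2').
Variables (L' : composite H S1' (composite_cospan K23')).
Variables (R' : composite H (composite_cospan K12') S3').
Variables (M1 : twodiag S1 S1') (M2 : twodiag S2 S2') (M3 : twodiag S3 S3').
Variables (X12 : twodiag (composite_cospan K12) (composite_cospan K12')).
Variables (X23 : twodiag (composite_cospan K23) (composite_cospan K23')).
Variables (XL : twodiag (composite_cospan L) (composite_cospan L')).
Variables (XR : twodiag (composite_cospan R) (composite_cospan R')).
Variables (q1 : hom (td_ob M1 ⊗ td_ob M2) (td_ob X12)) (v1 : is_hc q1).
Variables (q2 : hom (td_ob M2 ⊗ td_ob M3) (td_ob X23)) (v2 : is_hc q2).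
Variables (q3 : hom (td_ob X12 ⊗ td_ob M3) (td_ob XR)) (v3 : is_hc q3).
Variables (q4 : hom (td_ob M1 ⊗ td_ob X23) (td_ob XL)) (v4 : is_hc q4).

Lemma hc_assoc : exists f g, [/\ g ∘ f = idm (td_ob XL), f ∘ g = idm (td_ob XR)
  & assoc q3 q1 (f ∘ q4) q2].
Proof.
exact: (rtensor_assoc H (hc_univ v1) (hc_univ v2) (hc_univ v3) (hc_univ v4)
  (hc_rb v1) (hc_lb v2)).
Qed.

Variable f : hom (td_ob XL) (td_ob XR).
Hypothesis ef : assoc q3 q1 (f ∘ q4) q2.

Let ef' W : h1 f W ∘ (h2 q4 W ∘ td_ob M1 ◁ h2 q2 W) = h2 q3 W ∘ h2 q1 _.
Proof. by rewrite ef h2D compA. Qed.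

(** After cancelling two quotient maps for the bimodules and two for the algebras, the claim lives
    on the plain product of three algebras and three bimodules, where both sides are the three
    actions performed separately. *)
Lemma hc_assoc_la (p : hom (composite_cospan L') (composite_cospan R')) :
  assoc (cosp_rho H (composite_cospan K12') S3') (cosp_rho H S1' S2')
    (p ∘ cosp_rho H S1' (composite_cospan K23')) (cosp_rho H S2' S3') ->
  forall W, h1 f W ∘ h2 (tla XL) W
    = h2 (tla XR) W ∘ (h1 p _ ∘ composite_cospan L' ◁ h1 f W).
Proof.
move=> ep W; have u4 := cosp_rho_univ H S1' (composite_cospan K23').
have u2 := cosp_rho_univ H S2' S3'; have lL := hc_la v4; have lR := hc_la v3.
have l12 := hc_la v1; have l23 := hc_la v2.
move: (cosp_rho _ _ _) (cosp_rho _ _ _) (cosp_rho _ _ _) (cosp_rho _ _ _)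
  => k2 k4 k1 k3 in ep u4 u2 lL lR l12 l23 *.
have ep' V : h1 p V ∘ (h2 k4 V ∘ S1' ◁ h2 k2 V) = h2 k3 V ∘ h2 k1 _.
  by rewrite ep h2D compA.
apply: (univ_wl_epi H (hc_univ v4)); apply: (univ_wl2_epi H (hc_univ v2)).
apply: (univ_epi u4); apply: (univ_wl_epi H u2).
apply: homext => U x; hat_simp; rw3 (ef' _).
rw2 (wl_h2 k4 (_ ◁ h2 q2 _)); rw2 (wl_h2 k4 (h2 q4 _)); rw3 (lL _).
nfw (rw3 (l23 _)); rw2 (esym (wl_h2 (tla M1) (h2 q2 W))); rw3 (ef' _).
rw3 (ep' _); rw2 (esym (wl_h2 k1 (_ ◁ h2 q3 _))); rw3 (lR _).
by nfw (rw3 (l12 _)).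
Qed.

Lemma hc_assoc_ra (p : hom (composite_cospan L) (composite_cospan R)) :
  assoc (cosp_rho H (composite_cospan K12) S3) (cosp_rho H S1 S2)
    (p ∘ cosp_rho H S1 (composite_cospan K23)) (cosp_rho H S2 S3) ->
  forall W, h1 f W ∘ h2 (tra XL) W
    = h2 (tra XR) W ∘ (h1 f _ ∘ td_ob XL ◁ h1 p W).
Proof.
move=> ep W; have u4 := cosp_rho_univ H S1 (composite_cospan K23).
have u2 := cosp_rho_univ H S2 S3; have rL := hc_ra v4; have rR := hc_ra v3.
have r12 := hc_ra v1; have r23 := hc_ra v2.
move: (cosp_rho _ _ _) (cosp_rho _ _ _) (cosp_rho _ _ _) (cosp_rho _ _ _)
  => k2 k4 k1 k3 in ep u4 u2 rL rR r12 r23 *.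
have ep' V : h1 p V ∘ (h2 k4 V ∘ S1 ◁ h2 k2 V) = h2 k3 V ∘ h2 k1 _.
  by rewrite ep h2D compA.
apply: (univ_wl_epi H u4); apply: (univ_wl2_epi H u2).
apply: (univ_epi (hc_univ v4)); apply: (univ_wl_epi H (hc_univ v2)).
apply: homext => U x; hat_simp; rw3 (ep' _).
rw2 (wl_h2 q4 (_ ◁ h2 k2 _)); rw2 (wl_h2 q4 (h2 k4 _)); rw3 (rL _).
nfw (rw3 (r23 _)); rw2 (esym (wl_h2 (tra M1) (h2 q2 W))); rw3 (ef' _).
rw3 (ef' _); rw2 (esym (wl_h2 q1 (_ ◁ h2 k3 _))); rw3 (rR _).
by nfw (rw3 (r12 _)).
Qed.

Lemma hc_assoc_pt : f ∘ tpt XL = tpt XR.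
Proof.
apply: h0_inj; rewrite h0D (hc_h0 v4) (hc_h0 v3).
rewrite (hc_h0 v1) (hc_h0 v2); apply: homext => U x; hat_simp.
by rw2 (esym (wl_h0 (tpt M1) (h2 q2 _))); rw3 (ef' _).
Qed.
End HorizontalAssoc.

Section AssocHom.
Variables (Z : braided) (H : coequalizer_assumption Z) (A B C D : comAlg Z).
Variables (S1 : cospan A B) (S2 : cospan B C) (S3 : cospan C D).
Variables (K23 : composite H S2 S3) (K12 : composite H S1 S2).
Variables (L : composite H S1 (composite_cospan K23)).
Variables (R : composite H (composite_cospan K12) S3).

Lemma assoc_hom : exists p : cospan_hom (composite_cospan L) (composite_cospan R),
  is_iso p /\ assoc (cosp_rho H (composite_cospan K12) S3) (cosp_rho H S1 S2)
    (p ∘ cosp_rho H S1 (composite_cospan K23)) (cosp_rho H S2 S3).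
Proof.
have v1 := hc_id K12; have v2 := hc_id K23.
have v3 := hc_id R; have v4 := hc_id L.
have [p [p' [e1 e2 ep]]] := hc_assoc v1 v2 v3 v4.
(* For identity 2-diagrams the left actions are multiplications, so linearity of [p] along [p]
   itself is multiplicativity; likewise the points are the units. *)
have pm := hc_assoc_la v1 v2 v3 v4 ep ep.
have := hc_assoc_pt v1 v2 v3 v4 ep; rewrite /td_pt /= !comp1m => pi.
have ep' V : h1 p V ∘ (h2 (cosp_rho H S1 (composite_cospan K23)) V
    ∘ S1 ◁ h2 (cosp_rho H S2 S3) V)
    = h2 (cosp_rho H (composite_cospan K12) S3) V ∘ h2 (cosp_rho H S1 S2) _.
  by rewrite ep h2D compA.
have {}pm : p ∘ mu (composite_cospan L) = mu (composite_cospan R) ∘ (p ⊠ p).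
  by apply: h2_inj; rewrite h2D tensm_wlh1 compA h2_wl h2_h1 -compA; apply: pm.
pose ph := @AlgHom Z (composite_cospan L) (composite_cospan R) p pm pi.
have pl : ph ∘ legl (composite_cospan L) = legl (composite_cospan R).
  apply: h1_inj; rewrite h1D !cmp_h1l [h0 (iota (composite_cospan K23)) _]cmp_h0.
  apply: homext => U x; hat_simp.
  by rw3 (ep' _); nf.
have pr : ph ∘ legr (composite_cospan L) = legr (composite_cospan R).
  apply: h1_inj; rewrite h1D !cmp_h1r [h0 (iota (composite_cospan K12)) _]cmp_h0.
  apply: homext => U x; hat_simp.
  rw2 (esym (wl_h0 (iota S1) (h2 _ _))).
  by rw3 (ep' _); nf.
by exists (CospanHom pl pr); split=> //; exists p'.
Qed.
End AssocHom.

(** * Vertical composites with 2-diagrams of morphisms of cospans *)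

Section Companions.
Variables (Z : braided) (H : coequalizer_assumption Z) (A B : comAlg Z).
Implicit Types S T : cospan A B.

Lemma companion_ra S T (p : cospan_hom S T) W :
  h2 (tra (companion p)) W = h2 (mu T) W ∘ T ◁ h1 p W.
Proof. by rewrite -h2_wl wlE. Qed.

Lemma companion_pt S T (p : cospan_hom S T) : tpt (companion p) = iota T.
Proof. exact: ahom_iota. Qed.

Lemma id_pt S : tpt (id_twodiag S) = iota S.
Proof. exact: comp1m. Qed.

Lemma h1_legl S T (p : cospan_hom S T) W :
  h1 p W ∘ h1 (legl S) W = h1 (legl T) W.
Proof. by rewrite -h1D chom_legl. Qed.

Lemma h1_legr S T (p : cospan_hom S T) W :
  h1 p W ∘ h1 (legr S) W = h1 (legr T) W.
Proof. by rewrite -h1D chom_legr. Qed.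

Lemma univ_ra S T (E : twodiag S T) : univ (tra E) (mu S) (tra E).
Proof.
exact: (univ_rsplit (tdA_r _) (td_1r _) (@mu1l _ S) (@mu1r _ S)).
Qed.

Lemma univ_la S T (E : twodiag S T) : univ (mu T) (tla E) (tla E).
Proof.
exact: (univ_lsplit (tdA_l _) (td_1l _) (@mu1l _ T) (@mu1r _ T)).
Qed.

Lemma vc_idl S T (M : twodiag S T) :
  is_vc (M := M) (N := id_twodiag T) (X := M) (tla M).
Proof.
split; [exact: univ_la | exact: tdA_l | exact: tdA_lr |].
apply: h0_inj; rewrite h0_pair id_pt.
by rewrite compA td_1l comp1m.
Qed.

Lemma vc_idr S T (M : twodiag S T) :
  is_vc (M := id_twodiag S) (N := M) (X := M) (tra M).
Proof.
split; [exact: univ_ra | exact: tdA_lr | exact: tdA_r |].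
apply: h0_inj; rewrite h0_pair id_pt.
by rewrite -wl_h0 compA td_1r comp1m.
Qed.

(* The restriction of a 2-diagram along p on the right represents both
   composites of a naturality square. *)
Lemma restrict_ex S T T' (p : cospan_hom S T) (E : twodiag T T') :
  exists X : twodiag_on S T' (td_ob E),
    [/\ td_lact X = tla E, td_ract X = tra E ∘ (idm _ ⊠ p) & td_pt X = tpt E].
Proof.
have er W : h2 (tra E ∘ (idm _ ⊠ p)) W = h2 (tra E) W ∘ td_ob E ◁ h1 p W.
  by rewrite -wlE h2_wl.
apply: mk_twodiag => [|W|W|W|W|W|W]; rewrite ?er.
- exact: tdA_l.
- apply: homext => U x.
  by nfw (first [rw2 (tdA_r _ _) | rw2 (h1_mu p _)]).
- by apply: homext => U x; nfw (rw2 (tdA_lr _ _)).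
- exact: td_1l.
- by rewrite -compA -wlD h1_iota td_1r.
- by rewrite -compA -wlD h1_legl td_al.
- by rewrite td_ar -(h1_legr p) wlD -!compA.
Qed.

(** The model is [E ⊗_T T ≅ E], with the right action as universal operation. *)
Lemma vc_restrict S T T' (p : cospan_hom S T) (E : twodiag T T')
    (X : twodiag_on S T' (td_ob E)) : td_lact X = tla E ->
  td_ract X = tra E ∘ (idm _ ⊠ p) -> td_pt X = tpt E ->
  is_vc (M := companion p) (N := E) (X := TwoDiag X) (tra E).
Proof.
move=> el er ep; split=> /=.
- exact: univ_ra.
- rewrite el; exact: tdA_lr.
- move=> W; rewrite er companion_ra -wlE h2_wl; apply: homext => U x.
  by nfw (rw2 (tdA_r _ _)).
- apply: h0_inj; rewrite h0_pair ep companion_pt -wl_h0 compA td_1r.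
  by rewrite comp1m.
Qed.

(** Since [p'] is invertible, [T' ⊗_S' D] is [D] with its left action transported along [p'], and
    [f] identifies this with the restriction of [E]. The naturality squares follow by comparison
    with [vc_restrict]. *)
Lemma vc_square S S' T T' (p : cospan_hom S T) (p' : cospan_hom S' T')
    (D : twodiag S S') (E : twodiag T T') (f : hom (td_ob D) (td_ob E)) g
    (X : twodiag_on S T' (td_ob E)) : td_lact X = tla E ->
  td_ract X = tra E ∘ (idm _ ⊠ p) -> td_pt X = tpt E ->
  is_iso p' -> g ∘ f = idm _ -> f ∘ g = idm _ ->
  (forall W, h1 f W ∘ h2 (tla D) W = h2 (tla E) W ∘ (h1 p' _ ∘ S' ◁ h1 f W)) ->
  (forall W, h1 f W ∘ h2 (tra D) W = h2 (tra E) W ∘ (h1 f _ ∘ td_ob D ◁ h1 p W)) ->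
  f ∘ tpt D = tpt E ->
  is_vc (M := D) (N := companion p') (X := TwoDiag X) (tla E ∘ (idm T' ⊠ f)).
Proof.
move=> el er ep [p'V [pK pVK]] gf fg fl fr fp.
have kp W : h1 p'V W ∘ h1 p' W = idm _ by rewrite -h1D pK h1_id.
have kp' W : h1 p' W ∘ h1 p'V W = idm _ by rewrite -h1D pVK h1_id.
have kf W : h1 g W ∘ h1 f W = idm _ by rewrite -h1D gf h1_id.
have kg W : h1 f W ∘ h1 g W = idm _ by rewrite -h1D fg h1_id.
have fp' W : h1 f W ∘ h0 (tpt D) W = h0 (tpt E) W by rewrite -h0D fp.
rewrite -wlE; split=> [W|W|W|] /=; rewrite ?el ?er ?ep ?h2_wl ?companion_ra.
- split.
    exists (T' ◁ h0 (iota S') (td_ob D ⊗ W)); split.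
      by rewrite -compA -wlD h1_iota mu1r.
    by rewrite -wlD td_1l wl_id.
  split=> [|V h e].
    apply: homext => U x.
    by nfw (first [rw2 (tdA_l _ _) | rw2 (fl _)]).
  (* The descended map sends [e] to [h(1, g e)]. On [t · f d] balance gives back [h(t, d)], as [t]
     is [p'] of some element of [S']. *)
  exists (h ∘ (h0 (iota T') _ ∘ h1 g W)); split=> [|k <-].
    apply: homext => U x; hat_simp.
    have gl : h1 g W ∘ h2 (tla E) W
        = h2 (tla D) W ∘ (h1 p'V _ ∘ T' ◁ h1 g W).
      rewrite -[RHS]comp1m -kf -!compA (compA (h1 f W)) fl.
      apply: homext => V' y; hat_simp; rw2 (wl_h1 p'V (h1 f W)).
      rw2 (kp' _); rw2 (kg _). by [].
    rw2 gl; rw2 (kf _); rw2 (esym (wl_h0 (iota T') (h2 (tla D) W))).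
    rewrite (ap2 (esym e)) -!compA; rw2 (wl_h0 (iota T') (h1 p' _)).
    by rw2 (kp' _); rw2 (mu1l _ _).
  apply: homext => U x; hat_simp; rw2 (wl_h0 (iota T') (h1 f W)); rw2 (kg _).
  by rw2 (td_1l _ _).
- by apply: homext => U x; nfw (rw2 (tdA_l _ _)).
- rewrite -wlE h2_wl; apply: homext => U x.
  by nfw (first [rw2 (fr _) | rw2 (tdA_lr _ _)]).
apply: h0_inj; rewrite h0_pair [td_pt (companion_on _)](companion_pt p') h2_wl.
by apply: homext => U x; hat_simp; rw2 (wl_h0 (iota T') (h1 f _));
  rw2 (fp' _); rw2 (td_1l _ _).
Qed.


Lemma vc_companion S T U (p : cospan_hom S T) (p' : cospan_hom T U)
    (r : cospan_hom S U) : p' ∘ p = r :> hom _ _ ->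
  is_vc (M := companion p) (N := companion p') (X := companion r)
    (tra (companion p')).
Proof.
move=> e; apply: vc_restrict => //.
  by rewrite /td_ract /= -e tensm_compr compA.
by rewrite (companion_pt p') (companion_pt r).
Qed.

Lemma companion_id S (p : cospan_hom S S) : idm S = p :> hom _ _ ->
  td_iso (companion p) (id_twodiag S).
Proof.
move=> e; apply: (@td_isoP _ _ _ _ _ (companion p) (id_twodiag S) (idm S) (idm S));
  rewrite ?comp1m //.
split=> [W|W|] /=.
- by rewrite h1_id wl_id comp1m compm1.
- by rewrite /td_ract /= -e tensm_id compm1 !h1_id comp1m compm1.
- by rewrite comp1m (companion_pt p) id_pt.
Qed.

Lemma cospan_hom_inv S T (p : cospan_hom S T) : is_iso p ->
  exists q : cospan_hom T S, q ∘ p = idm S /\ p ∘ q = idm T.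
Proof.
case=> q [e1 e2].
have qm : q ∘ mu T = mu S ∘ (q ⊠ q).
  rewrite -[RHS]comp1m -e1 -(compA q) (compA p) ahom_mu -compA -tensm_comp e2.
  by rewrite tensm_id compm1.
have qi : q ∘ iota T = iota S by rewrite -(ahom_iota p) compA e1 comp1m.
pose qh := AlgHom qm qi.
have ql : qh ∘ legl T = legl S by rewrite -(chom_legl p) compA e1 comp1m.
have qr : qh ∘ legr T = legr S by rewrite -(chom_legr p) compA e1 comp1m.
by exists (CospanHom ql qr).
Qed.

End Companions.

(** * Horizontal composites of morphisms of cospans *)

Section Whiskering.
Variables (Z : braided) (H : coequalizer_assumption Z) (A B C : comAlg Z).
Variables (S S' : cospan A B) (T T' : cospan B C).
Variables (K : composite H S T) (K' : composite H S' T').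
Variables (p : cospan_hom S S') (p' : cospan_hom T T').
Notation k := (cosp_rho H S T).
Notation k' := (cosp_rho H S' T').

Lemma whisker_ex : exists r : cospan_hom (composite_cospan K) (composite_cospan K'),
  r ∘ k = k' ∘ (p ⊠ p').
Proof.
have u := cosp_rho_univ H S T; have u' := cosp_rho_univ H S' T'.
have b' W : h2 k' W ∘ (h2 (mu S') _ ∘ S' ◁ h1 (legr S') _)
    = h2 k' W ∘ (S' ◁ h2 (mu T') W ∘ S' ◁ h1 (legl T') _).
  by rewrite -h2_wl -wlD -h2_h1 h1E wlE; apply: (univ_bal u').
have [W|r er] := univ_ext u (f := k' ∘ (p ⊠ p')).
  rewrite tensm_wlh1 compA -wlE -h1E !h2_wl !h2_h1; apply: homext => U x.
  nfw (first [rw2 (h1_mu p _) | rw2 (h1_mu p' _)]).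
  rw2 (h1_legr p _); rw2 (h1_legl p' _).
  by rw2 (esym (wl_h1 p (h1 (legr S') _))); rw3 (b' _); nf.
have rk W : h1 r W ∘ h2 k W = h2 k' W ∘ (h1 p _ ∘ S ◁ h1 p' W).
  by rewrite -h2D er tensm_wlh1 compA h2_wl h2_h1 -compA.
have kp := cmp_prod K; have kp' := cmp_prod K'.
have rm : r ∘ mu (composite_cospan K) = mu (composite_cospan K') ∘ (r ⊠ r).
  apply: h2_inj; rewrite h2D tensm_wlh1 compA h2_wl h2_h1 -compA.
  apply: (univ_wl_epi H u); apply: (univ_epi u); apply: homext => U x; hat_simp.
  rw2 (rk _); rw2 (wl_h2 k (h2 k _)); rw3 (kp _).
  nfw (rw2 (rk _)).
  rw2 (esym (wl_h1 p' (h2 k' _))); rw2 (esym (wl_h1 p (_ ◁ h2 k' _))).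
  by rw3 (kp' _); nfw (first [rw2 (h1_mu p _) | rw2 (h1_mu p' _)]).
have ri : r ∘ iota (composite_cospan K) = iota (composite_cospan K').
  apply: h0_inj; rewrite h0D !cmp_h0; apply: homext => U x; hat_simp.
  by rw2 (rk _); nfw (first [rw2 (h1_iota p _) | rw2 (h1_iota p' _)]).
pose rh := @AlgHom Z (composite_cospan K) (composite_cospan K') r rm ri.
have rl : rh ∘ legl (composite_cospan K) = legl (composite_cospan K').
  apply: h1_inj; rewrite h1D !cmp_h1l; apply: homext => U x; hat_simp.
  by rw2 (rk _); nfw (first [rw2 (h1_legl p _) | rw2 (h1_iota p' _)]).
have rr : rh ∘ legr (composite_cospan K) = legr (composite_cospan K').
  apply: h1_inj; rewrite h1D !cmp_h1r; apply: homext => U x; hat_simp.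
  by rw2 (rk _); nfw (first [rw2 (h1_legr p' _) | rw2 (h1_iota p _)]).
by exists (CospanHom rl rr).
Qed.

Lemma hc_companion (r : cospan_hom (composite_cospan K) (composite_cospan K')) :
  r ∘ k = k' ∘ (p ⊠ p') ->
  is_hc (M := companion p) (N := companion p') (X := companion r) k'.
Proof.
move=> er; have kp' := cmp_prod K'.
have rk W : h1 r W ∘ h2 k W = h2 k' W ∘ (h1 p _ ∘ S ◁ h1 p' W).
  by rewrite -h2D er tensm_wlh1 compA h2_wl h2_h1 -compA.
split=> [|//|W|].
- have := cosp_rho_univ H S' T'.
  rewrite -(chom_legr p) tensm_compr compA; exact.
- rewrite !companion_ra /=; apply: homext => U x; hat_simp.
  rw2 (wl_h2 k' (h1 r _)); rw2 (rk _); rw3 (kp' _); nf.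
  by [].
by rewrite !companion_pt /iota /= (cmp_iota K').
Qed.
End Whiskering.

(** * Unit isomorphisms *)

Section Units.
Variables (Z : braided) (H : coequalizer_assumption Z) (A B : comAlg Z).

Lemma univ_td_rb (S S' : cospan A B) (M : twodiag S S') :
  univ (td_rb (td_on M)) (mu B) (td_rb (td_on M)).
Proof.
pose r := rrestrict (legr S) (bim_r (td_bim (td_on M))).
apply: (univ_rsplit (i := iota B)).
- exact: assocP (ract_mu r).
- by have /h2_h0r := ract_iota r.
- exact: mu1l.
- exact: mu1r.
Qed.

Lemma univ_td_lb (S S' : cospan A B) (M : twodiag S S') :
  univ (mu A) (td_lb (td_on M)) (td_lb (td_on M)).
Proof.
pose l := lrestrict (legl S') (bim_l (td_bim (td_on M))).
apply: (univ_lsplit (i := iota A)).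
- exact: assocP (lact_mu l).
- by have /h2_h0l := lact_iota l.
- exact: mu1l.
- exact: mu1r.
Qed.

Section Left.
Variables (S S' : cospan A B) (M : twodiag S S').
Variables (K : composite H S (id_cospan B)) (K' : composite H S' (id_cospan B)).
Variables (X : twodiag (composite_cospan K) (composite_cospan K')).
Variables (q : hom (td_ob M ⊗ B) (td_ob X)).
Hypothesis v : is_hc (M := M) (N := id_twodiag (id_cospan B)) (X := X) q.

Lemma hc_lunit_univ : univ (td_rb (td_on M)) (mu B) q.
Proof.
by have := hc_univ v; rewrite [td_lb (td_on (id_twodiag _))]/td_lb /= tensm_id compm1.
Qed.

Lemma hc_lunit : exists f g,
  [/\ f ∘ q = td_rb (td_on M), g ∘ f = idm _ & f ∘ g = idm _].
Proof.
have [f [g [e1 _ e2 e3]]] := univ_unique hc_lunit_univ (univ_td_rb M).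
by exists f, g.
Qed.

Variable f : hom (td_ob X) (td_ob M).
Hypothesis ef : f ∘ q = td_rb (td_on M).

Let ef' W : h1 f W ∘ h2 q W = h2 (tra M) W ∘ td_ob M ◁ h1 (legr S) W.
Proof. by rewrite -h2D ef h2_rb. Qed.

Lemma hc_lunit_la (p : hom (composite_cospan K') S') :
  p ∘ cosp_rho H S' (id_cospan B) = mu S' ∘ (idm S' ⊠ legr S') ->
  forall W, h1 f W ∘ h2 (tla X) W
    = h2 (tla M) W ∘ (h1 p _ ∘ composite_cospan K' ◁ h1 f W).
Proof.
move=> ep W; have u' := cosp_rho_univ H S' (id_cospan B).
have lX := hc_la v.
move: (cosp_rho _ _ _) => k in ep u' lX *.
have ep' V : h1 p V ∘ h2 k V = h2 (mu S') V ∘ S' ◁ h1 (legr S') V.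
  by rewrite -h2D ep -wlE h2_wl.
apply: (univ_wl_epi H hc_lunit_univ); apply: (univ_epi u').
apply: homext => U x; hat_simp.
rw2 (ef' _); rw2 (wl_h2 k (h2 q _)); rw3 (lX _); rw2 (ef' _).
nfw (first [rw2 (ep' _) | rw2 (h1_mu (legr S) _)]).
(* [td_ar] turns the element of [B] acting on [M] from the left through [S'] into one acting from
   the right through [S]. *)
nfw (first [rw2 (tdA_l _ _) | rw2 (tdA_lr _ _) | rw2 (td_ar _ _)]).
by rw2 (legrC S _); nfw (rw2 (tdA_r _ _)).
Qed.

Lemma hc_lunit_ra (p : hom (composite_cospan K) S) :
  p ∘ cosp_rho H S (id_cospan B) = mu S ∘ (idm S ⊠ legr S) ->
  forall W, h1 f W ∘ h2 (tra X) W
    = h2 (tra M) W ∘ (h1 f _ ∘ td_ob X ◁ h1 p W).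
Proof.
move=> ep W; have u' := cosp_rho_univ H S (id_cospan B).
have rX := hc_ra v.
move: (cosp_rho _ _ _) => k in ep u' rX *.
have ep' V : h1 p V ∘ h2 k V = h2 (mu S) V ∘ S ◁ h1 (legr S) V.
  by rewrite -h2D ep -wlE h2_wl.
apply: (univ_wl_epi H u'); apply: (univ_epi hc_lunit_univ).
apply: homext => U x; hat_simp.
rw2 (ep' _).
rw2 (wl_h2 q (h2 k _)); rw3 (rX _).
nfw (first [rw2 (ef' _) | rw2 (h1_mu (legr S) _)]).
nfw (rw2 (tdA_r _ _)).
rw2 (esym (wl_h1 (legr S) (h2 (mu S) _))).
(* Products in [S] are bracketed so that the image of [B] stands next to the element it has to
   commute with. *)
do 2 rw2 (esym (muA S _)); rw2 (legrC S _).
by nfw (rw2 (muA S _)).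
Qed.

Lemma hc_lunit_pt : f ∘ tpt X = tpt M.
Proof.
apply: h0_inj; rewrite h0D (hc_h0 v) id_pt; apply: homext => U x; hat_simp.
rw2 (ef' _); rw2 (esym (wl_h0 (tpt M) (h0 (iota B) _))).
by rw2 (h1_iota (legr S) _); rw2 (td_1r _ _).
Qed.
End Left.

Section Right.
Variables (S S' : cospan A B) (M : twodiag S S').
Variables (K : composite H (id_cospan A) S) (K' : composite H (id_cospan A) S').
Variables (X : twodiag (composite_cospan K) (composite_cospan K')).
Variables (q : hom (A ⊗ td_ob M) (td_ob X)).
Hypothesis v : is_hc (M := id_twodiag (id_cospan A)) (N := M) (X := X) q.

Lemma hc_runit_univ : univ (mu A) (td_lb (td_on M)) q.
Proof.
by have := hc_univ v; rewrite [td_rb (td_on (id_twodiag _))]/td_rb /= tensm_id compm1.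
Qed.

Lemma hc_runit : exists f g,
  [/\ f ∘ q = td_lb (td_on M), g ∘ f = idm _ & f ∘ g = idm _].
Proof.
have [f [g [e1 _ e2 e3]]] := univ_unique hc_runit_univ (univ_td_lb M).
by exists f, g.
Qed.

Variable f : hom (td_ob X) (td_ob M).
Hypothesis ef : f ∘ q = td_lb (td_on M).

Let ef' W : h1 f W ∘ h2 q W = h2 (tla M) W ∘ h1 (legl S') _.
Proof. by rewrite -h2D ef h2_lb. Qed.

Lemma hc_runit_la (p : hom (composite_cospan K') S') :
  p ∘ cosp_rho H (id_cospan A) S' = mu S' ∘ (legl S' ⊠ idm S') ->
  forall W, h1 f W ∘ h2 (tla X) W
    = h2 (tla M) W ∘ (h1 p _ ∘ composite_cospan K' ◁ h1 f W).
Proof.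
move=> ep W; have u' := cosp_rho_univ H (id_cospan A) S'.
have lX := hc_la v.
move: (cosp_rho _ _ _) => k in ep u' lX *.
have ep' V : h1 p V ∘ h2 k V = h2 (mu S') V ∘ h1 (legl S') _.
  by rewrite -h2D ep -h1E h2_h1.
apply: (univ_wl_epi H hc_runit_univ); apply: (univ_epi u').
apply: homext => U x; hat_simp.
rw2 (ef' _); rw2 (wl_h2 k (h2 q _)); rw3 (lX _).
nfw (first [rw2 (ef' _) | rw2 (ep' _) | rw2 (h1_mu (legl S') _)]).
nfw (first [rw2 (tdA_l _ _) | rw2 (muA S' _)]).
by rw2 (esym (tdA_l _ _)); rw2 (leglC S' _); nfw (rw2 (tdA_l _ _)).
Qed.

Lemma hc_runit_ra (p : hom (composite_cospan K) S) :
  p ∘ cosp_rho H (id_cospan A) S = mu S ∘ (legl S ⊠ idm S) ->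
  forall W, h1 f W ∘ h2 (tra X) W
    = h2 (tra M) W ∘ (h1 f _ ∘ td_ob X ◁ h1 p W).
Proof.
move=> ep W; have u' := cosp_rho_univ H (id_cospan A) S.
have rX := hc_ra v.
move: (cosp_rho _ _ _) => k in ep u' rX *.
have ep' V : h1 p V ∘ h2 k V = h2 (mu S) V ∘ h1 (legl S) _.
  by rewrite -h2D ep -h1E h2_h1.
apply: (univ_wl_epi H u'); apply: (univ_epi hc_runit_univ).
apply: homext => U x; hat_simp.
rw2 (ep' _).
rw2 (wl_h2 q (h2 k _)); rw3 (rX _).
nfw (first [rw2 (ef' _) | rw2 (h1_mu (legl S') _) | rw2 (tdA_lr _ _)]).
rw2 (esym (tdA_r _ _)); rw2 (td_al _ _).
by nfw (first [rw2 (tdA_l _ _) | rw2 (tdA_lr _ _)]).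
Qed.

Lemma hc_runit_pt : f ∘ tpt X = tpt M.
Proof.
apply: h0_inj; rewrite h0D (hc_h0 v) id_pt; apply: homext => U x; hat_simp.
by rw2 (ef' _); rw2 (h1_iota (legl S') _); rw2 (td_1l _ _).
Qed.
End Right.

Section Homs.
Variables (T : cospan A B).

Lemma lunit_hom (K : composite H T (id_cospan B)) :
  exists p : cospan_hom (composite_cospan K) T,
  is_iso p /\ p ∘ cosp_rho H T (id_cospan B) = mu T ∘ (idm T ⊠ legr T).
Proof.
have v : is_hc (M := id_twodiag T) (N := id_twodiag (id_cospan B)) (X := id_twodiag _) _
  := hc_id K.
have [p [p' [e e1 e2]]] := hc_lunit v.
have pm := hc_lunit_la v e e; have := hc_lunit_pt v e.
rewrite !id_pt => pi.
have ep V : h1 p V ∘ h2 (cosp_rho H T (id_cospan B)) V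
    = h2 (mu T) V ∘ T ◁ h1 (legr T) V.
  by rewrite -h2D e h2_rb.
have {}pm : p ∘ mu (composite_cospan K) = mu T ∘ (p ⊠ p).
  by apply: h2_inj; rewrite h2D tensm_wlh1 compA h2_wl h2_h1 -compA; apply: pm.
pose ph := @AlgHom Z (composite_cospan K) T p pm pi.
have pl : ph ∘ legl (composite_cospan K) = legl T.
  apply: h1_inj; rewrite h1D !cmp_h1l; apply: homext => U x; hat_simp.
  by rw2 (ep _); rw2 (h1_iota (legr T) _); rw2 (mu1r _ _).
have pr : ph ∘ legr (composite_cospan K) = legr T.
  apply: h1_inj; rewrite h1D !cmp_h1r /= h1_id; apply: homext => U x; hat_simp.
  by rw2 (ep _); nfw (rw2 (mu1l _ _)).
by exists (CospanHom pl pr); split=> //; exists p'.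
Qed.

Lemma runit_hom (K : composite H (id_cospan A) T) :
  exists p : cospan_hom (composite_cospan K) T,
  is_iso p /\ p ∘ cosp_rho H (id_cospan A) T = mu T ∘ (legl T ⊠ idm T).
Proof.
have v : is_hc (M := id_twodiag (id_cospan A)) (N := id_twodiag T) (X := id_twodiag _) _
  := hc_id K.
have [p [p' [e e1 e2]]] := hc_runit v.
have pm := hc_runit_la v e e; have := hc_runit_pt v e.
rewrite !id_pt => pi.
have ep V : h1 p V ∘ h2 (cosp_rho H (id_cospan A) T) V
    = h2 (mu T) V ∘ h1 (legl T) _.
  by rewrite -h2D e h2_lb.
have {}pm : p ∘ mu (composite_cospan K) = mu T ∘ (p ⊠ p).
  by apply: h2_inj; rewrite h2D tensm_wlh1 compA h2_wl h2_h1 -compA; apply: pm.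
pose ph := @AlgHom Z (composite_cospan K) T p pm pi.
have pl : ph ∘ legl (composite_cospan K) = legl T.
  apply: h1_inj; rewrite h1D !cmp_h1l /= h1_id; apply: homext => U x; hat_simp.
  rw2 (ep _); rw2 (esym (wl_h1 (legl T) (h0 (iota T) _))).
  by rw2 (mu1r _ _).
have pr : ph ∘ legr (composite_cospan K) = legr T.
  apply: h1_inj; rewrite h1D !cmp_h1r; apply: homext => U x; hat_simp.
  by rw2 (ep _); rw2 (h1_iota (legl T) _); rw2 (mu1l _ _).
by exists (CospanHom pl pr); split=> //; exists p'.
Qed.
End Homs.
End Units.

(** * Associativity and interchange for composites *)

Section BraidSurjective.
Variable Z : braided.
Implicit Types D X Y V U : Z.

Lemma wl_hb_sur D X Y V U (x : hom U (D ⊗ (Y ⊗ (X ⊗ V)))) :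
  exists y, x = D ◁ hb X Y V ∘ y.
Proof.
by exists (D ◁ hbV X Y V ∘ x); rewrite compA -wlD hbVK wl_id comp1m.
Qed.

Lemma wl2_hb_sur D (D' : Z) X Y V U (x : hom U (D ⊗ (D' ⊗ (Y ⊗ (X ⊗ V))))) :
  exists y, x = D ◁ (D' ◁ hb X Y V) ∘ y.
Proof.
by exists (D ◁ (D' ◁ hbV X Y V) ∘ x); rewrite compA -!wlD hbVK !wl_id comp1m.
Qed.

End BraidSurjective.

Lemma vc_assoc (Z : braided) (H : coequalizer_assumption Z) (A B : comAlg Z)
    (R S T U : cospan A B) (M : twodiag R S) (N : twodiag S T) (P : twodiag T U)
    Y1 q1 X1 q2 Y2 q3 X2 q4 :
  @is_vc _ _ _ _ _ _ M N Y1 q1 -> @is_vc _ _ _ _ _ _ Y1 P X1 q2 ->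
  @is_vc _ _ _ _ _ _ N P Y2 q3 -> @is_vc _ _ _ _ _ _ M Y2 X2 q4 ->
  td_iso X1 X2.
Proof.
move=> v1 v2 v3 v4.
have [f [g [gf fg e]]] := rtensor_assoc H (vc_univ v3) (vc_univ v1)
  (vc_univ v4) (vc_univ v2) (vc_ra v3) (vc_la v1).
have e' W : h1 f W ∘ (h2 q2 W ∘ td_ob P ◁ h2 q1 W) = h2 q4 W ∘ h2 q3 _.
  by rewrite e h2D compA.
apply: (td_isoP (d := f) (d' := g)) => //; split=> [W|W|].
- apply: (univ_wl_epi H (vc_univ v2)); apply: (univ_wl2_epi H (vc_univ v1)).
  apply: homext => V x; hat_simp; rw3 (e' _); rw2 (esym (vc_la v2 _)).
  rw2 (esym (wl_h2 (tla P) (h2 q1 _))); rw3 (e' _).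
  by rw2 (esym (vc_la v4 _)); rw2 (esym (vc_la v3 _)).
- apply: (univ_epi (vc_univ v2)); apply: (univ_wl_epi H (vc_univ v1)).
  apply: homext => V x; hat_simp; rw2 (vc_ra v2 _); rw2 (vc_ra v1 _); rw3 (e' _).
  by rw3 (e' _); rw2 (vc_ra v4 _); nf.
apply: h0_inj; rewrite h0D (vc_h0 v2) (vc_h0 v1) (vc_h0 v4) (vc_h0 v3).
apply: homext => V x; hat_simp; rw2 (esym (wl_h0 (tpt P) (h2 q1 _))).
by rw3 (e' _).
Qed.

(** * The interchange law *)

Section Interchange.
Variables (Z : braided) (H : coequalizer_assumption Z) (A B C : comAlg Z).
Variables (S S' S'' : cospan A B) (T T' T'' : cospan B C).
Variables (K : composite H S T) (K' : composite H S' T').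
Variables (K'' : composite H S'' T'').
Variables (M : twodiag S S') (M' : twodiag S' S'').
Variables (N : twodiag T T') (N' : twodiag T' T'').
Variables (P1 : twodiag S S'') (q1 : hom (td_ob M' ⊗ td_ob M) (td_ob P1)).
Variables (P2 : twodiag T T'') (q2 : hom (td_ob N' ⊗ td_ob N) (td_ob P2)).
Variables (P : twodiag (composite_cospan K) (composite_cospan K'')).
Variables (q3 : hom (td_ob P1 ⊗ td_ob P2) (td_ob P)).
Variables (Q1 : twodiag (composite_cospan K') (composite_cospan K'')).
Variables (q4 : hom (td_ob M' ⊗ td_ob N') (td_ob Q1)).
Variables (Q2 : twodiag (composite_cospan K) (composite_cospan K')).
Variables (q5 : hom (td_ob M ⊗ td_ob N) (td_ob Q2)).
Variables (Q : twodiag (composite_cospan K) (composite_cospan K'')).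
Variables (q6 : hom (td_ob Q1 ⊗ td_ob Q2) (td_ob Q)).
Hypotheses (v1 : is_vc q1) (v2 : is_vc q2) (v3 : is_hc q3).
Hypotheses (v4 : is_hc q4) (v5 : is_hc q5) (v6 : is_vc q6).
Notation k' := (cosp_rho H S' T').

Let b1 := univ_bal (vc_univ v1).
Let b2 := univ_bal (vc_univ v2).
Let b5 := univ_bal (hc_univ v5).
Let b6 := univ_bal (vc_univ v6).

Lemma vc_rb : assoc (td_rb (td_on P1)) q1 q1 (td_rb (td_on M)).
Proof.
move=> W; rewrite !h2_rb; apply: homext => U x.
by nfw (rw2 (vc_ra v1 _)).
Qed.

Lemma vc_lb : assoc q2 (td_lb (td_on N')) (td_lb (td_on P2)) q2.
Proof.
move=> W; rewrite !h2_lb; apply: homext => U x; hat_simp.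
by rw2 (esym (wl_h1 (legl T'') (h2 q2 _))); rw2 (esym (vc_la v2 _)).
Qed.

Lemma interchange_map : exists g1, prodrel g1 q4 q5 q3 q1 q2.
Proof.
apply: (prodrel_exists H (hc_univ v4) (hc_univ v5) (univ_bal (hc_univ v3))).
- move=> W; rewrite !h2_rb; apply: homext => U x; hat_simp.
  by nfw (first [rw2 (b1 _) | rw2 (td_ar _ _) | rw2 (vc_ra v1 _)]).
- exact: vc_lb.
- exact: vc_rb.
- move=> W; rewrite !h2_lb; apply: homext => U x; hat_simp.
  rw2 (esym (b2 _)); rw2 (td_al _ _).
  by rw2 (esym (wl_h1 (legl T'') (h2 q2 _))); rw2 (esym (vc_la v2 _)); nf.
Qed.

Section Bimap.
Variable g1 : hom (td_ob Q1 ⊗ td_ob Q2) (td_ob P).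
Hypothesis e1 : prodrel g1 q4 q5 q3 q1 q2.
Variable g : hom (td_ob Q) (td_ob P).
Hypothesis eg : g ∘ q6 = g1.

Lemma interchange_bal : assoc g1 (tra Q1) g1 (tla Q2).
Proof.
exact: (prodrel_assoc H (hc_univ v4) (cosp_rho_univ H S' T') (hc_univ v5)
  e1 (hc_ra v4) e1 (hc_la v5) b1 b2).
Qed.

Lemma interchange_bimap : bimap g.
Proof.
have eg' W : h1 g W ∘ h2 q6 W = h2 g1 W by rewrite -h2D eg.
have al := prodrel_assoc H (cosp_rho_univ H S'' T'') (hc_univ v4) (hc_univ v5)
  e1 (hc_la v4) (hc_la v3) e1 (vc_la v1) (vc_la v2).
have ar := prodrel_assoc H (hc_univ v4) (hc_univ v5) (cosp_rho_univ H S T)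
  (hc_ra v3) e1 e1 (hc_ra v5) (vc_ra v1) (vc_ra v2).
split=> [W|W|].
- apply: (univ_wl_epi H (vc_univ v6)); apply: homext => U x; hat_simp.
  rw2 (esym (vc_la v6 _)); rw2 (eg' _); rw2 (eg' _).
  by rw2 (al _).
- apply: (univ_epi (vc_univ v6)); apply: homext => U x; hat_simp.
  rw2 (vc_ra v6 _); rw2 (eg' _); rw2 (eg' _).
  by rw2 (ar _).
apply: h0_inj; rewrite h0D (vc_h0 v6) (hc_h0 v4) (hc_h0 v5) (hc_h0 v3).
rewrite (vc_h0 v1) (vc_h0 v2); apply: homext => U x; hat_simp.
rw2 (eg' _); rw2 (esym (wl_h0 (tpt N') (h2 q5 _))).
by rw2 (esym (wl_h0 (tpt M') (_ ◁ h2 q5 _))); rw3 (e1 _); nf.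
Qed.
End Bimap.

(* The actions of [s ⊗ 1] and [1 ⊗ t] move elements across [q6]. *)
Lemma slide_l W : h2 q6 W ∘ (h2 q4 _ ∘ (h2 (tra M') _
    ∘ (td_ob M' ◁ (S' ◁ (td_ob N' ◁ h2 q5 W)) ∘ td_ob M' ◁ hb (td_ob N') S' _)))
  = h2 q6 W ∘ (h2 q4 _ ∘ td_ob M' ◁ (td_ob N' ◁ (h2 q5 W ∘ h2 (tla M) _))).
Proof.
pose c := k' ∘ (idm S' ⊠ iota T') ∘ rgtV S'.
have ec V : h1 c V = h2 k' V ∘ (S' ◁ h0 (iota T') V ∘ h1 (idm S') V).
  by rewrite h1_rgtV !h1_id comp1m compm1.
have rN V : h2 (tra N') V ∘ _ ◁ h0 (iota T') V = h1 (idm _) V.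
  by rewrite td_1r h1_id.
have lN V : h2 (tla N) V ∘ h0 (iota T') _ = h1 (idm _) V by rewrite td_1l h1_id.
have er := prodrel_r0 (hc_ra v4) rN ec.
have el := prodrel_l0 (hc_la v5) lN ec.
apply: homext => U x; hat_simp.
have er' V : h2 (tra Q1) V ∘ (td_ob Q1 ◁ h1 c V ∘ h2 q4 (S' ⊗ V))
    = h2 q4 V ∘ (h2 (tra M') _ ∘ td_ob M' ◁ hb (td_ob N') S' V).
  by rewrite er !h1_id !wl_id !comp1m.
have el' V : h2 (tla Q2) V ∘ (h1 c _ ∘ S' ◁ h2 q5 V) = h2 q5 V ∘ h2 (tla M) _.
  by rewrite el !h1_id !wl_id !compm1.
rw2 (wl_hb _ _ (h2 q5 _)).
rw3 (esym (er' _)); rw2 (b6 _); rw2 (esym (wl_h2 q4 (S' ◁ h2 q5 _))).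
by rw3 (el' _); nf.
Qed.

Lemma slide_r W : h2 q6 W ∘ (h2 q4 _ ∘ (td_ob M' ◁ h2 (tra N') _
    ∘ td_ob M' ◁ (td_ob N' ◁ (T' ◁ h2 q5 W))))
  = h2 q6 W ∘ (h2 q4 _ ∘ td_ob M' ◁ (td_ob N' ◁ (h2 q5 W
    ∘ (td_ob M ◁ h2 (tla N) W ∘ hb T' (td_ob M) _)))).
Proof.
pose c := k' ∘ (iota S' ⊠ idm T') ∘ lamV T'.
have ec V : h1 c V = h2 k' V ∘ (h0 (iota S') _ ∘ h1 (idm T') V).
  by rewrite h1_lamV.
have rM V : h2 (tra M') V ∘ _ ◁ h0 (iota S') V = h1 (idm _) V.
  by rewrite td_1r h1_id.
have lM V : h2 (tla M) V ∘ h0 (iota S') _ = h1 (idm _) V by rewrite td_1l h1_id.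
have er := prodrel_0r (hc_ra v4) rM ec.
have el := prodrel_0l (hc_la v5) lM ec.
apply: homext => U x; hat_simp.
have er' V : h2 (tra Q1) V ∘ (td_ob Q1 ◁ h1 c V ∘ h2 q4 (T' ⊗ V))
    = h2 q4 V ∘ td_ob M' ◁ h2 (tra N') _.
  by rewrite er !h1_id !wl_id !comp1m compm1.
have el' V : h2 (tla Q2) V ∘ (h1 c _ ∘ T' ◁ h2 q5 V)
    = h2 q5 V ∘ (td_ob M ◁ h2 (tla N) _ ∘ hb T' (td_ob M) _).
  by rewrite el !h1_id !wl_id !comp1m.
rw2 (esym (er' _)); rw2 (b6 _); rw2 (esym (wl_h2 q4 (T' ◁ h2 q5 _))).
by rw3 (el' _); nf.
Qed.

(** The map [h] is the candidate inverse on representatives, known only through its composite with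
    the braiding of [N'] and [M]. Its balance over [S'] and over [T'] is [slide_l] and [slide_r]. *)
Lemma interchange_inv_ex
    (h : hom (td_ob M' ⊗ (td_ob M ⊗ (td_ob N' ⊗ (td_ob N ⊗ unit_ob))))
      (td_ob Q ⊗ unit_ob)) :
  (forall X (x : hom X _), h ∘ (td_ob M' ◁ hb (td_ob N') (td_ob M) _ ∘ x)
    = h2 q6 unit_ob ∘ (h2 q4 _
      ∘ (td_ob M' ◁ (td_ob N' ◁ h2 q5 unit_ob) ∘ x))) ->
  exists f1,
  h2 f1 unit_ob ∘ (h2 q1 _ ∘ td_ob M' ◁ (td_ob M ◁ h2 q2 unit_ob)) = h.
Proof.
move=> hK.
apply: (biuniv_ex H (vc_univ v1) (vc_univ v2)); apply: homext => U x.
  (* Braidings being invertible, the test map may be assumed to pass through them, which brings the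
     composites into the form required by [hK]. *)
  have [x1 ->] := wl2_hb_sur x; have [y ->] := wl_hb_sur x1.
  have sl := congr1 (fun k => k ∘ y) (slide_l unit_ob).
  rewrite -?compA ?wlD -?compA in sl.
  rewrite -!compA; rw2 (esym (wl_h2 (tra M') (hb (td_ob N') (td_ob M) _))).
  rewrite hK; nf; rewrite sl; hat_simp.
  rw3 (esym (hb_h2r _ _ (tla M))); by rewrite hK.
have [x1 ->] := wl_hb_sur x; have [y ->] := wl2_hb_sur x1.
have sl := congr1 (fun k => k ∘ y) (slide_r unit_ob).
rewrite -?compA ?wlD -?compA in sl.
rewrite -!compA; rw3 (esym (hb_h2l _ _ (tra N'))).
rewrite hK; nf; rewrite sl; hat_simp.
by rw2 (wl_hb _ _ (h2 (tla N) _)); rewrite hK.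
Qed.

(** Balance over [B] passes through [T']: an element of [B] acting on [M] crosses [q5] to act on [N]
    through [legl T'], [slide_r] moves it to a right action on [N'], and [td_al] makes that a left
    action through [legl T'']. *)
Lemma interchange_inv_bal
    (h : hom (td_ob M' ⊗ (td_ob M ⊗ (td_ob N' ⊗ (td_ob N ⊗ unit_ob))))
      (td_ob Q ⊗ unit_ob)) (f1 : hom (td_ob P1 ⊗ td_ob P2) (td_ob Q)) :
  (forall X (x : hom X _), h ∘ (td_ob M' ◁ hb (td_ob N') (td_ob M) _ ∘ x)
    = h2 q6 unit_ob ∘ (h2 q4 _
      ∘ (td_ob M' ◁ (td_ob N' ◁ h2 q5 unit_ob) ∘ x))) ->
  h2 f1 unit_ob ∘ (h2 q1 _ ∘ td_ob M' ◁ (td_ob M ◁ h2 q2 unit_ob)) = h ->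
  h2 f1 unit_ob ∘ h2 (td_rb (td_on P1)) _
    = h2 f1 unit_ob ∘ td_ob P1 ◁ h2 (td_lb (td_on P2)) _.
Proof.
move=> hK eh.
have eh' X (x : hom X _) : h2 f1 unit_ob
    ∘ (h2 q1 _ ∘ (td_ob M' ◁ (td_ob M ◁ h2 q2 unit_ob) ∘ x)) = h ∘ x.
  by rewrite -eh -!compA.
apply: (univ_wl2_epi H (vc_univ v2)); apply: (univ_epi (vc_univ v1)).
apply: homext => U x; hat_simp.
rw2 (esym (vc_lb _)); nf; rw2 (vc_rb _).
rw2 (esym (wl_h2 (td_rb (td_on M)) (h2 q2 _))); rewrite !eh' {eh eh'}.
have [x1 ->] := wl2_hb_sur x; have [x2 ->] := wl_hb_sur x1.
have [y ->] := wl2_hb_sur x2.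
rw3 (esym (hb_h2r _ _ (td_rb (td_on M)))); rewrite hK; rw2 (b5 _).
rewrite !h2_lb; hat_simp; rw3 (esym (td_al (td_on N') _)).
rw2 (wl_hb _ _ (h1 (legl T') _)); rw2 (esym (hb_h1l _ _ (legl T'))).
rw3 (esym (hb_h2l _ _ (tra N'))); rewrite hK; nf.
have sl := congr1 (fun k => k ∘ (td_ob M' ◁ (td_ob N' ◁ h1 (legl T') _) ∘ y))
  (slide_r unit_ob).
rewrite -?compA ?wlD -?compA in sl.
rw2 (esym (wl_h1 (legl T') (h2 q5 _))); rewrite sl.
by nf.
Qed.

Lemma interchange : td_iso P Q.
Proof.
have [g1 e1] := interchange_map.
have [g eg] := univ_ext (vc_univ v6) (interchange_bal e1).
have bg := interchange_bimap e1 eg.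
pose h := h2 q6 unit_ob ∘ (h2 q4 _ ∘ (td_ob M' ◁ (td_ob N' ◁ h2 q5 unit_ob)
  ∘ td_ob M' ◁ hbV (td_ob N') (td_ob M) (td_ob N ⊗ unit_ob))).
have hV X (x : hom X _) : h ∘ x = h2 q6 unit_ob ∘ (h2 q4 _
    ∘ (td_ob M' ◁ (td_ob N' ◁ h2 q5 unit_ob)
    ∘ (td_ob M' ◁ hbV (td_ob N') (td_ob M) (td_ob N ⊗ unit_ob) ∘ x))).
  by rewrite /h -!compA.
clearbody h.
have hK X (x : hom X _) : h ∘ (td_ob M' ◁ hb (td_ob N') (td_ob M) _ ∘ x)
    = h2 q6 unit_ob ∘ (h2 q4 _ ∘ (td_ob M' ◁ (td_ob N' ◁ h2 q5 unit_ob) ∘ x)).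
  by rewrite hV; rw2 (hbK _ _ _).
have [f1 ef1] := interchange_inv_ex hK.
have [f ef] := univ_ext_unit (hc_univ v3) (interchange_inv_bal hK ef1).
have fE : h1 f unit_ob ∘ h2 q3 unit_ob = h2 f1 unit_ob by rewrite -h2D ef.
have gE : h1 g unit_ob ∘ h2 q6 unit_ob = h2 g1 unit_ob by rewrite -h2D eg.
have f1E X (x : hom X _) : h2 f1 unit_ob
    ∘ (h2 q1 _ ∘ (td_ob M' ◁ (td_ob M ◁ h2 q2 unit_ob) ∘ x)) = h ∘ x.
  by rewrite -ef1 -!compA.
(* Linearity was shown for [g] alone; its inverse [f] inherits it by [bimap_inv]. *)
apply: td_iso_sym; apply: (td_isoP bg (d' := f)).
  apply: (univ_inj (vc_univ v6)); apply: h2_inj.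
  apply: (biuniv_inj H (hc_univ v4) (hc_univ v5)); apply: homext => U x.
  rewrite !h2D !h1D h1_id; hat_simp; rewrite (ap2 gE); rw3 (e1 _).
  by rewrite (ap2 fE) f1E hK.
apply: (univ_inj (hc_univ v3)); apply: h2_inj.
apply: (biuniv_inj H (vc_univ v1) (vc_univ v2)); apply: homext => U x.
rewrite !h2D !h1D h1_id; hat_simp; rewrite (ap2 fE) f1E hV (ap2 gE).
by rw3 (e1 _); rw2 (hbVK _ _ _).
Qed.
End Interchange.

(** * The bicategory *)

Section Companions.
Variables (Z : braided) (A B : comAlg Z).
Implicit Types S T : cospan A B.

Lemma companion_ext S T (p q : cospan_hom S T) : p = q :> hom _ _ ->
  td_iso (companion p) (companion q).
Proof.
move=> e; apply: (@td_isoP _ _ _ _ _ (companion p) (companion q) (idm T) (idm T));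
  rewrite ?comp1m //.
split=> [W|W|].
- by rewrite h1_id wl_id comp1m compm1.
- by rewrite !h1_id !companion_ra e comp1m compm1.
- by rewrite comp1m (companion_pt p) (companion_pt q).
Qed.

Lemma cospan_hom_comp S T U (p : cospan_hom S T) (q : cospan_hom T U) :
  exists r : cospan_hom S U, q ∘ p = r :> hom _ _.
Proof.
have rm : q ∘ p ∘ mu S = mu U ∘ ((q ∘ p) ⊠ (q ∘ p)).
  by rewrite -compA ahom_mu compA ahom_mu -compA tensm_comp.
have ri : q ∘ p ∘ iota S = iota U by rewrite -compA !ahom_iota.
have rl : AlgHom rm ri ∘ legl S = legl U by rewrite -compA !chom_legl.
have rr : AlgHom rm ri ∘ legr S = legr U by rewrite -compA !chom_legr.
by exists (CospanHom rl rr).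
Qed.

Lemma cospan_hom_id S : exists p : cospan_hom S S, idm S = p :> hom _ _.
Proof.
have pl : id_alghom S ∘ legl S = legl S by rewrite comp1m.
have pr : id_alghom S ∘ legr S = legr S by rewrite comp1m.
by exists (CospanHom pl pr).
Qed.
End Companions.

(** * Existence of the operations *)

Section Existence.
Variables (Z : braided) (H : coequalizer_assumption Z).

Lemma exists_inhabited (X : Type) : inhabited X -> exists x : X, True.
Proof. by case=> x; exists x. Qed.

Lemma inhabited_choice (X : Type) : inhabited X -> X.
Proof.
case/exists_inhabited/constructive_indefinite_description => x _; exact: x.
Qed.

Definition comp_choice (A B C : comAlg Z) (S : cospan A B) (T : cospan B C) :
  composite H S T := inhabited_choice (composite_ex H S T).

(** Representatives of both classes are chosen; independence of the choice is [vc_iso], used in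
    [vcomp_choiceP]. *)
Definition vcomp_choice (A B : comAlg Z) (R S T : cospan A B) (c : cell S T)
    (d : cell R S) : cell R T :=
  class_of (TwoDiag (proj1_sig (constructive_indefinite_description _
    (vc_ex H (proj1_sig (cellP d)) (proj1_sig (cellP c)))))).

Lemma vcomp_choiceP (A B : comAlg Z) (R S T : cospan A B)
    (M : twodiag R S) (N : twodiag S T) :
  exists2 F : twodiag_on R T (vtensor H M N), is_vcomp F &
    vcomp_choice (class_of N) (class_of M) = class_of (TwoDiag F).
Proof.
have [F vF] := vc_ex H M N; exists F => //; rewrite /vcomp_choice.
case: cellP => N' eN; case: cellP => M' eM /=.
case: constructive_indefinite_description => F' /= vF'.
apply: class_of_eq; apply: (vc_iso H (is_vcompP vF') (is_vcompP vF)).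
  exact/td_iso_sym/class_of_inj.
exact/td_iso_sym/class_of_inj.
Qed.

Definition hcomp_choice (A B C : comAlg Z) (T T' : cospan B C)
    (S S' : cospan A B) (c : cell T T') (d : cell S S') :
    cell (composite_cospan (comp_choice S T))
      (composite_cospan (comp_choice S' T')) :=
  class_of (TwoDiag (proj1_sig (constructive_indefinite_description _
    (hc_ex (comp_choice S T) (comp_choice S' T')
      (proj1_sig (cellP d)) (proj1_sig (cellP c)))))).

Lemma hcomp_choiceP (A B C : comAlg Z) (T T' : cospan B C)
    (S S' : cospan A B) (N : twodiag T T') (M : twodiag S S') :
  exists2 F : twodiag_on (composite_cospan (comp_choice S T))
      (composite_cospan (comp_choice S' T')) (htensor H M N), is_hcomp F &
    hcomp_choice (class_of N) (class_of M) = class_of (TwoDiag F).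
Proof.
have [F vF] := hc_ex (comp_choice S T) (comp_choice S' T') M N.
exists F => //; rewrite /hcomp_choice.
case: cellP => N' eN; case: cellP => M' eM /=.
case: constructive_indefinite_description => F' /= vF'.
apply: class_of_eq; apply: (hc_iso (is_hcompP vF') (is_hcompP vF)).
  exact/td_iso_sym/class_of_inj.
exact/td_iso_sym/class_of_inj.
Qed.

Lemma assoc_choice (A B C D : comAlg Z) (R : cospan C D) (S : cospan B C)
    (T : cospan A B)
    (cc := fun A B C S T => composite_cospan (@comp_choice A B C S T)) :
  {c : cell (cc _ _ _ T (cc _ _ _ S R)) (cc _ _ _ (cc _ _ _ T S) R) |
    exists p : cospan_hom (cc _ _ _ T (cc _ _ _ S R)) (cc _ _ _ (cc _ _ _ T S) R),
      [/\ is_iso p,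
          p ∘ cosp_rho H T (cc _ _ _ S R) ∘ (idm T ⊠ cosp_rho H S R)
          = cosp_rho H (cc _ _ _ T S) R ∘ (cosp_rho H T S ⊠ idm R)
            ∘ alphaV T S R
        & c = class_of (companion p)]}.
Proof.
apply: constructive_indefinite_description.
have [p [pi /assocE ep]] := assoc_hom
  (comp_choice T (cc _ _ _ S R)) (comp_choice (cc _ _ _ T S) R).
exists (class_of (companion p)), p; split=> //.
by rewrite ep -!compA alphaVK compm1.
Qed.

Lemma lunit_choice (A B : comAlg Z) (T : cospan A B)
    (K := composite_cospan (comp_choice T (id_cospan B))) :
  {c : cell K T | exists p : cospan_hom K T,
    [/\ is_iso p,
        p ∘ cosp_rho H T (id_cospan B) = mu T ∘ (idm T ⊠ legr T)
      & c = class_of (companion p)]}.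
Proof.
apply: constructive_indefinite_description.
have [p [pi ep]] := lunit_hom (comp_choice T (id_cospan B)).
by exists (class_of (companion p)), p.
Qed.

Lemma runit_choice (A B : comAlg Z) (T : cospan A B)
    (K := composite_cospan (comp_choice (id_cospan A) T)) :
  {c : cell K T | exists p : cospan_hom K T,
    [/\ is_iso p,
        p ∘ cosp_rho H (id_cospan A) T = mu T ∘ (legl T ⊠ idm T)
      & c = class_of (companion p)]}.
Proof.
apply: constructive_indefinite_description.
have [p [pi ep]] := runit_hom (comp_choice (id_cospan A) T).
by exists (class_of (companion p)), p.
Qed.

Lemma CALG_data_ex : inhabited (CALG_data H).
Proof.
constructor.
exact: (@CALGData Z H comp_choice _ vcomp_choiceP _ hcomp_choiceP
  _ (fun A B C D R S T => proj2_sig (assoc_choice R S T))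
  _ (fun A B T => proj2_sig (lunit_choice T))
  _ (fun A B T => proj2_sig (runit_choice T))).
Qed.
End Existence.

(** * The bicategory axioms *)

Section Bicategory.
Variables (Z : braided) (H : coequalizer_assumption Z) (d : CALG_data H).
Notation ccomp S T := (cg_cosp d S T).

(** Any model of the composite computes the operation of the given [d], by uniqueness of composites
    up to isomorphism. With [hcE], this makes the axioms independent of [d]. *)
Lemma vcE (A B : comAlg Z) (R S T : cospan A B) M N X q :
  @is_vc _ _ _ R S T M N X q ->
  cg_vcomp d (class_of N) (class_of M) = class_of X.
Proof.
move=> v; have [F vF ->] := cg_vcompP d M N; apply: class_of_eq.
exact: (vc_iso H (is_vcompP vF) v (td_iso_refl M) (td_iso_refl N)).
Qed.

Lemma vc_total (A B : comAlg Z) (R S T : cospan A B) (M : twodiag R S)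
    (N : twodiag S T) : exists X q, @is_vc _ _ _ R S T M N X q.
Proof.
have [F vF] := vc_exists H
  (rho_univ H (bim_r (td_bim (td_on N))) (bim_l (td_bim (td_on M)))).
by exists (TwoDiag F); eexists; apply: vF.
Qed.

Lemma hcE (A B C : comAlg Z) (S S' : cospan A B) (T T' : cospan B C) M N X q :
  @is_hc Z H A B C S S' T T' (cg_comp d S T) (cg_comp d S' T') M N X q ->
  cg_hcomp d (class_of N) (class_of M) = class_of X.
Proof.
move=> v; have [F vF ->] := cg_hcompP d N M; apply: class_of_eq.
exact: (hc_iso (is_hcompP vF) v (td_iso_refl M) (td_iso_refl N)).
Qed.

Lemma hc_total (A B C : comAlg Z) (S S' : cospan A B) (T T' : cospan B C)
    (M : twodiag S S') (N : twodiag T T') :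
  exists X q, @is_hc Z H A B C S S' T T' (cg_comp d S T) (cg_comp d S' T') M N X q.
Proof.
have [F vF] := hc_exists (cg_comp d S T) (cg_comp d S' T') M N.
by exists (TwoDiag F); eexists; apply: vF.
Qed.

Lemma vcomp_companion (A B : comAlg Z) (R S T : cospan A B)
    (p : cospan_hom R S) (q : cospan_hom S T) (r : cospan_hom R T) :
  q ∘ p = r :> hom _ _ ->
  cg_vcomp d (class_of (companion q)) (class_of (companion p))
  = class_of (companion r).
Proof. by move=> e; apply: vcE (vc_companion e). Qed.

Lemma hcomp_companion (A B C : comAlg Z) (S S' : cospan A B) (T T' : cospan B C)
    (p : cospan_hom S S') (q : cospan_hom T T')
    (r : cospan_hom (ccomp S T) (ccomp S' T')) :
  r ∘ cosp_rho H S T = cosp_rho H S' T' ∘ (p ⊠ q) ->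
  cg_hcomp d (class_of (companion q)) (class_of (companion p))
  = class_of (companion r).
Proof. by move=> e; apply: hcE (hc_companion e). Qed.

Lemma invertible_companion (A B : cell0 (CALG d)) (S T : cospan A B)
    (p : cospan_hom S T) : is_iso p ->
  @invertible2 (CALG d) A B S T (class_of (companion p)).
Proof.
move=> /cospan_hom_inv [q [e1 e2]]; exists (class_of (companion q)).
have [iS eS] := cospan_hom_id S; have [iT eT] := cospan_hom_id T.
split; rewrite /=.
  rewrite (@vcomp_companion _ _ _ _ _ p q iS) ?e1 //.
  exact: class_of_eq (companion_id eS).
rewrite (@vcomp_companion _ _ _ _ _ q p iT) ?e2 //.
exact: class_of_eq (companion_id eT).
Qed.

(** Both composites are represented by [E] with its right action restricted along [p]. *)
Lemma companion_nat (A B : comAlg Z) (S S' T T' : cospan A B)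
    (p : cospan_hom S T) (p' : cospan_hom S' T')
    (D : twodiag S S') (E : twodiag T T') (f : hom (td_ob D) (td_ob E)) g :
  is_iso p' -> g ∘ f = idm _ -> f ∘ g = idm _ ->
  (forall W, h1 f W ∘ h2 (tla D) W = h2 (tla E) W ∘ (h1 p' _ ∘ S' ◁ h1 f W)) ->
  (forall W, h1 f W ∘ h2 (tra D) W = h2 (tra E) W ∘ (h1 f _ ∘ td_ob D ◁ h1 p W)) ->
  f ∘ tpt D = tpt E ->
  cg_vcomp d (class_of (companion p')) (class_of D)
  = cg_vcomp d (class_of E) (class_of (companion p)).
Proof.
move=> ip e1 e2 fl fr fp; have [X [el er ep]] := restrict_ex p E.
rewrite (vcE (vc_square el er ep ip e1 e2 fl fr fp)).
by rewrite (vcE (vc_restrict el er ep)).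
Qed.

Lemma cg_assocE (A B C D : comAlg Z) (R : cospan C D) (S : cospan B C)
    (T : cospan A B) :
  exists p : cospan_hom (ccomp T (ccomp S R)) (ccomp (ccomp T S) R),
  [/\ is_iso p, cg_assoc d R S T = class_of (companion p)
    & assoc (cosp_rho H (ccomp T S) R) (cosp_rho H T S)
        (p ∘ cosp_rho H T (ccomp S R)) (cosp_rho H S R)].
Proof.
have [p [ip ep ->]] := cg_assocP d R S T; exists p; split=> //.
by apply: assocP; rewrite ep -!compA alphaK compm1.
Qed.

Lemma h1_whisker (A B C : comAlg Z) (S S' : cospan A B) (T T' : cospan B C)
    (p : cospan_hom S S') (q : cospan_hom T T')
    (r : cospan_hom (ccomp S T) (ccomp S' T')) :
  r ∘ cosp_rho H S T = cosp_rho H S' T' ∘ (p ⊠ q) -> forall W,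
  h1 r W ∘ h2 (cosp_rho H S T) W
  = h2 (cosp_rho H S' T') W ∘ (h1 p _ ∘ S ◁ h1 q W).
Proof. by move=> e W; rewrite -h2D e tensm_wlh1 compA h2_wl h2_h1 -compA. Qed.

Lemma h1_assoc (X Y V X' Y' V' V'' : Z) (p1 : hom (X' ⊗ V) V')
    (p2 : hom (X ⊗ Y) X') (a : hom V'' V') (p3 : hom (X ⊗ Y') V'')
    (p4 : hom (Y ⊗ V) Y') : assoc p1 p2 (a ∘ p3) p4 ->
  forall W, h1 a W ∘ (h2 p3 W ∘ X ◁ h2 p4 W) = h2 p1 W ∘ h2 p2 _.
Proof. by move=> e W; rewrite e h2D compA. Qed.

Lemma CALG_bicategory : is_bicategory (CALG d).
Proof.
split=> /=.
- move=> A B e f g h c b a.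
  have [P ->] := cellP c; have [N ->] := cellP b; have [M ->] := cellP a.
  have [Y1 [q1 v1]] := vc_total M N; have [X1 [q2 v2]] := vc_total Y1 P.
  have [Y2 [q3 v3]] := vc_total N P; have [X2 [q4 v4]] := vc_total M Y2.
  rewrite (vcE v1) (vcE v2) (vcE v3) (vcE v4).
  exact: class_of_eq (vc_assoc H v1 v2 v3 v4).
- move=> A B f g a; have [M ->] := cellP a; exact: vcE (vc_idl M).
- move=> A B f g a; have [M ->] := cellP a; exact: vcE (vc_idr M).
- move=> A B C g f; exact: hcE (hc_id _).
- move=> A B C g g' g'' f f' f'' b' b a' a.
  have [M ->] := cellP a; have [M' ->] := cellP a'.
  have [N ->] := cellP b; have [N' ->] := cellP b'.
  have [P1 [q1 v1]] := vc_total M M'; have [P2 [q2 v2]] := vc_total N N'.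
  have [P [q3 v3]] := hc_total P1 P2; have [Q1 [q4 v4]] := hc_total M' N'.
  have [Q2 [q5 v5]] := hc_total M N; have [Q [q6 v6]] := vc_total Q2 Q1.
  rewrite (vcE v1) (vcE v2) (hcE v3) (hcE v4) (hcE v5) (vcE v6).
  exact: class_of_eq (interchange v1 v2 v3 v4 v5 v6).
- move=> A B C D h g f; have [p [ip -> _]] := cg_assocE h g f.
  exact: invertible_companion.
- move=> A B C D h h' g g' f f' c b a.
  have [M3 ->] := cellP c; have [M2 ->] := cellP b; have [M1 ->] := cellP a.
  have [X23 [q2 v2]] := hc_total M2 M3; have [XL [q4 v4]] := hc_total M1 X23.
  have [X12 [q1 v1]] := hc_total M1 M2; have [XR [q3 v3]] := hc_total X12 M3.
  rewrite (hcE v2) (hcE v4) (hcE v1) (hcE v3).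
  have [p [_ -> ep]] := cg_assocE h g f.
  have [p' [ip' -> ep']] := cg_assocE h' g' f'.
  have [u [u' [e1 e2 eu]]] := hc_assoc v1 v2 v3 v4.
  apply: (companion_nat ip' e1 e2).
  + exact: (hc_assoc_la v1 v2 v3 v4 eu ep').
  + exact: (hc_assoc_ra v1 v2 v3 v4 eu ep).
  + exact: (hc_assoc_pt v1 v2 v3 v4 eu).
- move=> A B f; have [p [ip _ ->]] := cg_lunitP d f.
  exact: invertible_companion.
- move=> A B f f' a; have [M ->] := cellP a.
  have [X [q v]] := hc_total M (id_twodiag (id_cospan B)); rewrite (hcE v).
  have [p [_ ep ->]] := cg_lunitP d f; have [p' [ip' ep' ->]] := cg_lunitP d f'.
  have [u [u' [eu e1 e2]]] := hc_lunit v.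
  apply: (companion_nat ip' e1 e2).
  + exact: (hc_lunit_la v eu ep').
  + exact: (hc_lunit_ra v eu ep).
  + exact: (hc_lunit_pt v eu).
- move=> A B f; have [p [ip _ ->]] := cg_runitP d f.
  exact: invertible_companion.
- move=> A B f f' a; have [M ->] := cellP a.
  have [X [q v]] := hc_total (id_twodiag (id_cospan A)) M; rewrite (hcE v).
  have [p [_ ep ->]] := cg_runitP d f; have [p' [ip' ep' ->]] := cg_runitP d f'.
  have [u [u' [eu e1 e2]]] := hc_runit v.
  apply: (companion_nat ip' e1 e2).
  + exact: (hc_runit_la v eu ep').
  + exact: (hc_runit_ra v eu ep).
  + exact: (hc_runit_pt v eu).
- move=> A B C D E S4 S3 S2 S1.
  have [a1 [_ -> e1]] := cg_assocE S4 S3 (ccomp S1 S2).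
  have [a2 [_ -> e2]] := cg_assocE (ccomp S3 S4) S2 S1.
  have [a3 [_ -> e3]] := cg_assocE S3 S2 S1.
  have [a4 [_ -> e4]] := cg_assocE S4 (ccomp S2 S3) S1.
  have [a5 [_ -> e5]] := cg_assocE S4 S3 S2.
  have [i1 ei1] := cospan_hom_id S1; have [i4 ei4] := cospan_hom_id S4.
  (* Once identity 2-cells are written as classes of [companion], the pentagon becomes an equation
     between morphisms of cospans. *)
  rewrite -(class_of_eq (companion_id ei1)) -(class_of_eq (companion_id ei4)).
  have [r3 er3] := whisker_ex (cg_comp d (ccomp S1 (ccomp S2 S3)) S4)
    (cg_comp d (ccomp (ccomp S1 S2) S3) S4) a3 i4.
  have [r5 er5] := whisker_ex (cg_comp d S1 (ccomp S2 (ccomp S3 S4)))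
    (cg_comp d S1 (ccomp (ccomp S2 S3) S4)) i1 a5.
  have [m1 em1] := cospan_hom_comp a2 a1; have [m2 em2] := cospan_hom_comp r5 a4.
  have [m3 em3] := cospan_hom_comp m2 r3.
  rewrite (hcomp_companion er3) (hcomp_companion er5) (vcomp_companion em1).
  rewrite (vcomp_companion em2) (vcomp_companion em3).
  apply/class_of_eq/companion_ext; rewrite -em1 -em3 -em2.
  have w3 := h1_whisker er3; have w5 := h1_whisker er5.
  rewrite -ei4 in w3; rewrite -ei1 in w5.
  move/h1_assoc: e1 => e1; move/h1_assoc: e2 => e2; move/h1_assoc: e3 => e3.
  move/h1_assoc: e4 => e4; move/h1_assoc: e5 => e5.
  (* Three nested quotient maps are cancelled; on the plain product of the four algebras each
     associator only rebrackets. *)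
  apply: (univ_inj (cosp_rho_univ H S1 (ccomp S2 (ccomp S3 S4)))).
  apply: h2_inj.
  apply: (univ_wl_epi H (cosp_rho_univ H S2 (ccomp S3 S4))).
  apply: (univ_wl2_epi H (cosp_rho_univ H S3 S4)).
  apply: homext => U x; rewrite !h2D !h1D; hat_simp.
  rw3 (e2 _).
  rw2 (esym (wl_h2 (cosp_rho H S1 S2) (h2 (cosp_rho H S3 S4) _))); rw3 (e1 _).
  rw2 (w5 _); rewrite h1_id; hat_simp; rw3 (e5 _); rw3 (e4 _).
  by rw2 (w3 _); rewrite h1_id; hat_simp; rw3 (e3 _).
move=> A B C S2 S1.
have [a [_ -> e]] := cg_assocE S2 (id_cospan B) S1.
have [l [_ el ->]] := cg_lunitP d S1; have [r [_ er ->]] := cg_runitP d S2.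
have [i1 ei1] := cospan_hom_id S1; have [i2 ei2] := cospan_hom_id S2.
rewrite -(class_of_eq (companion_id ei1)) -(class_of_eq (companion_id ei2)).
have [u eu] := whisker_ex (cg_comp d (ccomp S1 (id_cospan B)) S2)
  (cg_comp d S1 S2) l i2.
have [v ev] := whisker_ex (cg_comp d S1 (ccomp (id_cospan B) S2))
  (cg_comp d S1 S2) i1 r.
have [m em] := cospan_hom_comp a u.
rewrite (hcomp_companion eu) (hcomp_companion ev) (vcomp_companion em).
apply/class_of_eq/companion_ext; rewrite -em.
have wu := h1_whisker eu; have wv := h1_whisker ev.
rewrite -ei2 in wu; rewrite -ei1 in wv; move/h1_assoc: e => e.
have el' W : h1 l W ∘ h2 (cosp_rho H S1 (id_cospan B)) W
    = h2 (mu S1 ∘ (idm S1 ⊠ legr S1)) W by rewrite -el h2D.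
have er' W : h1 r W ∘ h2 (cosp_rho H (id_cospan B) S2) W
    = h2 (mu S2 ∘ (legl S2 ⊠ idm S2)) W by rewrite -er h2D.
apply: (univ_inj (cosp_rho_univ H S1 (ccomp (id_cospan B) S2))).
apply: h2_inj; apply: (univ_wl_epi H (cosp_rho_univ H (id_cospan B) S2)).
apply: homext => U x; rewrite !h2D !h1D; hat_simp.
rw3 (e _); rw2 (wu _); rewrite h1_id; hat_simp; rw2 (el' _).
rw2 (wv _); rewrite h1_id; hat_simp; rw2 (er' _).
(* What remains of the triangle is that an element of [B] may act on either side of [S1 ⊗_B S2]. *)
by rw2 (univ_bal (cosp_rho_univ H S1 S2) _).
Qed.
End Bicategory.

Theorem theorem4p19 (Z : braided) (H : coequalizer_assumption Z) :
  inhabited (CALG_data H) /\ forall d : CALG_data H, is_bicategory (CALG d).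
Proof. by split; [exact: CALG_data_ex | exact: CALG_bicategory]. Qed.
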